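(* For every $\varepsilon>0$ there is a constant $C_\varepsilon>0$ such that for every $\lambda>1$, every eigenfunction $e_\lambda$ on $\mathbb{T}^3$ with $-\Delta e_\lambda=\lambda^2e_\lambda$, and every totally geodesic submanifold $\Sigma\subset\mathbb{T}^3$ of dimension $k\in\{1,2\}$: $$\|e_\lambda\|_{L^2(\Sigma)}\le C_\varepsilon\lambda^{\frac13+\varepsilon}\|e_\lambda\|_{L^2(\mathbb{T}^3)}\quad\text{when }k=1,$$ $$\|e_\lambda\|_{L^2(\Sigma)}\le C_\varepsilon\lambda^{\frac1{12}+\varepsilon}\|e_\lambda\|_{L^2(\mathbb{T}^3)}\quad\text{when }k=2.$$ The constants are independent of $\Sigma$ and $\lambda$.
   Context: $\mathbb{T}^3=\mathbb{R}^3/(2\pi\mathbb{Z})^3$ is the standard flat torus and $\Delta$ its Laplace-Beltrami operator. Eigenfunctions are complex valued; those with $-\Delta e_\lambda=\lambda^2e_\lambda$ are exactly the finite sums $e_\lambda(x)=\sum_{n\in\mathbb{Z}^3,\,|n|=\lambda}c_ne^{in\cdot x}$. Totally geodesic submanifolds are bounded and have unit Hausdorff measure: a totally geodesic submanifold $\Sigma\subset\mathbb{T}^3$ of dimension $k$ is the image in $\mathbb{T}^3$ of a relatively open subset $\tilde\Sigma$ of a $k$-dimensional affine plane in $\mathbb{R}^3$, with $k$-dimensional Hausdorff measure $1$, and contained in a ball of fixed radius $C_0$ (a fixed constant $C_0\ge 3$). $L^2(\Sigma)$ is taken with respect to $k$-dimensional Hausdorff measure on $\tilde\Sigma$. Constants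 may depend on $C_0$. *)

(* Defs.v *)
From HB Require Import structures.
From mathcomp Require Import all_boot all_order all_algebra complex.
From mathcomp Require Import all_classical all_reals all_analysis.

Set Implicit Arguments.
Unset Strict Implicit.
Unset Printing Implicit Defensive.

Import Order.TTheory GRing.Theory Num.Theory.
Import numFieldNormedType.Exports.

Local Open Scope classical_set_scope.
Local Open Scope ring_scope.
Local Open Scope complex_scope.

(* The library norm on 'rV[R]_n is the sup norm (it induces the same topology),
   so lengths are measured with the following Euclidean norm. *)
Definition enorm (R : realType) (n : nat) (x : 'rV[R]_n) : R :=
  Num.sqrt (\sum_i x 0 i ^+ 2).

Section covering_outer_measure.
Context (R : realType) (T : Type).
Local Open Scope ereal_scope.

(* Covers are sequences of members of [G], weighted by [c]. *)
Definition cover_inf (G : set (set T)) (c : set T -> \bar R) (A : set T) :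
    \bar R :=
  ereal_inf [set \sum_(i <oo) c (F i) |
    F in [set F : (set T)^nat | (forall i, G (F i)) /\ A `<=` \bigcup_i F i]].

Context (G : set (set T)) (c : set T -> \bar R).
Hypothesis c_ge0 : forall A, 0 <= c A.

Lemma cover_inf_ge0 A : 0 <= cover_inf G c A.
Proof.
by apply: le_ereal_inf_tmp => _ [F _ <-]; apply: nneseries_ge0.
Qed.

Lemma le_cover_inf : {homo cover_inf G c : A B / A `<=` B >-> A <= B}.
Proof.
move=> A B AB; apply/ereal_inf_le_tmp => _ [F [GF BF] <-].
by exists F => //; split => //; exact: subset_trans AB BF.
Qed.

Lemma cover_inf0 : G set0 -> c set0 = 0 -> cover_inf G c set0 = 0.
Proof.
move=> G0 c0; apply/eqP; rewrite eq_le cover_inf_ge0 andbT.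
apply: ereal_inf_lbound; exists (fun=> set0); first by split => // x [].
by apply: eseries0 => i _ _.
Qed.

Lemma cover_inf_sigma_subadditive : sigma_subadditive (cover_inf G c).
Proof.
move=> A; have [[i ioo]|] := pselect (exists i, cover_inf G c (A i) = +oo).
  rewrite (eseries_pinfty _ _ ioo) ?leey// => n _.
  by rewrite -ltNye (lt_le_trans _ (cover_inf_ge0 _)).
rewrite -forallNE => Aoo.
suff add2e (e : {posnum R}) : cover_inf G c (\bigcup_n A n) <=
    \sum_(i <oo) cover_inf G c (A i) + e%:num%:E.
  by apply/lee_addgt0Pr => _/posnumP[].
rewrite (le_trans _ (epsilon_trick _ _ _))//; last first.
  by move=> n; exact: cover_inf_ge0.
pose P n (B : (set T)^nat) :=
  [/\ forall i, G (B i), A n `<=` \bigcup_i B i &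
  \sum_(k <oo) c (B k) <= cover_inf G c (A n) + (e%:num / (2 ^ n.+1)%:R)%:E].
have [B PB] : {B : ((set T)^nat)^nat & forall n, P n (B n)}.
  apply: (@choice _ _ P) => n.
  have en1 : (0 < e%:num / (2 ^ n.+1)%:R)%R by [].
  have finA : cover_inf G c (A n) \is a fin_num.
    by rewrite ge0_fin_numE ?cover_inf_ge0// ltey; apply/eqP/Aoo.
  have [_ [F [GF AF] <-] /ltW cF] := lb_ereal_inf_adherent en1 finA.
  by exists F; split.
have cB_ge0 x : 0 <= (c \o uncurry B) x by exact: c_ge0.
apply: (@le_trans _ _ (\esum_(i in setT) (c \o uncurry B) i)).
  apply: ereal_inf_lbound => /=.
  have /card_esym/ppcard_eqP[f] := card_nat2.
  exists (uncurry B \o f).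
    split => [i|t [i _ Ait]]; first by rewrite /=; case: (f i) => a b; have [GB _ _] := PB a; apply: (GB b).
    have [_ /(_ _ Ait)[j _ Bijt] _] := PB i.
    by exists (f^-1%FUN (i, j)) => //=; rewrite invK ?inE.
  rewrite -(esum_pred_image (c \o uncurry B) _ xpredT) ?[fun=> _]set_true//.
  by rewrite image_eq.
rewrite (_ : esum _ _ = \sum_(i <oo) \sum_(j <oo ) c (B i j)); last first.
  pose J : nat -> set (nat * nat) := fun i => [set (i, j) | j in setT].
  rewrite (_ : setT = \bigcup_k J k); last first.
    by rewrite predeqE => -[a b]; split => // _; exists a => //; exists b.
  rewrite esum_bigcupT /=; last 2 first.
    - apply/trivIsetP => i j _ _ ij.
      rewrite predeqE => -[n m] /=; split => //= -[] [_] _ [<-{n} _].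
      by move=> [m' _] [] /esym/eqP; rewrite (negbTE ij).
    - by move=> /= [n m]; exact: c_ge0.
  rewrite -(image_id [set: nat]) -fun_true esum_pred_image//; last first.
    by move=> n _; exact: esum_ge0.
  apply: eq_eseriesr => /= j _.
  rewrite -(esum_pred_image (c \o uncurry B) (pair j) predT)//=; last first.
    by move=> ? ? _ _; exact: (@can_inj _ _ _ snd).
  by congr esum; rewrite predeqE => -[a b]; split; move=> [i _ <-]; exists i.
apply: lee_nneseries => // n *; last by have [] := PB n.
exact: nneseries_ge0.
Qed.

End covering_outer_measure.

Section hausdorff.
Context (R : realType) (n : nat) (k : nat).
Local Open Scope ereal_scope.

Definition diam (A : set 'rV[R]_n) : \bar R :=
  ereal_sup [set (enorm (p.1 - p.2))%:E | p in A `*` A].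

(* Volume of the unit ball of R^k. *)
Fixpoint unit_ball_volume (m : nat) : R :=
  match m with
  | 0 => 1
  | 1 => 2
  | m'.+2 => 2 * pi / m%:R * unit_ball_volume m'
  end%R.

(* [diam set0 = -oo], hence the separate case. *)
Definition diam_cost (A : set 'rV[R]_n) : \bar R :=
  if A == set0 then 0
  else (unit_ball_volume k / 2 ^+ k)%:E * diam A ^+ k.

(* The unit-ball factor makes the k-dimensional measure agree with Lebesgue
   measure on k-dimensional affine planes. *)
Definition hausdorff (A : set 'rV[R]_n) : \bar R :=
  ereal_sup [set cover_inf [set B | diam B <= delta%:E] diam_cost A |
             delta in [set delta : R | (0 < delta)%R]].

Lemma unit_ball_volume_ge0 m : (0 <= unit_ball_volume m)%R.
Proof.
suff : (0 <= unit_ball_volume m)%R /\ (0 <= unit_ball_volume m.+1)%R by case.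
elim: m => [|m [h1 h2]]; first by split => /=.
by split => //=; rewrite mulr_ge0// divr_ge0// mulr_ge0// pi_ge0.
Qed.

Lemma diam_cost_ge0 A : 0 <= diam_cost A.
Proof.
rewrite /diam_cost; case: ifPn => // /set0P[x Ax].
rewrite mule_ge0//; first by rewrite lee_fin divr_ge0// unit_ball_volume_ge0.
rewrite expe_ge0//; apply: le_ereal_sup_tmp; exists (enorm (x - x))%:E.
  by exists (x, x).
by rewrite lee_fin sqrtr_ge0.
Qed.

Let H_ge0 A : 0 <= hausdorff A.
Proof.
apply: le_ereal_sup_tmp; exists (cover_inf [set B | diam B <= 1%:E] diam_cost A).
  by exists 1%R => //=.
by apply: cover_inf_ge0; exact: diam_cost_ge0.
Qed.

Let H0 : hausdorff set0 = 0.
Proof.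
apply/eqP; rewrite eq_le H_ge0 andbT; apply: ge_ereal_sup => _ [d /= d0 <-].
rewrite cover_inf0 //=; [exact: diam_cost_ge0| |by rewrite /diam_cost eqxx].
by apply: ge_ereal_sup => x [p [[]]].
Qed.

Let le_H : {homo hausdorff : A B / A `<=` B >-> A <= B}.
Proof.
move=> A B AB; apply: ge_ereal_sup => _ [d d0 <-].
apply: (@le_trans _ _ (cover_inf [set B | diam B <= d%:E] diam_cost B)).
  exact: le_cover_inf.
by apply: ereal_sup_ubound; exists d.
Qed.

Let H_sigma_subadditive : sigma_subadditive hausdorff.
Proof.
move=> F; apply: ge_ereal_sup => _ [d d0 <-].
apply: (le_trans (cover_inf_sigma_subadditive _ diam_cost_ge0 _)).
apply: lee_nneseries => [i _ _|i _].
  by apply: cover_inf_ge0; exact: diam_cost_ge0.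
by apply: ereal_sup_ubound; exists d.
Qed.

HB.instance Definition _ := isOuterMeasure.Build R 'rV[R]_n hausdorff
  H0 H_ge0 le_H H_sigma_subadditive.

Definition hausdorff_measure : {outer_measure set 'rV[R]_n -> \bar R} :=
  hausdorff.

End hausdorff.

(* A plane is given by a point [p] and a matrix [V] whose rows are a basis of
   its direction; the submanifold of the torus is the image of [S]. *)
Definition geodesic_submanifold (R : realType) (C0 : R) (k : nat)
    (S : set 'rV[R]_3) : Prop :=
  [/\ exists (p : 'rV[R]_3) (V : 'M[R]_(k, 3)) (O : set 'rV[R]_3),
        [/\ row_free V, open O & S = [set p + u *m V | u in setT] `&` O],
      hausdorff k S = 1%E &
      exists c : 'rV[R]_3, S `<=` [set x | enorm (x - c) <= C0]].

Section torus.
Context (R : realType).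
Implicit Types (f : 'rV[R]_3 -> R) (e : 'rV[R]_3 -> R[i]).

Definition torus_periodic e : Prop :=
  forall (x : 'rV[R]_3) (m : 'rV[int]_3),
    e (x + (2 * pi) *: map_mx intr m) = e x.

Fixpoint Ck (m : nat) f : Prop :=
  continuous f /\
  if m is m'.+1 then
    forall i : 'I_3, (forall x, derivable f x (delta_mx 0 i)) /\
                     Ck m' ('D_(delta_mx 0 i) f)
  else True.

Definition laplacian f (x : 'rV[R]_3) : R :=
  \sum_(i < 3) 'D_(delta_mx 0 i) ('D_(delta_mx 0 i) f) x.

Definition claplacian e (x : 'rV[R]_3) : R[i] :=
  laplacian (@complex.Re R \o e) x +i* laplacian (@complex.Im R \o e) x.

(* Functions on the torus are represented by their periodic lifts. *)
Definition eigenfunction (lambda : R) e : Prop :=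
  [/\ torus_periodic e,
      Ck 2 (@complex.Re R \o e), Ck 2 (@complex.Im R \o e) &
      forall x, - claplacian e x = (lambda ^+ 2)%:C * e x].

Definition L2norm d (T : measurableType d) (mu : {measure set T -> \bar R})
    (D : set T) (g : T -> R[i]) : \bar R :=
  Lnorm mu 2%:E (EFin \o ((@Normc.normc R \o g) \_ D)).

(* Integration against the measure that the Hausdorff outer measure induces on
   its Caratheodory-measurable sets (these include the Borel sets). *)
Definition L2norm_geodesic (k : nat) (S : set 'rV[R]_3) e : \bar R :=
  let H := hausdorff_measure R 3 k in
  L2norm (H : {measure set (caratheodory_type H) -> \bar R}) S e.

Definition vec3 (t : R * R * R) : 'rV[R]_3 :=
  \row_(i < 3) [:: t.1.1; t.1.2; t.2]`_i.

Definition L2norm_torus e : \bar R :=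
  L2norm ((lebesgue_measure \x lebesgue_measure) \x lebesgue_measure)%E
    ((`[0, 2 * pi[ `*` `[0, 2 * pi[) `*` `[0, 2 * pi[) (e \o vec3).

End torus.

(* Main.v *)
(**
The frequencies of an eigenfunction are lattice points on the sphere of radius
lambda, and a plane contains at most C_eps lambda^eps of them, by the divisor
bound for representations by binary quadratic forms. Cut the sphere into small
pieces on which the lattice points span parallelepipeds of volume less than 1,
hence are coplanar: a slab of bounded width orthogonal to a unit vector
contains at most C_eps lambda^(2/3+eps) lattice points of the sphere, and a
tube of bounded width around a line at most C_eps lambda^(1/6+eps). When
e_lambda is integrated over a segment in direction v (resp. a square parallel
to a plane), the frequencies n and m interact through a Fejer kernel in v.(n -
m) (resp. in the two tangential components of n - m), so Schur's test bounds
the square of the restricted norm by the maximal number of frequencies in a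
slab (resp. a tube).

No integral over a geodesic is computed: the Hausdorff integral is dominated by
a Riemann sum over small cells, and the exponential sums are estimated at the
sample points. In the same way, an eigenfunction is approximated uniformly by a
trigonometric polynomial with frequencies on the sphere through the discrete
Fourier transform on a fine grid, where the discrete Laplacian has symbol close
to -|n|^2 and suppresses the other frequencies.
*)

From HB Require Import structures.
From mathcomp Require Import all_boot all_order all_algebra complex.
From mathcomp Require Import all_classical all_reals all_analysis measurable_realfun.
From mathcomp Require Import ring lra zify.
Require Import Defs.

Set Implicit Arguments.
Unset Strict Implicit.
Unset Printing Implicit Defensive.
Import Order.TTheory GRing.Theory Num.Theory.
Import numFieldNormedType.Exports.

(** * Divisor bounds and representations by binary forms *)

(** The exponents come from the size of the largest piece that is forced to be coplanar. Two sides
    of a piece are controlled by hand; the third is small because of the sphere: for x, x0 on it,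
    x0.(x - x0) = -|x - x0|^2 / 2, so the displacement is quadratically small along x0. Write lam =
    mu^6. A slab cuts the sphere in a ring of some radius r. With q = r^(1/3), boxes of side q in
    the ring have small enough volume. There are about q^2 of them along the ring and 1 + lam / q^4
    across it, hence lam / q^2 + q^2 in all, and mu <= q <= mu^2 turns this into mu^4 = lam^(2/3).
    Slabs near a pole, where the ring degenerates, are cut into squares of side about mu inside a
    disc of radius 4 mu^3, again mu^4 pieces. In a tube that meets the sphere obliquely, the height
    along the axis varies by at most about mu^3 and pieces have height mu^2, which gives mu =
    lam^(1/6) pieces. Every geometric count is relative to a number K bounding coplanar lattice
    points, so the loss lam^eps enters in one place only. Constants in the approximation of an
    eigenfunction by a wave may depend on lam, since that error is sent to 0 for fixed lam. *)

Lemma leq_size_fibers (T U : eqType) (f : T -> U) (D : seq U) (K : nat)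
    (s : seq T) :
    {in s, forall x, f x \in D} ->
    (forall u, u \in D -> size [seq x <- s | f x == u] <= K) ->
  size s <= size D * K.
Proof.
elim: D s => [|u D IH] s sD fib.
  by case: s sD {fib} => // x s /(_ x (mem_head _ _)).
rewrite -(count_predC (fun x => f x == u)) mulSn leq_add//.
  by rewrite -size_filter fib// mem_head.
rewrite -size_filter; apply: IH => [x|v vD].
  rewrite mem_filter /= => /andP[/negPf fx /sD].
  by rewrite in_cons fx.
have := fib v; rewrite in_cons vD orbT => /(_ isT); apply: leq_trans.
by rewrite -filter_predI !size_filter; apply: sub_count => x /= /andP[].
Qed.

Lemma expS_leq (p e : nat) : 1 < p -> e.+1 <= p ^ e.
Proof.
move=> p1; elim: e => // e IH; rewrite expnS.
by apply: leq_trans (leq_mul p1 IH); lia.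
Qed.

(** With q = e %/ k.+1 one has e + 1 <= (k + 1) p^(q + 1). In the k-th power p^(k q) is at most p^e,
    and what remains is the constant. *)
Lemma divisor_count_local (k p : nat) : 1 < p ->
  exists K, 0 < K /\ forall e, e.+1 ^ k <= K * p ^ e.
Proof.
move=> p1; have k1 : 0 < k.+1 by [].
exists ((k.+1 * p) ^ k); split.
  by rewrite expn_gt0 muln_gt0 /= (ltnW p1).
move=> e; have He : e.+1 <= k.+1 * p ^ (e %/ k.+1).+1.
  apply: (@leq_trans (k.+1 * (e %/ k.+1).+2)).
    by rewrite {1}(divn_eq e k.+1); have := ltn_pmod e k1; nia.
  by rewrite leq_mul2l expS_leq.
apply: (@leq_trans ((k.+1 * p ^ (e %/ k.+1).+1) ^ k)).
  by case: (posnP k) => [->//|k0]; rewrite leq_exp2r.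
rewrite expnS mulnA !expnMn leq_mul2l; apply/orP; right.
rewrite -expnM leq_exp2l//.
by have := leq_trunc_div e k.+1; nia.
Qed.

Lemma size_divisors_pfactor (p e m : nat) : prime p -> 0 < m -> ~~ (p %| m) ->
  size (divisors (p ^ e * m)) <= e.+1 * size (divisors m).
Proof.
move=> pp m0 pm.
have pm0 : 0 < p ^ e * m by rewrite muln_gt0 expn_gt0 prime_gt0.
rewrite -[e.+1](size_iota 0); apply: (leq_size_fibers (f := logn p)) => [d|j _].
  rewrite -dvdn_divisors// => dd; rewrite mem_iota /= ltnS.
  apply: leq_trans (dvdn_leq_log p pm0 dd) _.
  rewrite lognM ?expn_gt0 ?(prime_gt0 pp)//.
  by rewrite pfactorK// lognE (negPf pm) !andbF addn0.
rewrite -[leqLHS](size_map (partn^~ p^')); apply: uniq_leq_size.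
  rewrite map_inj_in_uniq ?filter_uniq ?divisors_uniq// => x y.
  rewrite !mem_filter -!dvdn_divisors// => /andP[/eqP lx dx] /andP[/eqP ly dy].
  move=> exy; have x0 := dvdn_gt0 pm0 dx; have y0 := dvdn_gt0 pm0 dy.
  by rewrite -(partnC p x0) -(partnC p y0) exy !p_part lx ly.
move=> _ /mapP[x + ->]; rewrite mem_filter -!dvdn_divisors// => /andP[_ dx].
have := partn_dvd p^' pm0 dx; rewrite partnM ?expn_gt0 ?(prime_gt0 pp)//.
rewrite [(p ^ e)`_p^']part_p'nat ?mul1n.
  by move/dvdn_trans; apply; apply: dvdn_part.
by rewrite pnatNK pnatX pnat_id.
Qed.

(** This is d(n) = O(n^(1/k)), stated without roots. A prime p >= 2^k satisfies (e + 1)^k <= 2^(e k)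
    <= p^e at no cost; each smaller prime costs a factor [K], and there are at most 2^k of those. *)
Lemma divisor_bound (k : nat) :
  exists C, 0 < C /\ forall n, 0 < n -> size (divisors n) ^ k <= C * n.
Proof.
have [K [K0 HK]] : exists K, 0 < K /\
    forall p e, 1 < p < 2 ^ k -> e.+1 ^ k <= K * p ^ e.
  elim: (2 ^ k) => [|m [K [K0 HK]]]; first by exists 1; split => // p e; rewrite ltn0 andbF.
  have [m1|m1] := ltnP 1 m; last first.
    by exists 1; split => // p e /andP[p1 pm]; exfalso; clear -m1 p1 pm; lia.
  have [L [L0 HL]] := divisor_count_local k m1.
  exists (maxn K L); split => [|p e /andP[p1]]; first by rewrite leq_max K0.
  rewrite ltnS leq_eqVlt => /predU1P[->|pm].
    by apply: leq_trans (HL e) _; rewrite leq_mul2r leq_maxr orbT.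
  apply: leq_trans (HK p e _) _; first by rewrite p1.
  by rewrite leq_mul2r leq_maxl orbT.
pose small n := size [seq p <- primes n | p < 2 ^ k].
suff H n : 0 < n -> size (divisors n) ^ k <= K ^ small n * n.
  exists (K ^ 2 ^ k); split => [|n n0]; first by rewrite expn_gt0 K0.
  apply: leq_trans (H n n0) _; rewrite leq_mul2r leq_pexp2l ?orbT//.
  rewrite -[leqRHS](size_iota 0); apply: uniq_leq_size.
    by rewrite filter_uniq// primes_uniq.
  by move=> p; rewrite mem_filter mem_iota => /andP[].
(* Strong induction: the full power of the least prime factor is split off. *)
have [m] := ubnP n; elim: m n => // m IH n nm n0.
have [->|n1] := eqVneq n 1; first by rewrite exp1n muln1 expn_gt0 K0.
have n2 : 1 < n by lia.
set p := pdiv n; have pp : prime p by apply: pdiv_prime.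
have pn : p %| n by apply: pdiv_dvd.
have [q pq e0] := pfactor_coprime pp n0; set e := logn p n in e0.
have q0 : 0 < q by move: n0; rewrite e0 muln_gt0 => /andP[].
have pq' : ~~ (p %| q) by rewrite -prime_coprime.
have e1 : 0 < e by rewrite /e logn_gt0 mem_primes pp n0.
have p1 := prime_gt1 pp.
have qn : q < m.
  suff qn2 : q * 2 <= n by lia.
  rewrite e0 leq_mul2l; apply/orP; right; apply: leq_trans p1 _.
  by have := leq_pexp2l (prime_gt0 pp) e1; rewrite expn1.
have sn : small n = (p < 2 ^ k) + small q.
  rewrite /small !size_filter; have /permP -> : perm_eq (primes n) (p :: primes q).
    apply: uniq_perm; rewrite ?primes_uniq//=.
      by rewrite primes_uniq mem_primes (negPf pq') !andbF.
    move=> r; rewrite in_cons {1}e0 primesM ?expn_gt0 ?(prime_gt0 pp)//.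
    rewrite primesX// (primes_prime pp);  by rewrite mem_seq1 orbC.
  by [].
have -> : divisors n = divisors (p ^ e * q) by rewrite mulnC -e0.
apply: (@leq_trans ((e.+1 * size (divisors q)) ^ k)).
  case: (posnP k) => [->//|k0]; rewrite leq_exp2r//.
  exact: size_divisors_pfactor.
rewrite expnMn sn e0 [q * _]mulnC expnD mulnACA leq_mul ?IH//.
case: ltnP => [pk|pk].
  by rewrite expn1 HK// p1.
rewrite mul1n; apply: (@leq_trans ((2 ^ e) ^ k)).
  case: (posnP k) => [->//|k0]; rewrite leq_exp2r//; exact: expS_leq.
by rewrite -expnM mulnC expnM; case: (posnP e) e1 => // e1 _; rewrite leq_exp2r.
Qed.

Local Open Scope ring_scope.

(* As (a x x' + b y y')^2 + a b (x y' - x' y)^2 = M^2, only five multiples of M are possible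
   for 2 (x y' - x' y), and each is attained at most twice. *)
Lemma size_form_reps_class (a b M : int) (t : seq (int * int)) :
  0 < a -> 0 < b -> 0 < M -> uniq t ->
  {in t, forall p, a * p.1 ^+ 2 + b * p.2 ^+ 2 = M} ->
  {in t &, forall p q, (M %| 2 * (p.1 * q.2 - q.1 * p.2))%Z} ->
  (size t <= 10)%N.
Proof.
move=> a0 b0 M0 ut tM tdvd; case: t ut tM tdvd => // p t0; set t := p :: t0.
move=> ut tM tdvd; have pt : p \in t by rewrite mem_head.
pose k q := p.1 * q.2 - q.1 * p.2.
pose S q := a * p.1 * q.1 + b * p.2 * q.2.
have key q : q \in t -> S q ^+ 2 + a * b * k q ^+ 2 = M ^+ 2.
  by move=> qt; rewrite [RHS]expr2 -{1}(tM p pt) -(tM q qt) /S /k; ring.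
(* The quotient determines [k q], hence [S q] up to its sign, which the boolean records; [k q] and
   [S q] determine [q]. *)
pose f q := ((2 * k q %/ M)%Z, 0 <= S q).
have fE q : q \in t -> 2 * k q = (f q).1 * M.
  by move=> qt; rewrite /f /= divzK// tdvd.
pose L : seq (int * bool) :=
  [seq (i, c) | i <- [:: (-2 : int); -1; 0; 1; 2], c <- [:: true; false]].
rewrite -[leqLHS](size_map f); apply: (@uniq_leq_size _ _ L).
  rewrite map_inj_in_uniq// => q r qt rt [e1 e2].
  have kE : k q = k r.
    apply: (@mulfI _ (2 : int)) => //.
    by rewrite !fE// /f /= e1.
  have SE : S q = S r.
    have /eqP : S q ^+ 2 = S r ^+ 2.
      by apply: (addIr (a * b * k q ^+ 2)); rewrite key// kE key.
    rewrite eqf_sqr => /orP[/eqP//|/eqP SN].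
    by move: e2; rewrite SN; lia.
  have h1 u : u \in t -> M * u.1 = p.1 * S u - b * p.2 * k u.
    by move=> _; rewrite -(tM p pt) /S /k; ring.
  have h2 u : u \in t -> M * u.2 = p.2 * S u + a * p.1 * k u.
    by move=> _; rewrite -(tM p pt) /S /k; ring.
  have M1 : M != 0 by rewrite gt_eqF.
  have E1 : q.1 = r.1 by apply: (mulfI M1); rewrite !h1// SE kE.
  have E2 : q.2 = r.2 by apply: (mulfI M1); rewrite !h2// SE kE.
  by rewrite (surjective_pairing q) E1 E2 -surjective_pairing.
move=> _ /mapP[q qt ->]; have := key q qt; have := fE q qt.
set i := (f q).1; have -> : f q = (i, (f q).2) by [].
move=> ki Sk; have : i ^+ 2 <= 4.
  rewrite -(@ler_pM2r _ (M ^+ 2)) ?exprn_gt0// -exprMn -ki exprMn -Sk.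
  rewrite -[X in 4 * (_ + X)]mul1r; have := sqr_ge0 (S q); have := sqr_ge0 (k q).
  move: (S q ^+ 2) (k q ^+ 2) => x y y0 x0.
  have ab1 : 1 <= a * b by rewrite -[1]mulr1 ler_pM//; lia.
  by nia.
have [i0|i0] := leP 0 i => i4.
  have : i <= 2 by nia.
  by case: i i0 {ki i4} => [[|[|[|i]]]|i]// _ _; case: (f q).2.
have : -2 <= i by nia.
by case: i i0 {ki i4} => [i|[|[|i]]]// _ _; case: (f q).2.
Qed.

(** Fix a representation p and put u, v = p.1 q.2 -+ q.1 p.2. Then M divides a u v and b u v, hence
    u v. If g = gcd(M, u) is the same for q and r, then g and h = M / g both divide q.1 r.2 - r.1
    q.2, after cancelling p.1. Moreover gcd(g, h) divides u + v = 2 p.1 q.2, hence 2, so M = gcd(g,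
    h) lcm(g, h) divides 2 (q.1 r.2 - r.1 q.2). Each divisor g thus yields a class of at most ten
    representations. *)
Lemma size_form_reps_coprime (a b M : int) (s : seq (int * int)) :
  0 < a -> 0 < b -> 0 < M -> coprimez a b -> uniq s ->
  {in s, forall p, [/\ a * p.1 ^+ 2 + b * p.2 ^+ 2 = M,
                       coprimez p.1 M & coprimez p.2 M]} ->
  (size s <= size (divisors `|M|) * 10)%N.
Proof.
move=> a0 b0 M0 ab us sM; have M0' : (0 < `|M|)%N by rewrite absz_gt0 gt_eqF.
case: s us sM => // p s0; set s := p :: s0.
move=> us sM; have ps : p \in s by rewrite mem_head.
pose u q := p.1 * q.2 - q.1 * p.2; pose v q := p.1 * q.2 + q.1 * p.2.
pose f q := gcdn `|M| `|u q|.
apply: (@leq_size_fibers _ _ f) => [q _|g _].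
  by rewrite -dvdn_divisors ?dvdn_gcdl.
apply: (@size_form_reps_class a b M) => //; rewrite ?filter_uniq//.
  by move=> q; rewrite mem_filter => /andP[_ /sM[]].
move=> q r; rewrite !mem_filter => /andP[/eqP fq qs] /andP[/eqP fr rs].
have [pM p1 p2] := sM p ps.
have Muv x : x \in s -> (M %| u x * v x)%Z.
  move=> xs; have [xM _ _] := sM x xs.
  have ha : (M %| a * (u x * v x))%Z.
    have -> : a * (u x * v x) = M * (x.2 ^+ 2 - p.2 ^+ 2).
      by rewrite mulrBr -{1}pM -xM /u /v; ring.
    exact: dvdz_mulr.
  have hb : (M %| b * (u x * v x))%Z.
    have -> : b * (u x * v x) = M * (p.1 ^+ 2 - x.1 ^+ 2).
      by rewrite mulrBr -{2}pM -xM /u /v; ring.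
    exact: dvdz_mulr.
  have /coprimezP[[m n] /= mn] := ab.
  rewrite -[u x * v x]mul1r -mn mulrDl -!mulrA.
  by apply: rpredD; apply: dvdz_mull.
have gM : (g %| `|M|)%N by rewrite -fq dvdn_gcdl.
have g0 : (0 < g)%N := dvdn_gt0 M0' gM.
have gu x : f x = g -> (g %| `|u x|)%N by move=> <-; exact: dvdn_gcdr.
pose h := (`|M| %/ g)%N.
have gh : (g * h = `|M|)%N by rewrite mulnC divnK.
have hv x : x \in s -> f x = g -> (h %| `|v x|)%N.
  move=> xs fx; have := Muv x xs; rewrite dvdzE abszM.
  have /dvdnP[w uw] := gu x fx.
  rewrite uw -gh [(w * g)%N]mulnC -mulnA dvdn_pmul2l// Gauss_dvdr//.
  move: fx; rewrite /f uw -gh [(w * g)%N]mulnC -muln_gcdr => /eqP.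
  by rewrite -[X in _ == X]muln1 eqn_pmul2l.
have cop1 x : (x %| `|M|)%N -> coprime x `|p.1|.
  by move=> xM; rewrite coprime_sym; apply: coprime_dvdr xM _.
have gk : (g%:Z %| q.1 * r.2 - r.1 * q.2)%Z.
  rewrite -(@Gauss_dvdzr _ p.1) /coprimez ?gcdzE ?cop1 //=; last first.
    by have := cop1 g gM; rewrite /coprime.
  have -> : p.1 * (q.1 * r.2 - r.1 * q.2) = q.1 * u r - r.1 * u q.
    by rewrite /u; ring.
  by rewrite rpredB// dvdz_mull// dvdzE /= gu.
have hM : (h %| `|M|)%N by rewrite -gh dvdn_mull.
have hk : (h%:Z %| q.1 * r.2 - r.1 * q.2)%Z.
  rewrite -(@Gauss_dvdzr _ p.1); last first.
    by have := cop1 h hM; rewrite /coprime /coprimez.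
  have -> : p.1 * (q.1 * r.2 - r.1 * q.2) = q.1 * v r - r.1 * v q.
    by rewrite /v; ring.
  by rewrite rpredB// dvdz_mull// dvdzE /= hv.
have g2 : (gcdn g h %| 2)%N.
  have [_ _ q2] := sM q qs.
  have cg x : (x %| `|M|)%N -> coprimez x%:Z (p.1 * q.2).
    move=> xM; rewrite coprimezMr; apply/andP; split; first exact: cop1.
    by rewrite coprimez_sym; apply: coprimez_dvdr q2.
  have := @Gauss_dvdzl (gcdn g h)%:Z 2 (p.1 * q.2).
  rewrite cg; last by rewrite (dvdn_trans _ gM) ?dvdn_gcdl.
  move=> /(_ isT); rewrite [RHS]dvdzE /= => <-.
  have -> : 2 * (p.1 * q.2) = u q + v q by rewrite /u /v; ring.
  rewrite rpredD// dvdzE /=.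
    by rewrite (dvdn_trans (dvdn_gcdl _ _)) ?gu.
  by rewrite (dvdn_trans (dvdn_gcdr _ _)) ?hv.
rewrite dvdzE abszM -gh -muln_lcm_gcd mulnC dvdn_mul//.
by rewrite dvdn_lcm; apply/andP; split.
Qed.

Lemma leq_size_divisors (m n : nat) : (0 < n)%N -> (m %| n)%N ->
  (size (divisors m) <= size (divisors n))%N.
Proof.
move=> n0 mn; have m0 := dvdn_gt0 n0 mn.
apply: uniq_leq_size; first exact: divisors_uniq.
by move=> d; rewrite -!dvdn_divisors// => dm; apply: dvdn_trans mn.
Qed.

(** Fix h = gcd(x, M). As y is prime to M, h divides D, and dividing by h gives h x'^2 + (D / h) y^2
    = M / h. Dividing further by the gcd [c] of the two coefficients leads to the coprime case, for
    a divisor [m] of M. *)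
Lemma size_form_reps_primitive (D M : int) (s : seq (int * int)) :
  0 < D -> 0 < M -> uniq s ->
  {in s, forall p, p.1 ^+ 2 + D * p.2 ^+ 2 = M /\ coprimez p.1 p.2} ->
  (size s <= size (divisors `|M|) * (size (divisors `|M|) * 10))%N.
Proof.
move=> D0 M0 us sM; have M0' : (0 < `|M|)%N by rewrite absz_gt0 gt_eqF.
apply: (@leq_size_fibers _ _ (fun p => gcdn `|p.1| `|M|)) => [q _|h hM].
  by rewrite -dvdn_divisors ?dvdn_gcdr.
rewrite -dvdn_divisors// in hM; have h0 : (0 < h)%N := dvdn_gt0 M0' hM.
set t := seq.filter _ s.
have : {in t, forall p, [/\ p.1 ^+ 2 + D * p.2 ^+ 2 = M, coprimez p.1 p.2 &
    gcdn `|p.1| `|M| = h]}.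
  by move=> p; rewrite mem_filter => /andP[/eqP ? /sM[]].
have : uniq t by rewrite filter_uniq.
move: t => t ut tM; clear s us sM; case: t ut tM => // p t0; set t := p :: t0.
move=> ut tM; have pt : p \in t by rewrite mem_head.
have h1 : h%:Z != 0 by lia.
have dvdX q : q \in t -> (h%:Z %| q.1)%Z.
  by move=> /tM[_ _ e]; rewrite dvdzE /= -e dvdn_gcdl.
have copY q : q \in t -> coprimez q.2 M.
  move=> /tM[e co _]; rewrite -e.
  have -> : q.1 ^+ 2 + D * q.2 ^+ 2 = D * q.2 * q.2 + q.1 ^+ 2 by ring.
  rewrite /coprimez gcdzMDl -/(coprimez _ _) coprimez_pexpr//.
  by rewrite coprimez_sym.
have hM' : (h%:Z %| M)%Z by rewrite dvdzE.
have hD : (h%:Z %| D)%Z.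
  have [e _ _] := tM p pt.
  have : (h%:Z %| D * p.2 ^+ 2)%Z.
    have -> : D * p.2 ^+ 2 = M - p.1 * p.1 by rewrite -e; ring.
    by rewrite rpredB// dvdz_mulr// dvdX.
  rewrite Gauss_dvdzl// coprimez_pexpr// coprimez_sym.
  exact: coprimez_dvdr (copY p pt).
have [D' DE] := dvdzP hD; have [M' ME] := dvdzP hM'.
have hz0 : 0 < h%:Z by lia.
have D'0 : 0 < D' by move: D0; rewrite DE pmulr_lgt0.
have M'0 : 0 < M' by move: M0; rewrite ME pmulr_lgt0.
pose phi (q : int * int) := ((q.1 %/ h%:Z)%Z, q.2).
have phiE q : q \in t -> h%:Z * (phi q).1 ^+ 2 + D' * (phi q).2 ^+ 2 = M'.
  move=> qt; have [e _ _] := tM q qt; apply: (mulfI h1).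
  rewrite [h%:Z * M']mulrC -ME -e -{1}(divzK (dvdX q qt)) DE /phi /=; ring.
pose c := gcdz h%:Z D'.
have c0 : 0 < c by rewrite /c /gcdz; have := gcdn_gt0 `|h%:Z| `|D'|; lia.
have cN0 : c != 0 by rewrite gt_eqF.
have [a aE] := dvdzP (dvdz_gcdl h%:Z D'); have [b bE] := dvdzP (dvdz_gcdr h%:Z D').
rewrite -/c in aE bE.
have [m mE] : exists m, M' = m * c.
  apply/dvdzP; rewrite -(phiE p pt); apply: rpredD; apply: dvdz_mulr.
    exact: dvdz_gcdl.
  exact: dvdz_gcdr.
have a0 : 0 < a by move: hz0; rewrite {1}aE pmulr_lgt0.
have b0 : 0 < b by move: D'0; rewrite bE pmulr_lgt0.
have m0 : 0 < m by move: M'0; rewrite mE pmulr_lgt0.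
have ab : coprimez a b.
  have : gcdz (a * c) (b * c) = c by rewrite -aE -bE.
  rewrite -mulz_gcdl => /eqP; rewrite /coprimez.
  by rewrite gtz0_abs// -[X in _ == X]mul1r (inj_eq (mulIf cN0)).
have mM : (`|m| %| `|M|)%N.
  by rewrite -dvdzE ME mE -mulrA dvdz_mulr.
rewrite -[leqLHS](size_map phi); apply: (@leq_trans (size (divisors `|m|) * 10)).
  apply: (@size_form_reps_coprime a b m) => //.
    rewrite map_inj_in_uniq// => q r qt rt [e1 e2].
    rewrite (surjective_pairing q) -(divzK (dvdX q qt)) e1 e2 divzK ?dvdX//.
    by rewrite -surjective_pairing.
  move=> _ /mapP[q qt ->]; split.
  - apply: (mulIf cN0); rewrite -mE -(phiE q qt) {1}aE bE; ring.
  - have [_ _] := tM q qt; rewrite -{1}(divzK (dvdX q qt)) ME !abszM /= => e.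
    rewrite coprimezE; apply: (@coprime_dvdr _ `|M'|%N); first by rewrite mE abszM dvdn_mulr.
    move: e; rewrite -muln_gcdl => /eqP.
    by rewrite -[X in _ == X]mul1n eqn_pmul2r// /coprimez /gcdz.
  - exact: coprimez_dvdr (copY q qt).
by rewrite leq_mul2r leq_size_divisors.
Qed.

(** The fibre over g = gcd(x, y) consists of primitive representations of M / g^2, scaled by g. *)
Lemma size_form_reps (D M : int) (s : seq (int * int)) :
  0 < D -> 0 < M -> uniq s ->
  {in s, forall p, p.1 ^+ 2 + D * p.2 ^+ 2 = M} ->
  (size s <= 10 * size (divisors `|M|) ^ 3)%N.
Proof.
move=> D0 M0 us sM; have M0' : (0 < `|M|)%N by rewrite absz_gt0 gt_eqF.
set d := size (divisors _).
have -> : (10 * d ^ 3 = d * (d * (d * 10)))%N by rewrite !expnS; lia.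
have gsq (p : int * int) : p \in s ->
    ((gcdz p.1 p.2) ^+ 2 %| M)%Z.
  move=> /sM <-; apply: rpredD; last apply: dvdz_mull; apply: dvdz_exp2r.
    exact: dvdz_gcdl.
  exact: dvdz_gcdr.
apply: (@leq_size_fibers _ _ (fun p => gcdn `|p.1| `|p.2|)) => [p ps|g gM].
  rewrite -dvdn_divisors//; apply: dvdn_trans (gsq p ps).
  by rewrite abszX dvdn_exp.
set t := seq.filter _ s.
have tM : {in t, forall p, p.1 ^+ 2 + D * p.2 ^+ 2 = M /\ gcdz p.1 p.2 = g}.
  by move=> p; rewrite mem_filter /gcdz => /andP[/eqP -> /sM].
have : {in t, forall p, (g%:Z ^+ 2 %| M)%Z}.
  move=> p pt; have [_ <-] := tM p pt; apply: gsq.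
  by move: pt; rewrite mem_filter => /andP[].
have : uniq t by rewrite filter_uniq.
move: t tM => t tM ut gM2; case: t ut tM gM2 => // p t0; set t := p :: t0.
move=> ut tM /(_ p (mem_head _ _)) /dvdzP[m mE].
have g0 : (0 < g)%N by rewrite -dvdn_divisors// in gM; apply: dvdn_gt0 gM.
have gz0 : g%:Z != 0 by lia.
have m0 : 0 < m by move: M0; rewrite mE pmulr_lgt0 ?exprn_gt0//; lia.
pose phi (q : int * int) := ((q.1 %/ g%:Z)%Z, (q.2 %/ g%:Z)%Z).
have d1 q : q \in t -> q.1 = (phi q).1 * g%:Z.
  by move=> /tM[_ e]; rewrite divzK// -e dvdz_gcdl.
have d2 q : q \in t -> q.2 = (phi q).2 * g%:Z.
  by move=> /tM[_ e]; rewrite divzK// -e dvdz_gcdr.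
have mM : (`|m| %| `|M|)%N by rewrite mE abszM dvdn_mulr.
rewrite -[leqLHS](size_map phi).
apply: (@leq_trans (size (divisors `|m|) * (size (divisors `|m|) * 10))%N).
  apply: (@size_form_reps_primitive D) => //.
    rewrite map_inj_in_uniq// => q r qt rt e.
    rewrite (surjective_pairing q) (d1 q)// (d2 q)// e -d1// -d2//.
    by rewrite -surjective_pairing.
  move=> _ /mapP[q qt ->]; have [e eg] := tM q qt; split.
    apply: (@mulIf _ (g%:Z ^+ 2)); first by rewrite expf_neq0.
    by rewrite -mE -e {1}(d1 q)// {1}(d2 q)//; ring.
  have := eg; rewrite {1}(d1 q)// {1}(d2 q)// -mulz_gcdl => /eqP.
  by rewrite -[X in _ == X]mul1r (inj_eq (mulIf gz0)).
by rewrite !leq_mul// leq_size_divisors.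
Qed.

(** * Lattice points on a sphere *)

Local Notation Z3 := (int * int * int)%type.

Section dot3.
Context (R : comPzRingType).
Implicit Types x y z : R * R * R.

Definition dot3 x y := x.1.1 * y.1.1 + x.1.2 * y.1.2 + x.2 * y.2.

Definition cross3 x y : R * R * R :=
  (x.1.2 * y.2 - x.2 * y.1.2, x.2 * y.1.1 - x.1.1 * y.2,
   x.1.1 * y.1.2 - x.1.2 * y.1.1).

Definition det3 x y z := dot3 x (cross3 y z).

End dot3.

Lemma gram3 (R : comNzRingType) (x u v : R * R * R) :
  det3 x u v ^+ 2 =
    dot3 x x * (dot3 u u * dot3 v v - dot3 u v ^+ 2)
    - dot3 x u * (dot3 x u * dot3 v v - dot3 u v * dot3 x v)
    + dot3 x v * (dot3 x u * dot3 u v - dot3 u u * dot3 x v).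
Proof. by rewrite /det3 /cross3 /dot3 /=; ring. Qed.

Lemma dot3_ge0 (R : realDomainType) (x : R * R * R) : 0 <= dot3 x x.
Proof. by rewrite /dot3 !addr_ge0// -expr2 sqr_ge0. Qed.

Lemma dot3_eq0 (R : realDomainType) (x : R * R * R) : dot3 x x = 0 -> x = 0.
Proof.
move=> /eqP; rewrite /dot3 -!expr2 !paddr_eq0 ?addr_ge0 ?sqr_ge0// !sqrf_eq0.
by case: x => [[a b] c] /= /andP[/andP[/eqP -> /eqP ->] /eqP ->].
Qed.

Lemma dot3_CS (R : realDomainType) (x y : R * R * R) :
  dot3 x y ^+ 2 <= dot3 x x * dot3 y y.
Proof.
have -> : dot3 x x * dot3 y y = dot3 x y ^+ 2 + dot3 (cross3 x y) (cross3 x y).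
  by rewrite /cross3 /dot3 /=; ring.
by rewrite lerDl dot3_ge0.
Qed.

(** Integral coordinates X, Y on the plane satisfy X^2 + D Y^2 = M with 0 < M <= 64 N^4, so the
    points are at most 10 d(M)^3 in number. The divisor bound is applied with exponent 3 k. *)
Lemma size_coplanar_sphere (k : nat) : exists2 C : nat, (0 < C)%N &
  forall (N : int) (s : seq Z3), 0 < N -> uniq s ->
    {in s, forall x : Z3, dot3 x x = N} ->
    {in s & &, forall x y z : Z3,
      {in s, forall t : Z3, det3 (t - x) (y - x) (z - x) = 0}} ->
  (size s ^ k <= C * `|N| ^ 4)%N.
Proof.
have [C0 [C0gt0 HC]] := divisor_bound (3 * k).
exists (2 ^ k + 10 ^ k * (C0 * 64))%N; first by rewrite addn_gt0 expn_gt0.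
move=> N s N0 us sN cop.
have N0' : (0 < `|N| ^ 4)%N by rewrite expn_gt0; lia.
rewrite mulnDl; case: s us sN cop => [|P0 [|P1 [|P2 s0]]].
- move=> *; apply: leq_trans (leq_addr _ _); apply: (@leq_trans (2 ^ k)).
    by case: (posnP k) => [->//|k0]; rewrite leq_exp2r.
  by rewrite leq_pmulr.
- move=> *; apply: leq_trans (leq_addr _ _); apply: (@leq_trans (2 ^ k)).
    by case: (posnP k) => [->//|k0]; rewrite leq_exp2r.
  by rewrite leq_pmulr.
- move=> *; apply: leq_trans (leq_addr _ _); apply: (@leq_trans (2 ^ k)).
    by case: (posnP k) => [->//|k0]; rewrite leq_exp2r.
  by rewrite leq_pmulr.
set s := P0 :: _ => us sN cop; apply: leq_trans (leq_addl _ _).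
have P0s : P0 \in s by rewrite mem_head.
have P1s : P1 \in s by rewrite !inE eqxx orbT.
have P2s : P2 \in s by rewrite !inE eqxx !orbT.
have [P01 P02 P12] : [/\ P0 != P1, P0 != P2 & P1 != P2].
  move: us; rewrite /s /= !inE !negb_or => /andP[/and3P[-> -> _]].
  by move=> /andP[/andP[->]].
pose u : Z3 := P1 - P0; pose v : Z3 := P2 - P0.
pose A : int := dot3 u u; pose B : int := dot3 u v; pose D : int := A * dot3 v v - B ^+ 2.
(* Coordinates along the Gram-Schmidt basis u, A v - B u of the plane, left unnormalised so that
   they are integers. *)
pose Y (x : Z3) : int := dot3 x u.
pose X (x : Z3) : int := A * dot3 x v - B * dot3 x u.
have A0 : 0 < A.
  rewrite lt_def dot3_ge0 andbT; apply: contra P01 => /eqP/dot3_eq0/eqP.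
  by rewrite subr_eq0 eq_sym.
(* [A v - B u = 0] would make P0, P1, P2 three distinct collinear points of the sphere *)
have D0 : 0 < D.
  rewrite lt_def subr_ge0 dot3_CS andbT subr_eq0; apply/negP => /eqP DE.
  have hP (P : Z3) : P \in s ->
      2 * dot3 P0 (P - P0) = - dot3 (P - P0) (P - P0).
    move=> Ps; have := sN _ Ps; rewrite -(sN _ P0s) /dot3 /= => e.
    by apply: (addIr (- dot3 P P + dot3 P0 P0)); rewrite /dot3 /= {2}e; ring.
  have hu := hP _ P1s; have hv := hP _ P2s; rewrite -/u -/v -/A in hu hv.
  have AB : forall z, A * dot3 z v = B * dot3 z u.
    have w0 : (A * v.1.1 - B * u.1.1, A * v.1.2 - B * u.1.2, A * v.2 - B * u.2)
        = 0 :> Z3%type.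
      apply: dot3_eq0; have -> : forall a b c : int, dot3 (a, b, c) (a, b, c) =
        a ^+ 2 + b ^+ 2 + c ^+ 2 by move=> a b c; rewrite /dot3 /=; ring.
      transitivity (A * (A * dot3 v v - B ^+ 2)); last by rewrite DE subrr mulr0.
      by rewrite [in LHS]/A [in LHS]/B [in RHS]/A [in RHS]/B /dot3; ring.
    case: w0 => w1 w2 w3 z; apply/eqP; rewrite -subr_eq0; apply/eqP.
    transitivity (z.1.1 * (A * v.1.1 - B * u.1.1) + z.1.2 * (A * v.1.2 - B * u.1.2)
      + z.2 * (A * v.2 - B * u.2)); first by rewrite /dot3; ring.
    by rewrite w1 w2 w3 !mulr0 !addr0.
  have CB : dot3 v v = B.
    apply: (mulfI (lt0r_neq0 A0)).
    by have := AB P0; have := hu; have := hv; lia.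
  have C0' : dot3 v v != 0.
    apply: contra P02 => /eqP/dot3_eq0/eqP.
    by rewrite subr_eq0 eq_sym.
  have AC : A = B by move: DE C0'; rewrite CB expr2 => /mulIf h /h.
  have : dot3 (v - u) (v - u) = 0.
    transitivity (dot3 v v - B - B + A); last by rewrite CB AC; ring.
    by rewrite /A /B /dot3 /=; ring.
  move=> /dot3_eq0 /eqP; rewrite subr_eq0 => /eqP/addIr e.
  by rewrite e eqxx in P12.
have key x y : x \in s -> y \in s ->
    A * D * (dot3 (x - y) (x - y)) = D * (Y x - Y y) ^+ 2 + (X x - X y) ^+ 2.
  move=> xs ys.
  have detE : det3 (x - y) u v = 0.
    have := cop _ _ _ P0s P1s P2s _ ys; have := cop _ _ _ P0s P1s P2s _ xs.
    rewrite -/u -/v => e1 e2.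
    have -> : det3 (x - y) u v = det3 (x - P0) u v - det3 (y - P0) u v.
      by rewrite /det3 /dot3 /=; ring.
    by rewrite e1 e2 subr0.
  have -> : Y x - Y y = dot3 (x - y) u by rewrite /Y /dot3 /=; ring.
  have -> : X x - X y = A * dot3 (x - y) v - B * dot3 (x - y) u.
    by rewrite /X /dot3 /=; ring.
  have := gram3 (x - y) u v; rewrite detE /D -/A -/B.
  move: (dot3 (x - y) (x - y)) (dot3 (x - y) u) (dot3 (x - y) v) (dot3 v v).
  move=> d p q c e.
  rewrite expr0n /= in e; have e2 := congr1 ( *%R A) e; rewrite mulr0 in e2.
  by apply/eqP; rewrite -subr_eq0; apply/eqP; apply: etrans (esym e2); ring.
(* The Gram identity [DE0] expresses |x|^2 by X, Y and the determinant with u, v. The latter is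
   constant on the plane, so the form takes the same value [M] at all points. *)
pose M := D * Y P0 ^+ 2 + X P0 ^+ 2.
have DE0 x : A * D * dot3 x x = D * Y x ^+ 2 + X x ^+ 2 + A * det3 x u v ^+ 2.
  rewrite gram3 /X /Y /D -/A -/B.
  by move: (dot3 x x) (dot3 x u) (dot3 x v) (dot3 v v) => d p q c; ring.
have XYM x : x \in s -> X x ^+ 2 + D * Y x ^+ 2 = M.
  move=> xs; have := DE0 x; have := DE0 P0; rewrite (sN _ xs) (sN _ P0s).
  have -> : det3 x u v = det3 P0 u v.
    have e := cop _ _ _ P0s P1s P2s _ xs; rewrite -/u -/v in e.
    apply/eqP; rewrite -subr_eq0; apply/eqP; rewrite -[RHS]e /det3 /dot3 /=; ring.
  by move=> -> /addIr e; rewrite /M addrC e.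
have inj x y : x \in s -> y \in s -> X x = X y -> Y x = Y y -> x = y.
  move=> xs ys eX eY; have := key x y xs ys.
  rewrite eX eY !subrr expr0n /= mulr0 addr0 => /eqP.
  rewrite !mulf_eq0 (gt_eqF A0) (gt_eqF D0) /= => /eqP/dot3_eq0/eqP.
  by rewrite subr_eq0 => /eqP.
have M0 : 0 < M.
  rewrite lt_def; apply/andP; split; last first.
    by apply: addr_ge0 (sqr_ge0 _); apply: mulr_ge0 (sqr_ge0 _); apply: ltW.
  apply: contra P01 => /eqP M00; apply/eqP.
  have z x : x \in s -> X x = 0 /\ Y x = 0.
    move=> /XYM /eqP; rewrite M00 paddr_eq0 ?sqr_ge0//; last first.
      by apply: mulr_ge0 (sqr_ge0 _); apply: ltW.
    by rewrite sqrf_eq0 mulf_eq0 (gt_eqF D0) /= sqrf_eq0 => /andP[/eqP ? /eqP].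
  have [x0 y0] := z _ P0s; have [x1 y1] := z _ P1s.
  by apply: inj => //; rewrite ?x0 ?y0 ?x1 ?y1.
(* Parallelogram law: |P - P0|^2 + |P + P0|^2 = 4 N. *)
have dist4 P : P \in s -> dot3 (P - P0) (P - P0) <= 4 * N.
  move=> Ps; have e1 := sN _ Ps; have e0 := sN _ P0s.
  have := dot3_ge0 (P + P0); move: e1 e0; rewrite /dot3 /=; lia.
have MN : M <= 64 * N ^+ 4.
  have MA : M <= A * D * N.
    rewrite -(sN _ P0s) DE0 /M lerDl mulr_ge0 ?sqr_ge0//; exact: ltW.
  have A4 : A <= 4 * N by exact: dist4.
  have D4 : D <= 4 * N * (4 * N).
    apply: (@le_trans _ _ (A * dot3 v v)); first by rewrite gerBl sqr_ge0.
    by apply: ler_pM => //; [exact: ltW|exact: dot3_ge0|exact: dist4].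
  apply: le_trans MA _; have -> : 64 * N ^+ 4 = 4 * N * (4 * N * (4 * N)) * N.
    by ring.
  by rewrite ler_pM2r// ler_pM// ltW.
rewrite -[size s](size_map (fun x => (X x, Y x))).
apply: (@leq_trans ((10 * size (divisors `|M|) ^ 3) ^ k)).
  case: (posnP k) => [->//|k0]; rewrite leq_exp2r//.
  apply: (@size_form_reps D) => //.
    by rewrite map_inj_in_uniq// => x y xs ys [eX eY]; apply: inj.
  by move=> _ /mapP[x xs ->]; apply: XYM.
rewrite expnMn -mulnA leq_mul2l; apply/orP; right.
rewrite -expnM; apply: leq_trans (HC _ _) _; first by rewrite absz_gt0 gt_eqF.
rewrite -mulnA leq_mul2l; apply/orP; right.
have -> : (64 * `|N| ^ 4 = `|(64 * N ^+ 4)%R|)%N by rewrite abszM abszX.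
by move: (64 * N ^+ 4) MN M0 => n; lia.
Qed.

(** * Small pieces of the sphere are coplanar *)

Section counting.
Context {R : realType}.
Implicit Types (lam K mu : R) (s t : seq Z3).
Implicit Types (v b d f : R * R * R).

Definition int3 (x : Z3) : R * R * R := (x.1.1%:~R, x.1.2%:~R, x.2%:~R).

Definition on_sphere lam s := {in s, forall x : Z3, dot3 (int3 x) (int3 x) = lam ^+ 2}.

(** [K] stays a parameter throughout the geometry; [coplanar_bound_eps] supplies it. *)
Definition coplanar_bound lam K := forall t, uniq t -> on_sphere lam t ->
  {in t & &, forall x y z : Z3,
    {in t, forall w : Z3, det3 (w - x) (y - x) (z - x) = 0}} ->
  (size t)%:R <= K.

Lemma int3B x y : int3 (x - y) = int3 x - int3 y.
Proof. by rewrite /int3 /= !rmorphB. Qed.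

Lemma det3_int3 x y z : det3 (int3 x) (int3 y) (int3 z) = (det3 x y z)%:~R.
Proof. by rewrite /det3 /cross3 /dot3 /= !(intrD, intrM, intrN). Qed.

(** Values lie within W of g x0, so 2 n bins of length D suffice for some n with W / D < n <= W / D
    + 1. *)
Lemma pigeonhole_real (T : eqType) (g : T -> R) (s : seq T) (W D K : R) :
  0 <= W -> 0 < D -> 0 <= K -> uniq s ->
  {in s &, forall x y, g x - g y <= W} ->
  (forall t : seq T, uniq t -> {subset t <= s} ->
    {in t &, forall x y, g x - g y <= D} -> (size t)%:R <= K) ->
  (size s)%:R <= (2 * W / D + 3) * K.
Proof.
move=> W0 D0 K0 us sW tK; have WD0 : 0 <= W / D by rewrite divr_ge0// ltW.
case: s us sW tK => [|x0 s0]; first by move=> _ _ _; rewrite mulr_ge0//; lra.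
set s := x0 :: s0 => us sW tK; have x0s : x0 \in s by rewrite mem_head.
have [n [nW nW1]] : exists n : nat, W / D < n%:R /\ n%:R <= W / D + 1.
  exists (Num.truncn (W / D)).+1; split; first by rewrite truncnS_gt.
  by rewrite -natr1 lerD2r truncn_le.
pose h x := (g x - g x0) / D + n%:R.
have hD x y : h x - h y = (g x - g y) / D by rewrite /h; field; rewrite gt_eqF.
have h0 x : x \in s -> 0 <= h x.
  move=> xs; suff : (g x0 - g x) / D <= W / D.
    have -> : (g x0 - g x) / D = - ((g x - g x0) / D) by ring.
    by rewrite /h => ?; lra.
  by rewrite ler_pM2r ?invr_gt0// sW.
have hn x : x \in s -> h x < 2 * n%:R.
  move=> xs; suff : (g x - g x0) / D <= W / D by rewrite /h => ?; lra.
  by rewrite ler_pM2r ?invr_gt0// sW.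
(* Sizes are integers, so [K] may be replaced by its integral part. *)
pose M := Num.truncn K.
have MK : M%:R <= K by rewrite truncn_le.
have sM : (size s <= size (iota 0 (2 * n)) * M)%N.
  apply: (@leq_size_fibers _ _ (fun x => Num.truncn (h x))) => [x xs|k _].
    rewrite mem_iota /= add0n -(ltr_nat R).
    by apply: (@le_lt_trans _ _ (h x)); rewrite ?truncn_le ?h0// natrM hn.
  rewrite /M truncn_ge_nat//; apply: tK; first by rewrite filter_uniq.
    by move=> x; rewrite mem_filter => /andP[].
  move=> x y; rewrite !mem_filter => /andP[/eqP kx xs] /andP[/eqP ky ys].
  have hx : h x < k.+1%:R by rewrite -kx truncnS_gt.
  have hy : k%:R <= h y by rewrite -ky truncn_le ?h0.
  have : (g x - g y) / D <= 1 by rewrite -hD; move: hx hy; rewrite -natr1 => ? ?; lra.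
  by rewrite ler_pdivrMr// mul1r.
apply: (@le_trans _ _ ((2 * n)%:R * M%:R)).
  by rewrite -natrM ler_nat; move: sM; rewrite size_iota.
apply: ler_pM => //.
by rewrite natrM -mulrA; lra.
Qed.

(* The determinant of three differences, an integer, is too small to be nonzero. *)
Lemma size_piece lam K t x0 (f1 f2 f3 : R * R * R) (w1 w2 w3 : R) :
  coplanar_bound lam K -> uniq t -> on_sphere lam t ->
  {in t, forall x : Z3, [/\ `|dot3 f1 (int3 x - int3 x0)| <= w1,
    `|dot3 f2 (int3 x - int3 x0)| <= w2 & `|dot3 f3 (int3 x - int3 x0)| <= w3]} ->
  6 * (w1 * w2 * w3) < `|det3 f1 f2 f3| ->
  (size t)%:R <= K.
Proof.
move=> HK ut ts tw wf; apply: HK => //.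
have det0 : {in t & &, forall x y z, det3 (x - x0) (y - x0) (z - x0) = 0}.
  move=> x y z xt yt zt; set m := det3 _ _ _.
  have mE : m%:~R = det3 (int3 x - int3 x0) (int3 y - int3 x0) (int3 z - int3 x0).
    by rewrite -!int3B det3_int3.
  apply/eqP; rewrite -normr_le0 -ltzD1 add0r -(ltr_int R) intr_norm mE.
  have [x1 x2 x3] := tw x xt; have [y1 y2 y3] := tw y yt.
  have [z1 z2 z3] := tw z zt.
  set X := int3 x - _ in mE x1 x2 x3 *; set Y := int3 y - _ in mE y1 y2 y3 *.
  set Z := int3 z - _ in mE z1 z2 z3 *.
  have f0 : 0 < `|det3 f1 f2 f3|.
    by apply: le_lt_trans wf; rewrite mulr_ge0 ?mulr_ge0 ?(le_trans _ x1)
      ?(le_trans _ x2) ?(le_trans _ x3).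
  rewrite -(ltr_pM2l f0) mulr1 -normrM; apply: le_lt_trans wf.
  (* Multiplicativity of the determinant: six products of pairings, each at most w1 w2 w3. *)
  have -> : det3 f1 f2 f3 * det3 X Y Z =
      dot3 f1 X * dot3 f2 Y * dot3 f3 Z - dot3 f1 X * dot3 f2 Z * dot3 f3 Y
    + dot3 f1 Y * dot3 f2 Z * dot3 f3 X - dot3 f1 Y * dot3 f2 X * dot3 f3 Z
    + dot3 f1 Z * dot3 f2 X * dot3 f3 Y - dot3 f1 Z * dot3 f2 Y * dot3 f3 X.
    by rewrite /det3 /cross3 /dot3 /=; ring.
  have P (a b c : R) : `|a| <= w1 -> `|b| <= w2 -> `|c| <= w3 ->
      `|a * b * c| <= w1 * w2 * w3.
    by move=> *; rewrite !normrM !ler_pM// mulr_ge0.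
  have := P _ _ _ x1 y2 z3; have := P _ _ _ x1 z2 y3; have := P _ _ _ y1 z2 x3.
  have := P _ _ _ y1 x2 z3; have := P _ _ _ z1 x2 y3; have := P _ _ _ z1 y2 x3.
  rewrite !ler_norml => /andP[? ?] /andP[? ?] /andP[? ?] /andP[? ?] /andP[? ?].
  by move=> /andP[? ?]; apply/andP; split; lra.
(* By trilinearity the determinant based at x is a combination of four determinants based at x0,
   which all vanish. *)
move=> x y z xt yt zt w wt.
have := det0 _ _ _ wt yt zt; have := det0 _ _ _ xt yt zt.
have := det0 _ _ _ wt xt zt; have := det0 _ _ _ wt yt xt.
move=> e1 e2 e3 e4.
transitivity (det3 (w - x0) (y - x0) (z - x0) - det3 (x - x0) (y - x0) (z - x0)
  - det3 (w - x0) (x - x0) (z - x0) - det3 (w - x0) (y - x0) (x - x0)).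
  by rewrite /det3 /cross3 /dot3 /=; ring.
by rewrite e1 e2 e3 e4 !subr0.
Qed.

Lemma coplanar_bound_ge0 lam K : coplanar_bound lam K -> 0 <= K.
Proof. by move=> /(_ [::]) h; apply: h. Qed.

Lemma frame_norm v b : dot3 v v = 1 -> dot3 b b = 1 -> dot3 v b = 0 ->
  forall d, dot3 d d = dot3 v d ^+ 2 + dot3 b d ^+ 2 + dot3 (cross3 v b) d ^+ 2.
Proof.
move=> v1 b1 vb d; have := gram3 d v b; rewrite v1 b1 vb => e.
have -> : dot3 (cross3 v b) d = det3 d v b by rewrite /det3 /cross3 /dot3 /=; ring.
have -> : dot3 v d = dot3 d v by rewrite /dot3; ring.
have -> : dot3 b d = dot3 d b by rewrite /dot3; ring.
by rewrite e; ring.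
Qed.

(** A chord is nearly tangent: its component along the endpoint y is quadratic in its length. This
    supplies the third small width of a piece. *)
Lemma dot3_sphere (x y : R * R * R) : dot3 x x = dot3 y y ->
  dot3 y (x - y) = - (dot3 (x - y) (x - y) / 2).
Proof.
move=> e; suff : 2 * dot3 y (x - y) + dot3 (x - y) (x - y) = 0 by move=> ?; lra.
transitivity (dot3 x x - dot3 y y); last by rewrite e subrr.
by rewrite /dot3 /=; ring.
Qed.

Lemma norm_le_sqr (x y : R) : 0 <= y -> x ^+ 2 <= y ^+ 2 -> `|x| <= y.
Proof. by move=> y0 h; rewrite -ler_sqr ?nnegrE// real_normK ?num_real. Qed.

End counting.

(** * One quarter of a slab away from the poles *)

Section slabs_and_tubes.
Context {R : realType}.
Implicit Types (lam K mu : R) (s t : seq Z3).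
Implicit Types (v b d f : R * R * R).

Definition narrow (r : R) f s := {in s &, forall x y : Z3,
  `|dot3 f (int3 x) - dot3 f (int3 y)| <= r}.

Lemma dot3B (f x y : R * R * R) : dot3 f (x - y) = dot3 f x - dot3 f y.
Proof. by rewrite /dot3 /=; ring. Qed.

Lemma dot3Nl (f x : R * R * R) : dot3 (- f) x = - dot3 f x.
Proof. by rewrite /dot3 /=; ring. Qed.

(** Subtract the two circle equations and divide by y2 + y2' >= r. The drift of z contributes lam /
    (32 r), and that of y1, where |y1 + y1'| <= 11/5 r, contributes at most 3 q. *)
Lemma sector_chord (lam r q y1 y1' y2 y2' z z' : R) : 0 < lam -> 0 < r -> 0 < q ->
  lam ^+ 2 - z ^+ 2 = y1 ^+ 2 + y2 ^+ 2 -> lam ^+ 2 - z' ^+ 2 = y1' ^+ 2 + y2' ^+ 2 ->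
  `|y1| <= 11 / 10 * r -> `|y1'| <= 11 / 10 * r -> r / 2 <= y2 -> r / 2 <= y2' ->
  `|z| <= lam -> `|z'| <= lam -> `|z - z'| <= 1 / 64 -> `|y1 - y1'| <= q ->
  y2 - y2' <= lam / (32 * r) + 3 * q.
Proof.
move=> lam0 r0 q0 e1 e2 a1 a1' a2 a2' b b' zz yy.
have [h|pos] := leP (y2 - y2') 0.
  apply: le_trans h _; apply: addr_ge0; last by apply: mulr_ge0 => //; apply: ltW.
  by apply: divr_ge0; [exact: ltW|apply: mulr_ge0; [exact: ler0n|exact: ltW]].
have e3 : (y2 - y2') * (y2 + y2') = (z' - z) * (z' + z) - (y1 - y1') * (y1 + y1').
  by rewrite -!subr_sqr; move: e1 e2; clear => *; lra.
have h1 : (z' - z) * (z' + z) <= lam / 32.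
  apply: le_trans (ler_norm _) _; rewrite normrM distrC.
  have -> : lam / 32 = 1 / 64 * (lam + lam) by field.
  by apply: ler_pM (normr_ge0 _) (normr_ge0 _) zz (le_trans (ler_normD _ _) (lerD b' b)).
have h2 : - ((y1 - y1') * (y1 + y1')) <= 3 * r * q.
  apply: le_trans (ler_norm _) _; rewrite normrN normrM [leRHS]mulrC.
  apply: ler_pM (normr_ge0 _) (normr_ge0 _) yy _.
  apply: le_trans (ler_normD _ _) _; apply: le_trans (lerD a1 a1') _.
  by move: r0; clear => ?; lra.
have -> : lam / (32 * r) + 3 * q = (lam / 32 + 3 * r * q) / r by field; rewrite gt_eqF.
rewrite ler_pdivlMr//; apply: le_trans (_ : (y2 - y2') * (y2 + y2') <= _).
  by rewrite ler_pM2l//; move: a2 a2'; clear => *; lra.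
by rewrite e3; apply: lerD.
Qed.

(* On a piece where both coordinates orthogonal to v vary by at most q, the point x0 itself
   serves as the functional x - x0 |-> x0.(x - x0), which the sphere makes quadratically small. *)
Lemma slab_sector lam K mu r q v b s :
  1 <= mu -> mu ^+ 6 = lam -> coplanar_bound lam K ->
  dot3 v v = 1 -> dot3 b b = 1 -> dot3 v b = 0 ->
  0 < q -> q ^+ 3 = r -> 16 * lam <= r ^+ 2 -> r <= lam ->
  uniq s -> on_sphere lam s -> narrow (1 / 64) v s ->
  {in s, forall x : Z3,
     7 / 8 * r ^+ 2 <= lam ^+ 2 - dot3 v (int3 x) ^+ 2 <= 9 / 8 * r ^+ 2} ->
  {in s, forall x : Z3,
     `|dot3 b (int3 x)| <= dot3 (cross3 v b) (int3 x)} ->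
  (size s)%:R <= 82 * mu ^+ 4 * K.
Proof.
move=> mu1 muE HK v1 b1 vb q0 qE rlam rl us ss sv sr sb.
have K0 := coplanar_bound_ge0 HK.
have frame := frame_norm v1 b1 vb.
set b' := cross3 v b in sb frame.
have lam0 : 0 < lam by rewrite -muE exprn_gt0//; lra.
have r0 : 0 < r by rewrite -qE exprn_gt0.
(* The bounds 16 lam <= r^2 and r <= lam confine q = r^(1/3) to the interval from mu to mu^2. *)
have muq : mu <= q.
  have : mu ^+ 6 <= q ^+ 6.
    have -> : q ^+ 6 = r ^+ 2 by rewrite -qE; ring.
    by rewrite muE; nra.
  by rewrite ler_pXn2r// nnegrE; lra.
have qmu : q <= mu ^+ 2.
  have : q ^+ 3 <= (mu ^+ 2) ^+ 3 by rewrite qE -exprM muE.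
  by rewrite ler_pXn2r// nnegrE ?exprn_ge0//; lra.
have q1 : 1 <= q by lra.
pose y1 (x : Z3) := dot3 b (int3 x).
pose y2 (x : Z3) := dot3 b' (int3 x).
pose z (x : Z3) := dot3 v (int3 x).
have yz x : x \in s -> lam ^+ 2 - z x ^+ 2 = y1 x ^+ 2 + y2 x ^+ 2.
  by move=> xs; rewrite -(ss _ xs) frame; rewrite /y1 /y2 /z; ring.
have zl x : x \in s -> `|z x| <= lam.
  move=> xs; apply: norm_le_sqr; first exact: ltW.
  by have := yz x xs; have := sqr_ge0 (y1 x); have := sqr_ge0 (y2 x) => *; lra.
have yr x : x \in s -> [/\ - (11 / 10 * r) <= y1 x, y1 x <= 11 / 10 * r & r / 2 <= y2 x].
  move=> xs; have := sr x xs; have := sb x xs; rewrite -/(y1 x) -/(y2 x) -/(z x).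
  rewrite (yz x xs) ler_norml => /andP[h1 h2] /andP[h3 h4].
  have y20 : 0 <= y2 x by lra.
  have h5 : y1 x ^+ 2 <= y2 x ^+ 2 by nra.
  have : `|y1 x| <= 11 / 10 * r by apply: norm_le_sqr; [lra|nra].
  by rewrite ler_norml => /andP[? ?]; split => //; nra.
(* The factors count the intervals of length [q] needed for [y1] and for [y2]. Their product is 9/16
   lam / q^2 + 81 q^2, and both lam / q^2 and q^2 are at most mu^4. *)
have muK : 9 * q ^+ 2 * ((lam / (16 * q ^+ 4) + 9) * K) <= 82 * mu ^+ 4 * K.
  rewrite mulrA; apply: ler_wpM2r => //.
  have -> : 9 * q ^+ 2 * (lam / (16 * q ^+ 4) + 9) = 9 / 16 * (lam / q ^+ 2) + 81 * q ^+ 2.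
    by field; lra.
  have h1 : lam / q ^+ 2 <= mu ^+ 4.
    rewrite ler_pdivrMr ?exprn_gt0// -muE.
    have -> : mu ^+ 6 = mu ^+ 4 * mu ^+ 2 by ring.
    by rewrite ler_wpM2l ?exprn_ge0 ?ler_pXn2r ?nnegrE//; lra.
  have h2 : q ^+ 2 <= mu ^+ 4.
    have -> : mu ^+ 4 = (mu ^+ 2) ^+ 2 by ring.
    by rewrite ler_pXn2r ?nnegrE ?exprn_ge0//; lra.
  by have := exprn_ge0 4 (le_trans ler01 mu1) => ?; lra.
apply: le_trans muK.
have lq0 : 0 <= lam / (16 * q ^+ 4).
  apply: divr_ge0; first exact: ltW.
  by apply: mulr_ge0; [exact: ler0n|apply: exprn_ge0; exact: ltW].
apply: (@le_trans _ _ ((2 * (3 * r) / q + 3) * ((lam / (16 * q ^+ 4) + 9) * K))).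
  apply: (@pigeonhole_real _ _ y1) => //; first by lra.
  - by rewrite mulr_ge0// addr_ge0.
  - move=> x y /yr[? ? _] /yr[? ? _]; lra.
  move=> t ut ts ty1.
  have tW : {in t &, forall x y, y2 x - y2 y <= lam / (32 * r) + 3 * q}.
    move=> x y xt yt; have xs := ts _ xt; have ys := ts _ yt.
    have [x1 x2 x3] := yr x xs; have [y1' y2' y3] := yr y ys.
    have := zl x xs; have := zl y ys; have := sv x y xs ys; rewrite -/(z x) -/(z y).
    move=> zz zy zx.
    have e1 := yz x xs; have e2 := yz y ys.
    have dy := ty1 x y xt yt; have dy' : - q <= y1 x - y1 y by rewrite lerNl opprB; apply: ty1.
    by apply: (@sector_chord lam r q (y1 x) (y1 y) _ _ (z x) (z y)) => //; rewrite ler_norml; apply/andP.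
  have -> : lam / (16 * q ^+ 4) + 9 = 2 * (lam / (32 * r) + 3 * q) / q + 3.
    by rewrite -qE; field; lra.
  apply: (@pigeonhole_real _ _ y2) => //.
    apply: addr_ge0; last by apply: mulr_ge0 => //; apply: ltW.
    by apply: divr_ge0; [exact: ltW|apply: mulr_ge0; [exact: ler0n|exact: ltW]].
  move=> p up pt py2.
  case: p up pt py2 => // x0 p0; set p := x0 :: p0 => up pt py2.
  have x0p : x0 \in p by rewrite mem_head.
  have x0s : x0 \in s by apply: ts; apply: pt.
  have [x1 x2 x3] := yr x0 x0s; have r2 := sr x0 x0s.
  rewrite -/(z x0) (yz x0 x0s) in r2.
  have d2 x : x \in p -> dot3 (int3 x - int3 x0) (int3 x - int3 x0) <= 4 * q ^+ 2.
    move=> xp; rewrite frame !dot3B -/(y1 x) -/(y2 x) -/(z x) -/(z x0).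
    rewrite -/(y1 x0) -/(y2 x0).
    have := sv x x0 (ts _ (pt _ xp)) x0s; rewrite -/(z x) -/(z x0) ler_norml.
    move=> /andP[z1 z2].
    have := py2 x x0 xp x0p; have := py2 x0 x x0p xp.
    have := ty1 x x0 (pt _ xp) (pt _ x0p); have := ty1 x0 x (pt _ x0p) (pt _ xp).
    move: (y1 x - y1 x0) (y1 x0 - y1 x) (opprB (y1 x) (y1 x0)) => a _ <-.
    move: (y2 x - y2 x0) (y2 x0 - y2 x) (opprB (y2 x) (y2 x0)) => c _ <-.
    move: (z x - z x0) z1 z2 => e z1 z2 c1 c2 a1 a2.
    move: q1 z1 z2 c1 c2 a1 a2; clear => *.
    have : e ^+ 2 <= 1 by nra.
    have : a ^+ 2 <= q ^+ 2 by nra.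
    have : c ^+ 2 <= q ^+ 2 by nra.
    have : 1 <= q ^+ 2 by nra.
    by move=> *; lra.
  have x0E : dot3 (cross3 v (int3 x0)) (cross3 v (int3 x0)) = y1 x0 ^+ 2 + y2 x0 ^+ 2.
    rewrite -(yz _ x0s) -(ss _ x0s) /z -[dot3 (int3 x0) (int3 x0)]mul1r -v1.
    by rewrite /cross3 /dot3 /=; ring.
  apply: (@size_piece _ lam K p x0 (int3 x0) v (cross3 v (int3 x0))
    (2 * q ^+ 2) (1 / 64) (11 / 5 * q * r)) => //.
  - by move=> x /pt/ts; exact: ss.
  - move=> x xp; have xs := ts _ (pt _ xp); split.
    + rewrite dot3_sphere; last by rewrite !ss.
      rewrite normrN ger0_norm ?divr_ge0 ?dot3_ge0//.
      by have := d2 x xp => ?; lra.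
    + by rewrite dot3B; apply: sv.
    + apply: norm_le_sqr; first by apply: (mulr_ge0 _ (ltW r0)); apply: mulr_ge0 => //; apply: ltW.
      apply: le_trans (dot3_CS _ _) _; rewrite x0E.
      have -> : (11 / 5 * q * r) ^+ 2 = (121 / 100 * r ^+ 2) * (4 * q ^+ 2) by field.
      apply: ler_pM; rewrite ?dot3_ge0 ?d2 ?addr_ge0 ?sqr_ge0//.
      by move: r2 (sqr_ge0 r); clear => /andP[? ?] ?; lra.
  have -> : det3 (int3 x0) v (cross3 v (int3 x0)) =
      - dot3 (cross3 v (int3 x0)) (cross3 v (int3 x0)).
    by rewrite /det3 /cross3 /dot3 /=; ring.
  rewrite normrN x0E ger0_norm ?addr_ge0 ?sqr_ge0//.
  (* Here q^3 = r is used: the volume is of order r^2, with 33/80 below the 7/8 available in the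
     determinant |v x x0|^2. *)
  have -> : 6 * (2 * q ^+ 2 * (1 / 64) * (11 / 5 * q * r)) = 33 / 80 * r ^+ 2.
    by rewrite -qE; field.
  by move: r2 (exprn_gt0 2 r0); clear => /andP[? ?] ?; lra.
apply: ler_wpM2r; first by rewrite mulr_ge0// addr_ge0.
have -> : 2 * (3 * r) / q = 6 * q ^+ 2 by rewrite -qE; field; lra.
nra.
Qed.
End slabs_and_tubes.

(** * Lattice points in slabs and tubes *)

Section slab_and_tube_counts.
Context {R : realType}.
Implicit Types (lam K mu : R) (s t : seq Z3).
Implicit Types (v b d e f : R * R * R).

Lemma cbrt_exists (r : R) : 0 < r -> exists2 q : R, 0 < q & q ^+ 3 = r.
Proof.
move=> r0; exists (r `^ 3^-1); first exact: powR_gt0.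
by rewrite -powR_mulrn ?powR_ge0// -powRrM mulVf// powRr1// ltW.
Qed.

Lemma size_filter_cover4 (T : eqType) (s : seq T) (p1 p2 p3 p4 : pred T) (B : R) :
  {in s, forall x, [|| p1 x, p2 x, p3 x | p4 x]} ->
  (size (seq.filter p1 s))%:R <= B -> (size (seq.filter p2 s))%:R <= B ->
  (size (seq.filter p3 s))%:R <= B -> (size (seq.filter p4 s))%:R <= B ->
  (size s)%:R <= 4 * B.
Proof.
move=> cov b1 b2 b3 b4.
have : (size s <= size (seq.filter p1 s) + size (seq.filter p2 s)
  + size (seq.filter p3 s) + size (seq.filter p4 s))%N.
  elim: s cov {b1 b2 b3 b4} => // x s IH cov /=.
  have := cov x (mem_head _ _).
  have {}IH := IH (fun y ys => cov y (mem_behead (s := x :: s) ys)).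
  by case: (p1 x); case: (p2 x); case: (p3 x); case: (p4 x) => //= _;
    clear -IH; lia.
rewrite -(ler_nat R) !natrD => h; lra.
Qed.

Lemma narrow_filter (r : R) f s p : narrow r f s -> narrow r f (seq.filter p s).
Proof.
move=> h x y; rewrite !mem_filter => /andP[_ xs] /andP[_ ys]; exact: h.
Qed.

Lemma on_sphere_filter lam s p : on_sphere lam s -> on_sphere lam (seq.filter p s).
Proof. by move=> h x; rewrite !mem_filter => /andP[_ xs]; apply: h. Qed.

Lemma cross_frame v b : dot3 v v = 1 -> dot3 b b = 1 -> dot3 v b = 0 ->
  [/\ dot3 (cross3 v b) (cross3 v b) = 1, dot3 v (cross3 v b) = 0
    & cross3 v (cross3 v b) = - b].
Proof.
move=> v1 b1 vb; split.
- transitivity (dot3 v v * dot3 b b - dot3 v b ^+ 2).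
    by rewrite /cross3 /dot3 /=; ring.
  by rewrite v1 b1 vb; ring.
- by rewrite /cross3 /dot3 /=; ring.
have -> : cross3 v (cross3 v b) = (dot3 v b * v.1.1 - dot3 v v * b.1.1,
    dot3 v b * v.1.2 - dot3 v v * b.1.2, dot3 v b * v.2 - dot3 v v * b.2).
  by congr (_, _, _); rewrite /cross3 /dot3 /=; ring.
by rewrite v1 vb; congr (_, _, _) => /=; ring.
Qed.

Lemma cross3Nr v b : cross3 v (- b) = - cross3 v b.
Proof. by congr (_, _, _); rewrite /=; ring. Qed.

Lemma dot3N v : dot3 (- v) (- v) = dot3 v v.
Proof. by rewrite /dot3 /=; ring. Qed.

(** The four sectors obtained from b, v x b and their opposites cover the plane orthogonal to v. *)
Lemma slab_large lam K mu r q v b s :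
  1 <= mu -> mu ^+ 6 = lam -> coplanar_bound lam K ->
  dot3 v v = 1 -> dot3 b b = 1 -> dot3 v b = 0 ->
  0 < q -> q ^+ 3 = r -> 16 * lam <= r ^+ 2 -> r <= lam ->
  uniq s -> on_sphere lam s -> narrow (1 / 64) v s ->
  {in s, forall x : Z3,
     7 / 8 * r ^+ 2 <= lam ^+ 2 - dot3 v (int3 x) ^+ 2 <= 9 / 8 * r ^+ 2} ->
  (size s)%:R <= 328 * mu ^+ 4 * K.
Proof.
move=> mu1 muE HK v1 b1 vb q0 qE rl1 rl2 us ss sv sr.
have [c1 vc cc] := cross_frame v1 b1 vb; set c := cross3 v b in c1 vc cc.
have sector e (e1 : dot3 e e = 1) (ve : dot3 v e = 0) :
    (size [seq x <- s | `|dot3 e (int3 x)| <= dot3 (cross3 v e) (int3 x)])%:R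
      <= 82 * mu ^+ 4 * K.
  apply: (@slab_sector _ lam K mu r q v e) => //.
  - by rewrite filter_uniq.
  - exact: on_sphere_filter.
  - exact: narrow_filter.
  - by move=> x; rewrite mem_filter => /andP[_ xs]; apply: sr.
  - by move=> x; rewrite mem_filter => /andP[].
have vN e : dot3 v e = 0 -> dot3 v (- e) = 0.
  by move=> h; transitivity (- dot3 v e); [rewrite /dot3 /=; ring|rewrite h oppr0].
have -> : 328 * mu ^+ 4 * K = 4 * (82 * mu ^+ 4 * K) by ring.
have s1 := sector b b1 vb; have s2 := sector c c1 vc.
have := sector (- b); rewrite dot3N => /(_ b1 (vN _ vb)) s3.
have := sector (- c); rewrite dot3N => /(_ c1 (vN _ vc)) s4.
apply: size_filter_cover4 s1 s3 s2 s4 => x xs.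
rewrite !cross3Nr cc opprK -/c !dot3Nl !normrN.
move: (dot3 b _) (dot3 c _) => y1 y2; clear.
case: (lerP 0 y1) => h1; case: (lerP 0 y2) => h2;
  rewrite ?(ger0_norm h1) ?(ltr0_norm h1) ?(ger0_norm h2) ?(ltr0_norm h2);
  case: (lerP `|y1| `|y2|);
  rewrite ?(ger0_norm h1) ?(ltr0_norm h1) ?(ger0_norm h2) ?(ltr0_norm h2) => h3.
- by rewrite h3.
- by rewrite [y2 <= y1]ltW// !orbT.
- by rewrite h3 orbT.
- by rewrite [- y2 <= y1]ltW// !orbT.
- by rewrite h3.
- by rewrite [y2 <= - y1]ltW// !orbT.
- by rewrite h3 orbT.
- by rewrite [- y2 <= - y1]ltW// !orbT.
Qed.

(** The two coordinates orthogonal to v are at most 4 mu^3. Squares of side mu / 8 number at most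
    (131 mu^2)^2 = 17161 mu^4, and each holds coplanar points only. *)
Lemma slab_polar lam K mu v b s :
  1 <= mu -> mu ^+ 6 = lam -> coplanar_bound lam K ->
  dot3 v v = 1 -> dot3 b b = 1 -> dot3 v b = 0 ->
  uniq s -> on_sphere lam s -> narrow (1 / 64) v s ->
  {in s, forall x : Z3,
     lam ^+ 2 - dot3 v (int3 x) ^+ 2 <= 16 * lam} ->
  (size s)%:R <= 17161 * mu ^+ 4 * K.
Proof.
move=> mu1 muE HK v1 b1 vb us ss sv sr.
have K0 := coplanar_bound_ge0 HK; have frame := frame_norm v1 b1 vb.
have mu0 : 0 < mu by apply: lt_le_trans mu1.
have mu21 : 1 <= mu ^+ 2 by rewrite exprn_ege1.
pose y1 (x : Z3) := dot3 b (int3 x).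
pose y2 (x : Z3) := dot3 (cross3 v b) (int3 x).
pose z (x : Z3) := dot3 v (int3 x).
have yz x : x \in s -> lam ^+ 2 - z x ^+ 2 = y1 x ^+ 2 + y2 x ^+ 2.
  by move=> xs; rewrite -(ss _ xs) frame; rewrite /y1 /y2 /z; ring.
have m3 : (4 * mu ^+ 3) ^+ 2 = 16 * lam by rewrite -muE; ring.
have yb x : x \in s -> `|y1 x| <= 4 * mu ^+ 3 /\ `|y2 x| <= 4 * mu ^+ 3.
  move=> xs; have := sr x xs; rewrite -/(z x) (yz x xs) -m3.
  have p : 0 <= 4 * mu ^+ 3 by rewrite mulr_ge0// exprn_ge0// ltW.
  move=> h; split; apply: norm_le_sqr => //; apply: le_trans h.
    by rewrite lerDl sqr_ge0.
  by rewrite lerDr sqr_ge0.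
have W x y (g : Z3 -> R) : `|g x| <= 4 * mu ^+ 3 ->
    `|g y| <= 4 * mu ^+ 3 -> g x - g y <= 8 * mu ^+ 3.
  rewrite !ler_norml => /andP[_ h1] /andP[h2 _]; clear -h1 h2; lra.
have W0 : 0 <= 8 * mu ^+ 3 by rewrite mulr_ge0// exprn_ge0// ltW.
have D0 : 0 < mu / 8 by rewrite divr_gt0.
have WD : 2 * (8 * mu ^+ 3) / (mu / 8) + 3 <= 131 * mu ^+ 2.
  have -> : 2 * (8 * mu ^+ 3) / (mu / 8) = 128 * mu ^+ 2 by field; rewrite gt_eqF.
  clear -mu21; lra.
have WD0 : 0 <= 2 * (8 * mu ^+ 3) / (mu / 8) + 3.
  by rewrite addr_ge0 ?divr_ge0 ?mulr_ge0 ?exprn_ge0 ?ltW.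
have -> : 17161 * mu ^+ 4 * K = 131 * mu ^+ 2 * (131 * mu ^+ 2 * K) by ring.
apply: (@le_trans _ _ ((2 * (8 * mu ^+ 3) / (mu / 8) + 3) *
    ((2 * (8 * mu ^+ 3) / (mu / 8) + 3) * K))); last first.
  by rewrite ler_pM// ?mulr_ge0// ler_wpM2r.
apply: (@pigeonhole_real _ _ y1) => //; first by rewrite mulr_ge0.
  by move=> x y /yb[? _] /yb[? _]; apply: W.
move=> t ut ts ty1; apply: (@pigeonhole_real _ _ y2) => //.
  by move=> x y /ts/yb[_ ?] /ts/yb[_ ?]; apply: W.
move=> p up pt py2.
case: p up pt py2 => [_ _ _|x0 p0]; first by rewrite (le_trans _ K0).
set p := x0 :: p0 => up pt py2.
have x0p : x0 \in p by rewrite mem_head.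
have x0s : x0 \in s by apply: ts; apply: pt.
have pb x : x \in p -> [/\ `|y1 x - y1 x0| <= mu / 8, `|y2 x - y2 x0| <= mu / 8
    & `|z x - z x0| <= 1 / 64].
  move=> xp; split; last exact: (sv x x0 (ts _ (pt _ xp)) x0s).
    rewrite ler_norml (ty1 x x0 (pt _ xp) (pt _ x0p)) andbT lerNl opprB.
    by rewrite (ty1 x0 x (pt _ x0p) (pt _ xp)).
  by rewrite ler_norml (py2 x x0 xp x0p) andbT lerNl opprB (py2 x0 x x0p xp).
have ps : on_sphere lam p by move=> x /pt/ts; exact: ss.
have sq (a c : R) : `|a| <= c -> a ^+ 2 <= c ^+ 2.
  by move=> h; rewrite -(real_normK (num_real a)) lerXn2r ?nnegrE// (le_trans _ h).
(* Using x0 as a functional requires |v.x0| >= lam / 2, which the polar hypothesis gives for lam >=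
   64. Below 64 one has mu^2 < 4, and the box in the frame v, b, v x b is already small enough. *)
have [l64|l64] := ltP lam 64.
  apply: (@size_piece _ lam K p x0 v b (cross3 v b) (1 / 64) (mu / 8) (mu / 8)) => //.
    by move=> x xp; have [? ? ?] := pb x xp; split; rewrite dot3B.
  have -> : det3 v b (cross3 v b) = dot3 v v * dot3 b b - dot3 v b ^+ 2.
    by rewrite /det3 /cross3 /dot3 /=; ring.
  rewrite v1 b1 vb expr0n /= subr0 mulr1 normr1.
  have mu2 : mu ^+ 2 < 4.
    have : (mu ^+ 2) ^+ 3 < 4 ^+ 3 by rewrite -exprM muE; clear -l64; lra.
    by rewrite ltr_pXn2r// nnegrE// exprn_ge0// ltW.
  have -> : 6 * (1 / 64 * (mu / 8) * (mu / 8)) = 6 / 4096 * mu ^+ 2 by field.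
  clear -mu2; lra.
apply: (@size_piece _ lam K p x0 (int3 x0) b (cross3 v b) (mu ^+ 2 / 32)
    (mu / 8) (mu / 8)) => //.
  move=> x xp; have [h1 h2 h3] := pb x xp; split; rewrite ?dot3B//.
  rewrite -dot3B dot3_sphere; last by rewrite !ps.
  rewrite normrN ger0_norm ?divr_ge0 ?dot3_ge0// frame !dot3B.
  move: (sq _ _ h1) (sq _ _ h2) (sq _ _ h3).
  rewrite /y1 /y2 /z; clear -mu21 => *; lra.
have -> : det3 (int3 x0) b (cross3 v b) =
    dot3 v (int3 x0) * dot3 b b - dot3 v b * dot3 b (int3 x0).
  by rewrite /det3 /cross3 /dot3 /=; ring.
rewrite b1 vb mul0r subr0 mulr1 -/(z x0).
have -> : 6 * (mu ^+ 2 / 32 * (mu / 8) * (mu / 8)) = 6 / 2048 * mu ^+ 4 by field.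
have m4 : mu ^+ 4 <= lam.
  rewrite -muE; have -> : mu ^+ 6 = mu ^+ 4 * mu ^+ 2 by ring.
  by rewrite ler_peMr// exprn_ge0// ltW.
apply: (@lt_le_trans _ _ (lam / 2)); first by clear -m4 l64; lra.
rewrite leNgt; apply/negP => zl.
have z2 : z x0 ^+ 2 <= (lam / 2) ^+ 2 by apply: sq; exact: ltW.
have := sr _ x0s; rewrite -/(z x0); clear -z2 l64 => h.
by nra.
Qed.

(** Across the slab lam^2 - (v.x)^2 varies by at most lam / 32. A single point where it exceeds 16
    lam therefore fixes the ring radius r for all points, up to the tolerance of [slab_large];
    otherwise the slab is polar. *)
Lemma slab_count lam K mu v b s :
  1 <= mu -> mu ^+ 6 = lam -> coplanar_bound lam K ->
  dot3 v v = 1 -> dot3 b b = 1 -> dot3 v b = 0 ->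
  uniq s -> on_sphere lam s -> narrow (1 / 64) v s ->
  (size s)%:R <= 17161 * mu ^+ 4 * K.
Proof.
move=> mu1 muE HK v1 b1 vb us ss sv.
pose z (x : Z3) := dot3 v (int3 x).
have lam1 : 1 <= lam by rewrite -muE exprn_ege1.
have [/hasP[x0 x0s big]|/hasPn small] :=
    boolP (has (fun x => 16 * lam < lam ^+ 2 - z x ^+ 2) s); last first.
  by apply: (@slab_polar lam K mu v b) => // x xs; rewrite leNgt small.
have zl x : x \in s -> z x ^+ 2 <= lam ^+ 2.
  by move=> xs; rewrite -(ss _ xs) -[leRHS]mul1r -v1 dot3_CS.
pose r := Num.sqrt (lam ^+ 2 - z x0 ^+ 2).
have rE : r ^+ 2 = lam ^+ 2 - z x0 ^+ 2 by rewrite sqr_sqrtr// subr_ge0 zl.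
have r0 : 0 < r.
  by rewrite sqrtr_gt0; apply: le_lt_trans big; rewrite mulr_ge0//; apply: le_trans lam1.
have rl : r <= lam.
  have ln : 0 <= lam by apply: le_trans lam1.
  by rewrite -(ler_sqr (ltW r0 : r \is Num.nneg) ln) rE gerBl sqr_ge0.
have [q q0 qE] := cbrt_exists r0.
apply: (@le_trans _ _ (328 * mu ^+ 4 * K)); last first.
  rewrite ler_wpM2r ?(coplanar_bound_ge0 HK)// ler_wpM2r ?ler_nat//.
  by rewrite exprn_ge0// (le_trans _ mu1).
apply: (@slab_large lam K mu r q v b) => //; first by rewrite rE ltW.
move=> x xs; rewrite -/(z x).
have zd : `|z x ^+ 2 - z x0 ^+ 2| <= 1 / 64 * (2 * lam).
  rewrite subr_sqr normrM; apply: ler_pM => //; first exact: sv.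
  apply: le_trans (ler_normD _ _) _.
  have zl' y : y \in s -> `|z y| <= lam.
    by move=> ys; apply: norm_le_sqr; rewrite ?zl// (le_trans _ lam1).
  by have := zl' _ xs; have := zl' _ x0s; clear => *; lra.
move: zd; rewrite ler_norml rE; clear -big lam1 => /andP[? ?].
by apply/andP; split; lra.
Qed.

(** Let R2 be the squared distance of a point from the axis through the origin with direction e1 x
    e2, and w its height along that axis. R2, hence w^2, varies by at most lam / 16. If R2 >= lam^2
    / 4 somewhere, then w >= 0 varies by at most mu^3 / 4 and is cut into intervals of length mu^2.
    Otherwise w >= lam / 2 everywhere, and w varies by at most 1/8. *)
Lemma tube_same_sign lam K mu e1 e2 s :
  1 <= mu -> mu ^+ 6 = lam -> coplanar_bound lam K ->
  dot3 e1 e1 = 1 -> dot3 e2 e2 = 1 -> dot3 e1 e2 = 0 ->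
  uniq s -> on_sphere lam s -> narrow (1 / 64) e1 s -> narrow (1 / 64) e2 s ->
  {in s, forall x : Z3, 0 <= dot3 (cross3 e1 e2) (int3 x)} ->
  (size s)%:R <= 4 * mu * K.
Proof.
move=> mu1 muE HK t11 t22 t12 us ss s1 s2 sw.
have K0 := coplanar_bound_ge0 HK; have frame := frame_norm t11 t22 t12.
have mu0 : 0 < mu by apply: lt_le_trans mu1.
have lam1 : 1 <= lam by rewrite -muE exprn_ege1.
have lam0 : 0 < lam by apply: lt_le_trans lam1.
pose a (x : Z3) := dot3 e1 (int3 x).
pose c (x : Z3) := dot3 e2 (int3 x).
pose w (x : Z3) := dot3 (cross3 e1 e2) (int3 x).
pose R2 x := a x ^+ 2 + c x ^+ 2.
have Rw x : x \in s -> R2 x + w x ^+ 2 = lam ^+ 2.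
  by move=> xs; rewrite -(ss _ xs) frame.
have al x : x \in s -> `|a x| <= lam /\ `|c x| <= lam.
  move=> xs; split; apply: norm_le_sqr (ltW lam0) _; rewrite -(Rw x xs) /R2.
    by rewrite -addrA lerDl addr_ge0 ?sqr_ge0.
  by rewrite [a x ^+ 2 + _]addrC -addrA lerDl addr_ge0 ?sqr_ge0.
have Rd x y : x \in s -> y \in s -> `|R2 x - R2 y| <= lam / 16.
  move=> xs ys; have [a1 c1] := al x xs; have [a2 c2] := al y ys.
  have P (f : Z3 -> R) : `|f x - f y| <= 1 / 64 ->
      `|f x| <= lam -> `|f y| <= lam -> `|f x ^+ 2 - f y ^+ 2| <= 1 / 64 * (2 * lam).
    move=> h h1 h2; rewrite subr_sqr normrM; apply: ler_pM => //.
    by apply: le_trans (ler_normD _ _) _; clear -h1 h2; lra.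
  have := P a (s1 x y xs ys) a1 a2; have := P c (s2 x y xs ys) c1 c2.
  rewrite /R2 !ler_norml; clear => /andP[? ?] /andP[? ?].
  by apply/andP; split; lra.
have wd x y : x \in s -> y \in s -> w x ^+ 2 - w y ^+ 2 <= lam / 16.
  move=> xs ys; have := Rd x y xs ys; have := Rw x xs; have := Rw y ys.
  by rewrite ler_norml; clear => ? ? /andP[? ?]; lra.
have [/hasP[x0 x0s big]|/hasPn small] :=
    boolP (has (fun x => lam ^+ 2 / 4 <= R2 x) s).
  have Rlow x : x \in s -> lam ^+ 2 / 8 <= R2 x.
    move=> xs; have := Rd x x0 xs x0s; rewrite ler_norml => /andP[h _].
    have : lam <= lam ^+ 2 by rewrite expr2 ler_peMl// ltW.
    by move: big h; clear -lam0 => *; lra.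
  have m2 : 0 < mu ^+ 2 by rewrite exprn_gt0.
  apply: (@le_trans _ _ ((2 * (mu ^+ 3 / 4) / mu ^+ 2 + 3) * K)); last first.
    rewrite ler_wpM2r//.
    have -> : 2 * (mu ^+ 3 / 4) / mu ^+ 2 = mu / 2 by field; rewrite gt_eqF.
    by clear -mu1; lra.
  apply: (@pigeonhole_real _ _ w) => //.
    by rewrite divr_ge0// exprn_ge0// ltW.
  - move=> x y xs ys; apply: le_trans (ler_norm _) _.
    apply: norm_le_sqr; first by rewrite divr_ge0// exprn_ge0// ltW.
    have -> : (mu ^+ 3 / 4) ^+ 2 = lam / 16 by rewrite -muE; field.
    have := wd x y xs ys; have := wd y x ys xs; have := sw x xs; have := sw y ys.
    rewrite -/(w x) -/(w y); clear => ? ? ? ?.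
    by have [?|?] := leP (w x) (w y); nra.
  move=> p up pt pw.
  case: p up pt pw => [_ _ _|y0 p0]; first by rewrite (le_trans _ K0).
  set p := y0 :: p0 => up pt pw.
  have y0p : y0 \in p by rewrite mem_head.
  have y0s : y0 \in s by apply: pt.
  have ps : on_sphere lam p by move=> x /pt; exact: ss.
  have RE : dot3 (cross3 (int3 y0) (cross3 e1 e2)) (cross3 (int3 y0) (cross3 e1 e2)) = R2 y0.
    transitivity (dot3 (int3 y0) (int3 y0) *
      (dot3 e1 e1 * dot3 e2 e2 - dot3 e1 e2 ^+ 2) - w y0 ^+ 2).
      by rewrite /w /cross3 /dot3 /=; ring.
    by rewrite t11 t22 t12 (ss _ y0s) -(Rw _ y0s); ring.
  have r0 : 0 < R2 y0.
    by apply: lt_le_trans (Rlow _ y0s); rewrite divr_gt0 ?exprn_gt0.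
  pose r := Num.sqrt (R2 y0).
  have rE : r ^+ 2 = R2 y0 by rewrite sqr_sqrtr// ltW.
  have rp : 0 < r by rewrite sqrtr_gt0.
  have lr : lam <= 3 * r.
    have r3 : 0 <= 3 * r by rewrite mulr_ge0// ltW.
    rewrite -(ler_sqr (ltW lam0 : lam \is Num.nneg) r3) exprMn rE.
    by have := Rlow _ y0s; clear -r0 => *; lra.
  (* The third functional is y0 x (e1 x e2), a combination of e1 and e2 with coefficients at most r
     = sqrt (R2 y0). The determinant is r^2, against 3/16 lam r <= 9/16 r^2 from the widths. *)
  apply: (@size_piece _ lam K p y0 (int3 y0) (cross3 e1 e2)
    (cross3 (int3 y0) (cross3 e1 e2)) (mu ^+ 4) (mu ^+ 2) (r / 32)) => //.
    move=> x xp; have xs := pt _ xp.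
    have h1 := s1 x y0 xs y0s; have h2 := s2 x y0 xs y0s.
    have h3 : `|w x - w y0| <= mu ^+ 2.
      by rewrite ler_norml lerNl opprB !pw.
    split.
    - rewrite dot3_sphere; last by rewrite !ps.
      rewrite normrN ger0_norm ?divr_ge0 ?dot3_ge0// frame !dot3B.
      have sq (e f : R) : `|e| <= f -> e ^+ 2 <= f ^+ 2.
        by move=> h; rewrite -(real_normK (num_real e)) lerXn2r ?nnegrE// (le_trans _ h).
      have := sq _ _ h1; have := sq _ _ h2; have := sq _ _ h3; rewrite /w.
      have : 1 <= mu ^+ 4 by rewrite exprn_ege1.
      have -> : (mu ^+ 2) ^+ 2 = mu ^+ 4 by rewrite -exprM.
      by clear => *; lra.
    - by rewrite dot3B.
    - have -> : dot3 (cross3 (int3 y0) (cross3 e1 e2)) (int3 x - int3 y0) =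
          c y0 * (a x - a y0) - a y0 * (c x - c y0).
        by rewrite /a /c /cross3 /dot3 /=; ring.
      have ar : `|a y0| <= r.
        by apply: norm_le_sqr (ltW rp) _; rewrite rE lerDl sqr_ge0.
      have cr : `|c y0| <= r.
        by apply: norm_le_sqr (ltW rp) _; rewrite rE lerDr sqr_ge0.
      apply: le_trans (ler_normB _ _) _; rewrite !normrM.
      have -> : r / 32 = r * (1 / 64) + r * (1 / 64) by field.
      by apply: lerD; apply: ler_pM.
  have -> : det3 (int3 y0) (cross3 e1 e2) (cross3 (int3 y0) (cross3 e1 e2)) =
      dot3 (cross3 (int3 y0) (cross3 e1 e2)) (cross3 (int3 y0) (cross3 e1 e2)).
    by rewrite /det3; move: (cross3 e1 e2) (int3 y0) => g f; rewrite /cross3 /dot3 /=; ring.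
  rewrite RE ger0_norm ?(ltW r0)// -rE.
  have -> : 6 * (mu ^+ 4 * mu ^+ 2 * (r / 32)) = 3 / 16 * (lam * r) by rewrite -muE; field.
  have : lam * r <= 3 * r * r by rewrite ler_wpM2r// ltW.
  by move: rp; rewrite expr2; clear => rp h; nra.
case: s us ss s1 s2 sw Rw al Rd wd small => [|x0 s0].
  by move=> *; rewrite !mulr_ge0// ltW.
set s := x0 :: s0 => us ss s1 s2 sw Rw al Rd wd small.
have x0s : x0 \in s by rewrite mem_head.
apply: (@le_trans _ _ K); last by rewrite ler_peMl//; clear -mu1; lra.
(* Steep tube: all the points fit into one box of volume below 1/6. *)
apply: (@size_piece _ lam K s x0 e1 e2 (cross3 e1 e2) (1 / 64) (1 / 64) (1 / 8)) => //.
  move=> x xs; rewrite !dot3B -/(w x) -/(w x0).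
  split; [exact: s1|exact: s2|].
  have wl y : y \in s -> lam / 2 <= w y.
    move=> ys; have := small y ys; rewrite -ltNge; have := Rw y ys.
    by have := sw y ys; rewrite -/(w y); clear -lam0 => *; nra.
  have h1 := wd x x0 xs x0s; have h2 := wd x0 x x0s xs.
  have h3 := wl _ xs; have h4 := wl _ x0s.
  rewrite ler_norml; clear -lam0 h1 h2 h3 h4; apply/andP; split; nra.
have -> : det3 e1 e2 (cross3 e1 e2) = dot3 e1 e1 * dot3 e2 e2 - dot3 e1 e2 ^+ 2.
  by rewrite /det3 /cross3 /dot3 /=; ring.
by rewrite t11 t22 t12 expr0n /= subr0 mulr1 normr1; clear; lra.
Qed.

(** Replacing e2 by -e2 reverses the axis, so each half of the tube is an instance of the one-sided
    bound. *)
Lemma tube_count lam K mu e1 e2 s :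
  1 <= mu -> mu ^+ 6 = lam -> coplanar_bound lam K ->
  dot3 e1 e1 = 1 -> dot3 e2 e2 = 1 -> dot3 e1 e2 = 0 ->
  uniq s -> on_sphere lam s -> narrow (1 / 64) e1 s -> narrow (1 / 64) e2 s ->
  (size s)%:R <= 8 * mu * K.
Proof.
move=> mu1 muE HK t11 t22 t12 us ss s1 s2.
pose p (x : Z3) := 0 <= dot3 (cross3 e1 e2) (int3 x).
pose p' (x : Z3) := 0 <= dot3 (cross3 e1 (- e2)) (int3 x).
have t12' : dot3 e1 (- e2) = 0.
  by transitivity (- dot3 e1 e2); [rewrite /dot3 /=; ring|rewrite t12 oppr0].
have b1 : (size (seq.filter p s))%:R <= 4 * mu * K.
  apply: (@tube_same_sign lam K mu e1 e2) => //; rewrite ?filter_uniq//.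
  - exact: on_sphere_filter.
  - exact: narrow_filter.
  - exact: narrow_filter.
  - by move=> x; rewrite mem_filter => /andP[].
have b2 : (size (seq.filter p' s))%:R <= 4 * mu * K.
  apply: (@tube_same_sign lam K mu e1 (- e2)) => //; rewrite ?dot3N ?filter_uniq//.
  - exact: on_sphere_filter.
  - exact: narrow_filter.
  - apply: narrow_filter => x y xs ys; rewrite !dot3Nl -opprD normrN.
    exact: s2.
  - by move=> x; rewrite mem_filter => /andP[].
have : (size s <= size (seq.filter p s) + size (seq.filter p' s))%N.
  rewrite !size_filter -(count_predC p) leq_add2l; apply: sub_count => x /=.
  by rewrite /p /p' cross3Nr dot3Nl -ltNge oppr_ge0 => /ltW.
by rewrite -(ler_nat R) natrD; move: b1 b2; clear => *; lra.
Qed.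

End slab_and_tube_counts.

(** * Sampled exponential sums *)

Local Open Scope classical_set_scope.
Local Open Scope ring_scope.
Local Open Scope complex_scope.

Local Notation normc := Normc.normc.

Section exponentials.
Context {R : realType}.
Implicit Types (t x y : R) (z w : R[i]).

Lemma ge0_derive_le (f df : R -> R) :
  (forall x, is_derive x 1 f (df x)) -> (forall x, 0 < x -> 0 <= df x) ->
  forall x, 0 <= x -> f 0 <= f x.
Proof.
move=> fd df0 x; rewrite le_eqVlt => /predU1P[<-//|x0].
have cf : {within `[0, x], continuous f}.
  apply: continuous_subspaceT => y; apply: differentiable_continuous.
  by apply/derivable1_diffP; have [] := fd y.
have [c] := MVT x0 (fun y _ => fd y) cf.
rewrite in_itv /= => /andP[c0 cx] e.
by rewrite -subr_ge0 e mulr_ge0 ?df0// subr0 ltW.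
Qed.

Lemma sin_le_id x : 0 <= x -> sin x <= x.
Proof.
move=> x0; suff : (id - @sin R) 0 <= (id - @sin R) x.
  by rewrite !fctE sin0 subr0 subr_ge0.
by apply: (@ge0_derive_le _ (fun y => 1 - cos y)).
Qed.

Lemma cos_ge_quadratic x : 1 - x ^+ 2 / 2 <= cos x.
Proof.
wlog x0 : x / 0 <= x.
  move=> h; have [/h//|/ltW x0] := leP 0 x.
  by rewrite -sqrrN -cosN; apply: h; rewrite oppr_ge0.
have -> : x = x / 2 *+ 2 by rewrite -mulr_natr; field.
rewrite cos_mulr2n cos2sin2 -[x / 2 *+ 2]mulr_natr.
have h0 : 0 <= x / 2 by rewrite divr_ge0.
have : sin (x / 2) ^+ 2 <= (x / 2) ^+ 2.
  have [p|p] := leP 0 (sin (x / 2)); first by rewrite lerXn2r ?nnegrE ?sin_le_id.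
  have q : (id + @sin R) 0 <= (id + @sin R) (x / 2).
    by apply: (@ge0_derive_le _ (fun y => 1 + cos y)).
  rewrite !fctE sin0 addr0 in q.
  rewrite -sqrrN lerXn2r ?nnegrE//; first by rewrite oppr_ge0 ltW.
  by rewrite -subr_ge0 opprK.
by move: (sin _) => s; rewrite exprMn -mulr_natr => h; lra.
Qed.

Lemma sin_ge_cubic x : 0 <= x -> x - x ^+ 3 / 6 <= sin x.
Proof.
move=> x0.
pose f := @sin R - id + 6^-1 \*: (@id R ^+ 3).
have D y : is_derive y 1 f (cos y - 1 + y ^+ 2 / 2).
  have h1 := is_deriveB (is_derive_sin y) (is_derive_id y (1 : R)).
  have h2 := is_deriveZ (6^-1) (is_deriveX 3 (is_derive_id y (1 : R))).
  apply: (is_derive_eq (is_deriveD h1 h2)).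
  by rewrite /GRing.scale /=; field.
have D0 y : 0 < y -> 0 <= cos y - 1 + y ^+ 2 / 2.
  by move=> _; have := cos_ge_quadratic y => ?; lra.
have fE y : f y = sin y - y + 6^-1 * y ^+ 3 by [].
have := ge0_derive_le D D0 x0.
by rewrite !fE sin0 expr0n /= mulr0 subrr addr0 => ?; lra.
Qed.

(** For 0 <= u = x / 2 <= 2 the cubic bound gives sin u >= u (1 - u^2 / 6) >= u / 3. *)
Lemma two_sub_cos_ge x : `|x| <= pi -> x ^+ 2 / 9 <= 2 - 2 * cos x.
Proof.
wlog x0 : x / 0 <= x.
  move=> h; have [/h//|/ltW x0] := leP 0 x.
  by rewrite -normrN -sqrrN -cosN; apply: h; rewrite oppr_ge0.
rewrite ger0_norm// => xpi; have p2 := pihalf_lt2 R.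
have h2 : x / 2 <= 2 by lra.
have -> : cos x = cos (x / 2 *+ 2) by congr cos; rewrite -mulr_natr; field.
rewrite cos_mulr2n cos2sin2.
have h0 : 0 <= x / 2 by rewrite divr_ge0.
have : x / 2 / 3 <= sin (x / 2).
  apply: le_trans (sin_ge_cubic h0); move: (x / 2) h0 h2 => u; clear => u0 u2.
  by nra.
by move: (sin _) => s h; rewrite -mulr_natr; clear -h h0; nra.
Qed.

Definition cis t : R[i] := cos t +i* sin t.

Lemma cisD x y : cis (x + y) = cis x * cis y.
Proof. by rewrite /cis cosD sinD; congr (_ +i* _); rewrite addrC. Qed.

Lemma cis0 : cis 0 = 1. Proof. by rewrite /cis cos0 sin0. Qed.

Lemma conj_cis x : conjc (cis x) = cis (- x).
Proof. by rewrite /cis cosN sinN. Qed.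

Lemma normc_cis x : normc (cis x) = 1.
Proof. by rewrite /= cos2Dsin2 sqrtr1. Qed.

Lemma cisX (x : R) n : cis (n%:R * x) = cis x ^+ n.
Proof.
elim: n => [|n IH]; first by rewrite mul0r cis0.
by rewrite -natr1 mulrDl mul1r cisD IH exprSr.
Qed.

Lemma cis2pi : cis (2 * pi) = 1.
Proof. by rewrite mulr_natl /cis cos2pi sin2pi. Qed.

Lemma cis2pi_int (k : int) : cis (k%:~R * (2 * pi)) = 1.
Proof.
case: k => n; first by rewrite -pmulrn cisX cis2pi expr1n.
by rewrite NegzE intrN mulNr -conj_cis -pmulrn cisX cis2pi expr1n conjc1.
Qed.

Definition sqn z : R := complex.Re z ^+ 2 + complex.Im z ^+ 2.

Lemma sqn_ge0 z : 0 <= sqn z.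
Proof. by rewrite addr_ge0// sqr_ge0. Qed.

Lemma normc_sqr z : normc z ^+ 2 = sqn z.
Proof. by case: z => a b; rewrite /= sqr_sqrtr// addr_ge0 ?sqr_ge0. Qed.

Lemma sqnE z : sqn z = complex.Re (z * conjc z).
Proof. by case: z => a b; rewrite /sqn /=; ring. Qed.

Lemma sqnM z w : sqn (z * w) = sqn z * sqn w.
Proof. by case: z => a b; case: w => c d; rewrite /sqn /=; ring. Qed.

Lemma normc_ge0 z : 0 <= normc z.
Proof. by case: z => a b; rewrite /= sqrtr_ge0. Qed.

Lemma Re_le_normc z : complex.Re z <= normc z.
Proof.
case: z => a b; rewrite /= (le_trans (ler_norm _))// -sqrtr_sqr ler_wsqrtr//.
by rewrite lerDl sqr_ge0.
Qed.

Lemma normc_conj z : normc (conjc z) = normc z.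
Proof. by case: z => a b; rewrite /= sqrrN. Qed.

Lemma Re_sum (I : Type) (s : seq I) (P : pred I) (F : I -> R[i]) :
  complex.Re (\sum_(i <- s | P i) F i) = \sum_(i <- s | P i) complex.Re (F i).
Proof. by apply: (big_morph (@complex.Re R)) => // -[a b] []. Qed.

Lemma conjc_sum (I : Type) (s : seq I) (P : pred I) (F : I -> R[i]) :
  conjc (\sum_(i <- s | P i) F i) = \sum_(i <- s | P i) conjc (F i).
Proof. exact: rmorph_sum. Qed.

Lemma conjcM z w : conjc (z * w) = conjc z * conjc w.
Proof. exact: rmorphM. Qed.

Lemma normc_sum (I : Type) (s : seq I) (P : pred I) (F : I -> R[i]) :
  normc (\sum_(i <- s | P i) F i) <= \sum_(i <- s | P i) normc (F i).
Proof.
elim/big_ind2 : _ => //; first by rewrite Normc.normc0.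
by move=> x a y b xa yb; apply: le_trans (le_normcD _ _) _; apply: lerD.
Qed.

Lemma sqn_sum (I : Type) (s : seq I) (F : I -> R[i]) :
  sqn (\sum_(i <- s) F i) = \sum_(i <- s) \sum_(j <- s) complex.Re (F i * conjc (F j)).
Proof.
rewrite sqnE conjc_sum big_distrlr /= Re_sum; apply: eq_bigr => i _.
exact: Re_sum.
Qed.

Lemma sqnD_le z w : sqn (z + w) <= 2 * sqn z + 2 * sqn w.
Proof.
case: z => a b; case: w => c d; rewrite /sqn /=.
by have := sqr_ge0 (a - c); have := sqr_ge0 (b - d) => *; lra.
Qed.

Definition dirichlet (L : nat) x : R[i] := \sum_(a < L) cis (a%:R * x).

Lemma normc_dirichlet_le L x : normc (dirichlet L x) <= L%:R.
Proof.
apply: le_trans (normc_sum _ _ _) _.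
by under eq_bigr do rewrite normc_cis; rewrite sumr_const card_ord.
Qed.

Lemma dirichlet_geometric L x : (1 - cis x) * dirichlet L x = 1 - cis (L%:R * x).
Proof.
rewrite /dirichlet; under eq_bigr do rewrite cisX.
by rewrite cisX; apply: oppr_inj; rewrite -mulNr !opprB subrX1.
Qed.

Lemma sqn_one_sub_cis x : sqn (1 - cis x) = 2 - 2 * cos x.
Proof.
by rewrite /sqn /= sub0r sqrrN sqrrB -addrA cos2Dsin2 -mulr_natr; ring.
Qed.

(** Averaging over differences b - a with a < L and b < 2 L makes the phases factor into two
    Dirichlet sums. A plain sum over i < L would give a single one, whose decay 1 / |x| is not
    summable over the cells; the product decays like 1 / (L x^2). *)
Definition fejer_kernel (L : nat) x : R :=
  normc (dirichlet (2 * L) x) * normc (dirichlet L (- x)) / L%:R.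

Lemma fejer_kernel_ge0 L x : 0 <= fejer_kernel L x.
Proof. by rewrite divr_ge0// mulr_ge0 ?normc_ge0. Qed.

Lemma normc_dirichletN L x :
  normc (dirichlet L (- x)) = normc (dirichlet L x).
Proof.
rewrite -[RHS]normc_conj; congr normc; rewrite conjc_sum.
by apply: eq_bigr => a _; rewrite conj_cis mulrN.
Qed.

Lemma fejer_kernelN L x : fejer_kernel L (- x) = fejer_kernel L x.
Proof. by rewrite /fejer_kernel !normc_dirichletN. Qed.

Lemma fejer_kernel_le L x : fejer_kernel L x <= 2 * L%:R.
Proof.
have [->|L0] := posnP L; first by rewrite /fejer_kernel invr0 !mulr0.
rewrite /fejer_kernel ler_pdivrMr ?ltr0n//.
by apply: ler_pM; rewrite ?normc_ge0// ?(le_trans (normc_dirichlet_le _ _))// natrM.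
Qed.

Lemma fejer_kernel_decay L x : (0 < L)%N -> `|x| <= pi ->
  fejer_kernel L x * (L%:R * x ^+ 2) <= 36.
Proof.
move=> L0 xpi; have L0' : 0 < L%:R :> R by rewrite ltr0n.
have -> : fejer_kernel L x * (L%:R * x ^+ 2) =
    normc (dirichlet (2 * L) x) * normc (dirichlet L x) * x ^+ 2.
  by rewrite /fejer_kernel normc_dirichletN; field; rewrite gt_eqF.
set n1 := normc _; set n2 := normc _.
have bound M : normc (1 - cis x) * normc (dirichlet M x) <= 2.
  rewrite -Normc.normcM dirichlet_geometric.
  by apply: le_trans (le_normcD _ _) _; rewrite normcN normc_cis Normc.normc1.
have n10 : 0 <= n1 by apply: normc_ge0.
have n20 : 0 <= n2 by apply: normc_ge0.
have h : normc (1 - cis x) ^+ 2 * (n1 * n2) <= 4.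
  have -> : normc (1 - cis x) ^+ 2 * (n1 * n2) =
    (normc (1 - cis x) * n1) * (normc (1 - cis x) * n2) by ring.
  have -> : 4 = 2 * 2 :> R by ring.
  by apply: ler_pM; rewrite ?mulr_ge0 ?normc_ge0 ?bound.
have := two_sub_cos_ge xpi; rewrite -sqn_one_sub_cis -normc_sqr => g.
have : x ^+ 2 / 9 * (n1 * n2) <= 4.
  by apply: le_trans h; rewrite ler_wpM2r// mulr_ge0.
by clear; rewrite mulrC => ?; lra.
Qed.

(* The right-hand side turns the sum of squares of an exponential sum into a Fejer-type kernel. *)
Lemma fejer_window (F : R -> R) (L : nat) : (0 < L)%N -> (forall x, 0 <= F x) ->
  \sum_(i < L) F i%:R <=
  L%:R^-1 * \sum_(a < L) \sum_(b < 2 * L) F (b%:R - a%:R).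
Proof.
move=> L0 F0; have L0' : 0 < L%:R :> R by rewrite ltr0n.
rewrite [leRHS]mulrC ler_pdivlMr//; set A := \sum_(i < L) F i%:R.
have -> : A * L%:R = \sum_(a < L) A by rewrite sumr_const card_ord mulr_natr.
apply: ler_sum => a _; rewrite /A {A}.
(* For fixed [a], the indices b in [a, a + L) already reproduce the left-hand side; the others are
   dropped by positivity. *)
rewrite -(big_mkord xpredT (fun b => F (b%:R - a%:R))).
rewrite (@big_cat_nat _ _ _ a)//=; last by rewrite mul2n -addnn ltnW// ltn_addr.
rewrite (@big_cat_nat _ _ _ (L + a) a)//=; [|by rewrite leq_addl|]; last first.
  by rewrite mul2n -addnn leq_add2l ltnW.
rewrite ler_wpDl ?sumr_ge0// ler_wpDr ?sumr_ge0//.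
rewrite -{1}[nat_of_ord a]add0n big_addn addnK big_mkord.
by apply: ler_sum => i _; rewrite natrD addrK.
Qed.

Lemma fejer_window2 (F : R -> R -> R) (L M : nat) : (0 < L)%N -> (0 < M)%N ->
  (forall x y, 0 <= F x y) ->
  \sum_(i < L) \sum_(j < M) F i%:R j%:R <=
  L%:R^-1 * M%:R^-1 * \sum_(a < L) \sum_(b < 2 * L) \sum_(c < M) \sum_(d < 2 * M)
    F (b%:R - a%:R) (d%:R - c%:R).
Proof.
move=> L0 M0 F0.
apply: le_trans (@fejer_window (fun x => \sum_(j < M) F x j%:R) L L0 _) _.
  by move=> x; apply: sumr_ge0.
rewrite -mulrA ler_wpM2l ?invr_ge0// mulr_sumr; apply: ler_sum => a _.
by rewrite mulr_sumr; apply: ler_sum => b _; apply: fejer_window.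
Qed.

Lemma sum_pairM (T U : finType) (F : T -> R[i]) (G : U -> R[i]) :
  \sum_(p : T * U) F p.1 * G p.2 = (\sum_x F x) * (\sum_y G y).
Proof. by rewrite big_distrlr /= pair_bigA. Qed.

(** After windowing in both variables and expanding the square, the pair (n, m) carries a product of
    four Dirichlet sums; taking moduli leaves the two kernels. *)
Lemma sampled_exponential_sum_le (I : Type) (s : seq I) (z : I -> R[i])
    (p q : I -> R) (L M : nat) : (0 < L)%N -> (0 < M)%N ->
  \sum_(i < L) \sum_(j < M)
    sqn (\sum_(n <- s) z n * cis (i%:R * p n + j%:R * q n)) <=
  \sum_(n <- s) \sum_(m <- s) normc (z n) * normc (z m) *
    (fejer_kernel L (p n - p m) * fejer_kernel M (q n - q m)).
Proof.
move=> L0 M0.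
pose F x y := sqn (\sum_(n <- s) z n * cis (x * p n + y * q n)).
apply: le_trans (@fejer_window2 F L M L0 M0 _) _.
  by move=> x y; apply: sqn_ge0.
rewrite /F; under eq_bigr do under eq_bigr do under eq_bigr do
  under eq_bigr do rewrite sqn_sum.
rewrite pair_bigA pair_bigA pair_bigA /= exchange_big /=.
rewrite mulr_sumr; apply: ler_sum => n _.
rewrite exchange_big /= mulr_sumr; apply: ler_sum => m _.
rewrite -Re_sum.
set S := bigop.body _ _ _.
pose x := p n - p m; pose y := q n - q m.
have -> : S = z n * conjc (z m) * (dirichlet L (- x) * dirichlet (2 * L) x *
    dirichlet M (- y) * dirichlet (2 * M) y).
  rewrite -!sum_pairM mulr_sumr; apply: eq_bigr => i _.
  rewrite conjcM conj_cis -!cisD mulrACA -cisD; congr (_ * cis _).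
  by rewrite /x /y; ring.
apply: le_trans (_ : _ <= L%:R^-1 * M%:R^-1 * normc _) _.
  by rewrite ler_wpM2l ?mulr_ge0 ?invr_ge0//; apply: Re_le_normc.
rewrite !Normc.normcM normc_conj /fejer_kernel -/x -/y.
by rewrite le_eqVlt; apply/orP; left; apply/eqP; ring.
Qed.

End exponentials.

(** * Schur's test and summation over cells *)

Section schur.
Context {R : realType}.

Lemma ler_sum_uniq_sub (I : eqType) (F : I -> R) (s t : seq I) :
  uniq s -> {subset s <= t} -> (forall i, 0 <= F i) ->
  \sum_(i <- s) F i <= \sum_(i <- t) F i.
Proof.
move=> us st F0; elim: s t us st => [|x s IH] t /=.
  by rewrite big_nil => _ _; apply: sumr_ge0.
move=> /andP[xs us] st; have xt : x \in t by apply: st; rewrite mem_head.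
rewrite big_cons (perm_big _ (perm_to_rem xt)) big_cons lerD2l; apply: IH => // y ys.
have : y \in t by apply: st; rewrite in_cons ys orbT.
rewrite (perm_mem (perm_to_rem xt)) in_cons => /orP[/eqP yx|//].
by rewrite yx (negPf xs) in ys.
Qed.

(** In the applications f sends a frequency to its cell, B is a slab or tube count and S the total
    weight of the cells. *)
Lemma ler_sum_fibers (I J : eqType) (f : I -> J) (G : J -> R) (s : seq I) (B S : R) :
  (forall j, 0 <= G j) -> 0 <= B ->
  (forall j, (count (fun i => f i == j) s)%:R <= B) ->
  (forall u : seq J, uniq u -> \sum_(j <- u) G j <= S) ->
  \sum_(i <- s) G (f i) <= B * S.
Proof.
move=> G0 B0 fB GS; set U := undup (map f s).
have -> : \sum_(i <- s) G (f i) = \sum_(j <- U) \sum_(i <- s | f i == j) G j.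
  rewrite (exchange_big_dep xpredT)//= big_seq [RHS]big_seq; apply: eq_bigr => i si.
  rewrite (eq_bigl (pred1 (f i))); last by move=> j; rewrite /= eq_sym.
  rewrite -big_filter filter_pred1_uniq ?undup_uniq ?big_seq1//.
  by rewrite mem_undup map_f.
apply: le_trans (_ : _ <= \sum_(j <- U) B * G j) _.
  apply: ler_sum => j _; rewrite big_const_seq iter_addr addr0 -mulr_natr mulrC.
  by rewrite ler_wpM2r.
by rewrite -mulr_sumr ler_wpM2l// GS// undup_uniq.
Qed.

(** From a_i a_j <= (a_i^2 + a_j^2) / 2 and the symmetry of the kernel. *)
Lemma schur_test (I : eqType) (s : seq I) (a : I -> R) (k : I -> I -> R) (B : R) :
  (forall i j, 0 <= k i j) -> (forall i j, k i j = k j i) ->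
  {in s, forall i, \sum_(j <- s) k i j <= B} ->
  \sum_(i <- s) \sum_(j <- s) a i * a j * k i j <= B * \sum_(i <- s) a i ^+ 2.
Proof.
move=> k0 ksym kB.
have half : \sum_(i <- s) \sum_(j <- s) a i ^+ 2 * k i j <= B * \sum_(i <- s) a i ^+ 2.
  rewrite mulr_sumr big_seq [leRHS]big_seq; apply: ler_sum => i si.
  by rewrite -mulr_sumr mulrC ler_wpM2r ?sqr_ge0 ?kB.
apply: le_trans (_ : _ <= \sum_(i <- s) \sum_(j <- s)
    (a i ^+ 2 * k i j / 2 + a j ^+ 2 * k j i / 2)) _.
  apply: ler_sum => i _; apply: ler_sum => j _; rewrite (ksym j i).
  rewrite -subr_ge0; have -> : a i ^+ 2 * k i j / 2 + a j ^+ 2 * k i j / 2 -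
    a i * a j * k i j = (a i - a j) ^+ 2 * (k i j / 2) by field.
  by rewrite mulr_ge0 ?sqr_ge0// divr_ge0.
under eq_bigr do rewrite big_split /=; rewrite big_split /= [X in _ + X]exchange_big /=.
set S := \sum_(i <- s) _.
have -> : S = (\sum_(i <- s) \sum_(j <- s) a i ^+ 2 * k i j) / 2.
  by rewrite mulr_suml; apply: eq_bigr => i _; rewrite mulr_suml.
by rewrite -splitr.
Qed.

(** Majorant of the kernel, up to a constant, when the frequency difference lies in the j-th
    interval of length 1/64. That length matches the width of the slabs and tubes counted above. *)
Definition cell_weight (j : int) : R := (1 + j%:~R ^+ 2)^-1.

Lemma cell_weight_ge0 j : 0 <= cell_weight j.
Proof. by rewrite invr_ge0 addr_ge0 ?sqr_ge0. Qed.

(** The subtracted term makes the bound telescope, with step 3 / ((N + 1)(N + 2)). *)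
Lemma sum_inv_sqr_le (N : nat) :
  \sum_(n < N) (1 + n%:R ^+ 2)^-1 <= 3 - 3 / N.+1%:R :> R.
Proof.
elim: N => [|N IH]; first by rewrite big_ord0; lra.
rewrite big_ord_recr /=; apply: le_trans (lerD IH (lexx _)) _.
have -> : 3 - 3 / N.+2%:R = 3 - 3 / N.+1%:R + 3 / (N.+1%:R * N.+2%:R) :> R.
  by rewrite -[N.+2%:R]natr1 -[N.+1%:R]natr1; have := ler0n R N; clear => ?; field; lra.
rewrite lerD2l -[leLHS]mul1r ler_pdivrMr ?ltr_wpDr ?sqr_ge0//.
rewrite mulrAC ler_pdivlMr ?mulr_gt0 ?ltr0n// mul1r.
have : (N.+1 * N.+2 <= 3 * (1 + N ^ 2))%N by clear; case: N => [|[|N]]//; nia.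
by rewrite -(ler_nat R) !natrM natrD natrX.
Qed.

Lemma sum_cell_weight_le (u : seq int) : uniq u -> \sum_(j <- u) cell_weight j <= 6.
Proof.
move=> uu; have [N uN] : exists N, {in u, forall j, (`|j| < N)%N}.
  exists (\max_(j <- u) `|j|%N).+1 => j ju; by rewrite ltnS (leq_bigmax_seq _ ju).
pose v := [seq Posz n | n <- iota 0 N] ++ [seq Negz n | n <- iota 0 N].
apply: le_trans (@ler_sum_uniq_sub _ cell_weight u v uu _ cell_weight_ge0) _.
  move=> j ju; have := uN j ju; rewrite mem_cat; case: j {ju} => n nN; apply/orP; [left|right];
    apply/mapP; exists n => //; rewrite mem_iota /=; clear -nN; lia.
have S := sum_inv_sqr_le N.
have N3 : 0 <= 3 / N.+1%:R :> R by rewrite divr_ge0.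
rewrite big_cat !big_map /= -{1 2}[N]subn0 !big_mkord.
have -> : 6 = 3 + 3 :> R by ring.
have S3 : \sum_(n < N) (1 + n%:R ^+ 2)^-1 <= 3 :> R.
  by apply: le_trans S _; rewrite gerBl.
apply: lerD; apply: le_trans S3; apply: ler_sum => n _; rewrite /cell_weight.
  by rewrite -pmulrn.
rewrite NegzE intrN sqrrN -pmulrn lef_pV2 ?posrE ?ltr_wpDr ?sqr_ge0//.
by rewrite lerD2l lerXn2r ?nnegrE// ler_nat.
Qed.

Lemma sum_cell_weight2_le (u : seq (int * int)) : uniq u ->
  \sum_(j <- u) cell_weight j.1 * cell_weight j.2 <= 36.
Proof.
move=> uu; pose U1 := undup (map fst u); pose U2 := undup (map snd u).
have W0 (j : int * int) : 0 <= cell_weight j.1 * cell_weight j.2.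
  by rewrite mulr_ge0 ?cell_weight_ge0.
apply: le_trans (@ler_sum_uniq_sub _ (fun j => cell_weight j.1 * cell_weight j.2)
  u [seq (i, j) | i <- U1, j <- U2] uu _ W0) _.
  move=> [i j] ij; apply/allpairsP; exists (i, j); split => //=.
    by rewrite mem_undup; apply/mapP; exists (i, j).
  by rewrite mem_undup; apply/mapP; exists (i, j).
rewrite big_allpairs /= -big_distrlr /=.
have -> : 36 = 6 * 6 :> R by ring.
by apply: ler_pM; rewrite ?sumr_ge0 ?sum_cell_weight_le ?undup_uniq// => *;
  rewrite cell_weight_ge0.
Qed.

(* The weight is summable over the cells, uniformly in the sampling step h. *)
Lemma fejer_kernel_cell (L : nat) (h T xi : R) : (0 < L)%N -> 0 < h -> 1 <= T ->
  T = L%:R * h -> `|h * xi| <= pi ->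
  h * fejer_kernel L (h * xi) <=
    (6 * T + 72 * 4096) * cell_weight (Num.floor (64 * xi)).
Proof.
move=> L0 h0 T1 TE hxi; set k := fejer_kernel _ _.
have k0 : 0 <= k by apply: fejer_kernel_ge0.
have h1 : h * k <= 2 * T.
  by rewrite TE mulrA [2 * _ * h]mulrC ler_pM2l// fejer_kernel_le.
have h2 : h * k * xi ^+ 2 <= 36.
  have := fejer_kernel_decay L0 hxi; rewrite -/k.
  have -> : k * (L%:R * (h * xi) ^+ 2) = T * (h * k * xi ^+ 2) by rewrite TE; ring.
  move: (h * k * xi ^+ 2) => z; clear -T1 => z36.
  by have [z0|z0] := leP 0 z; nra.
set j := Num.floor _.
(* As j is within 1 of 64 xi, j^2 <= 2 (64 xi)^2 + 2. With the bounds 2 T and 36 this produces 6 T +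
   8192 * 36. *)
have j2 : 1 + j%:~R ^+ 2 <= 3 + 8192 * xi ^+ 2.
  have := real_floor_le (num_real (64 * xi)); have := real_floorD1_gt (num_real (64 * xi)).
  rewrite -/j intrD; move: (j%:~R : R) => x; clear => hx1 hx2.
  have p := sqr_ge0 (64 * xi + (64 * xi - x)).
  have q : (64 * xi - x) ^+ 2 <= 1 by nra.
  by move: p q; rewrite !expr2 => p q; lra.
rewrite /cell_weight ler_pdivlMr ?ltr_wpDr ?sqr_ge0//.
apply: le_trans (ler_wpM2l (mulr_ge0 (ltW h0) k0) j2) _.
by rewrite mulrDr; move: h1 h2; clear; move: (h * k) => z *; lra.
Qed.

End schur.

(** * Waves sampled on segments and squares *)

Section sampled_waves.
Context {R : realType}.
Implicit Types (s : seq Z3) (c : Z3 -> R[i]).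
Implicit Types (p v b t : R * R * R).

Definition wave c s (x : R * R * R) : R[i] :=
  \sum_(n <- s) c n * cis (dot3 (int3 n) x).

Definition lin3 p (x : R) t (y : R) t' : R * R * R :=
  (p.1.1 + x * t.1.1 + y * t'.1.1, p.1.2 + x * t.1.2 + y * t'.1.2,
   p.2 + x * t.2 + y * t'.2).

Lemma dot3_lin3 w p x t y t' :
  dot3 w (lin3 p x t y t') = dot3 w p + (x * dot3 w t + y * dot3 w t').
Proof. by rewrite /dot3 /lin3 /=; ring. Qed.

Lemma dot3C (x y : R * R * R) : dot3 x y = dot3 y x.
Proof. by rewrite /dot3; ring. Qed.

Lemma dot3_unit_le lam s v : 0 <= lam -> on_sphere lam s -> dot3 v v = 1 ->
  {in s, forall n, `|dot3 v (int3 n)| <= lam}.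
Proof.
move=> l0 ss v1 n ns; apply: norm_le_sqr => //.
by rewrite -(ss _ ns) -[leRHS]mul1r -v1 dot3_CS.
Qed.

(** No aliasing: the mesh is fine enough for all phase differences to stay in the period where the
    kernel decay holds. *)
Lemma phase_le_pi lam s v (h : R) : 0 <= lam -> 0 < h -> lam * h <= 1 ->
  on_sphere lam s -> dot3 v v = 1 ->
  {in s &, forall n m, `|h * (dot3 v (int3 n) - dot3 v (int3 m))| <= pi}.
Proof.
move=> l0 h0 lh ss v1 n m ns ms; rewrite normrM (gtr0_norm h0).
have := dot3_unit_le l0 ss v1 ns; have := dot3_unit_le l0 ss v1 ms.
move=> mm nn; apply: le_trans (ler_wpM2l (ltW h0) (ler_normB _ _)) _.
apply: le_trans (pi_ge2 R); clear -h0 lh mm nn; nra.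
Qed.

Lemma same_floor_narrow (x y z : R) :
  Num.floor (64 * (z - x)) = Num.floor (64 * (z - y)) -> `|x - y| <= 1 / 64.
Proof.
move=> e; have h1 := real_floor_le (num_real (64 * (z - x))).
have h2 := real_floorD1_gt (num_real (64 * (z - x))).
have h3 := real_floor_le (num_real (64 * (z - y))).
have h4 := real_floorD1_gt (num_real (64 * (z - y))).
rewrite -e in h3 h4; rewrite intrD in h2 h4.
move: (Num.floor _)%:~R h1 h2 h3 h4 => f; clear => *.
by rewrite ler_norml; apply/andP; split; lra.
Qed.

Definition sampling_const (T : R) : R := 6 * T + 72 * 4096.

(** For fixed n, the frequencies m in one cell lie in a slab orthogonal to v. Hence each row of the
    Schur kernel is at most the slab count times the total cell weight 6. *)
Lemma sampled_wave1 lam K mu v b s c p h T (L : nat) :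
  1 <= mu -> mu ^+ 6 = lam -> coplanar_bound lam K ->
  dot3 v v = 1 -> dot3 b b = 1 -> dot3 v b = 0 ->
  uniq s -> on_sphere lam s ->
  0 < h -> lam * h <= 1 -> (0 < L)%N -> 1 <= T -> T = L%:R * h ->
  h * \sum_(i < L) sqn (wave c s (lin3 p (i%:R * h) v 0 v)) <=
    (2 * sampling_const T * (17161 * mu ^+ 4 * K) * 6) * \sum_(n <- s) sqn (c n).
Proof.
move=> mu1 muE HK v1 b1 vb us ss h0 lh L0 T1 TE.
have K0 := coplanar_bound_ge0 HK.
have mu0 : 0 <= mu by apply: le_trans mu1.
have l0 : 0 <= lam by rewrite -muE exprn_ge0.
have A0 : 0 <= sampling_const T by rewrite /sampling_const; clear -T1; lra.
pose xi n := dot3 v (int3 n).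
pose z n := c n * cis (dot3 (int3 n) p).
have wE i : wave c s (lin3 p (i * h) v 0 v) =
    \sum_(n <- s) z n * cis (i * (h * xi n) + 0%:R * 0).
  apply: eq_bigr => n _; rewrite dot3_lin3 cisD mulrA; congr (_ * cis _).
  by rewrite !mul0r !addr0 -mulrA dot3C.
have zE n : normc (z n) = normc (c n).
  by rewrite Normc.normcM normc_cis mulr1.
(* The second direction is degenerate: one sample with phase 0, whose kernel is at most 2. *)
have := @sampled_exponential_sum_le R _ s z (fun n => h * xi n) (fun=> 0) L 1 L0 isT.
under eq_bigr do rewrite big_ord1 -wE.
move=> H; apply: (le_trans (ler_wpM2l (ltW h0) H)); clear H.
rewrite mulr_sumr.
under eq_bigr do rewrite mulr_sumr.
under eq_bigr do under eq_bigr do rewrite !zE mulrCA.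
under [X in _ <= _ * X]eq_bigr do rewrite -normc_sqr.
apply: (@schur_test _ _ s (fun n => normc (c n)) (fun n m =>
  h * (fejer_kernel L (h * xi n - h * xi m) * fejer_kernel 1 (0 - 0)))).
- by move=> n m; apply: (mulr_ge0 (ltW h0)); rewrite mulr_ge0 ?fejer_kernel_ge0.
- by move=> n m; congr (_ * (_ * _)); rewrite -fejer_kernelN opprB.
move=> n ns; pose f m := Num.floor (64 * (xi n - xi m)).
apply: le_trans (_ : _ <= 2 * sampling_const T * \sum_(m <- s) cell_weight (f m)) _.
  rewrite mulr_sumr big_seq [leRHS]big_seq; apply: ler_sum => m ms.
  rewrite -mulrBr mulrA -[leRHS]mulrA [leRHS]mulrC.
  apply: ler_pM; [exact: mulr_ge0 (ltW h0) (fejer_kernel_ge0 _ _)|exact: fejer_kernel_ge0| |].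
    by apply: (@fejer_kernel_cell R L h T (xi n - xi m)) => //;
      apply: (phase_le_pi l0 h0 lh ss v1).
  by apply: le_trans (fejer_kernel_le _ _) _; rewrite mulr1.
rewrite -[leRHS]mulrA; apply: ler_wpM2l; first exact: mulr_ge0.
apply: (@ler_sum_fibers R _ _ f cell_weight s (17161 * mu ^+ 4 * K) 6).
- exact: cell_weight_ge0.
- exact: mulr_ge0 (mulr_ge0 (ler0n R 17161) (exprn_ge0 4 mu0)) K0.
- move=> j; rewrite -size_filter; apply: (@slab_count R lam K mu v b) => //.
  + by rewrite filter_uniq.
  + exact: on_sphere_filter.
  + move=> x y; rewrite !mem_filter => /andP[/eqP fx xs] /andP[/eqP fy ys].
    by apply: (@same_floor_narrow _ _ (xi n)); rewrite -/(f x) -/(f y) fx fy.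
- by move=> u; apply: sum_cell_weight_le.
Qed.

(** Here a cell is a pair of intervals, its frequencies lie in a tube with axis orthogonal to t and
    t', and the weights sum to 36. *)
Lemma sampled_wave2 lam K mu t t' s c p h T (L : nat) :
  1 <= mu -> mu ^+ 6 = lam -> coplanar_bound lam K ->
  dot3 t t = 1 -> dot3 t' t' = 1 -> dot3 t t' = 0 ->
  uniq s -> on_sphere lam s ->
  0 < h -> lam * h <= 1 -> (0 < L)%N -> 1 <= T -> T = L%:R * h ->
  h ^+ 2 * \sum_(i < L) \sum_(j < L)
      sqn (wave c s (lin3 p (i%:R * h) t (j%:R * h) t')) <=
    (sampling_const T ^+ 2 * (8 * mu * K) * 36) * \sum_(n <- s) sqn (c n).
Proof.
move=> mu1 muE HK t1 t'1 tt' us ss h0 lh L0 T1 TE.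
have K0 := coplanar_bound_ge0 HK.
have mu0 : 0 <= mu by apply: le_trans mu1.
have l0 : 0 <= lam by rewrite -muE exprn_ge0.
have A0 : 0 <= sampling_const T by rewrite /sampling_const; clear -T1; lra.
pose xi n := dot3 t (int3 n); pose eta n := dot3 t' (int3 n).
pose z n := c n * cis (dot3 (int3 n) p).
have wE i j : wave c s (lin3 p (i * h) t (j * h) t') =
    \sum_(n <- s) z n * cis (i * (h * xi n) + j * (h * eta n)).
  apply: eq_bigr => n _; rewrite dot3_lin3 cisD mulrA; congr (_ * cis _).
  by rewrite -!mulrA ![dot3 (int3 n) _]dot3C.
have zE n : normc (z n) = normc (c n).
  by rewrite Normc.normcM normc_cis mulr1.
have := @sampled_exponential_sum_le R _ s z (fun n => h * xi n) (fun n => h * eta n)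
  L L L0 L0.
under eq_bigr do under eq_bigr do rewrite -wE.
have h20 : 0 < h ^+ 2 by rewrite exprn_gt0.
move=> H; apply: (le_trans (ler_wpM2l (ltW h20) H)); clear H.
rewrite mulr_sumr.
under eq_bigr do rewrite mulr_sumr.
under eq_bigr do under eq_bigr do rewrite !zE mulrCA.
under [X in _ <= _ * X]eq_bigr do rewrite -normc_sqr.
apply: (@schur_test _ _ s (fun n => normc (c n)) (fun n m =>
  h ^+ 2 * (fejer_kernel L (h * xi n - h * xi m) *
    fejer_kernel L (h * eta n - h * eta m)))).
- by move=> n m; apply: (mulr_ge0 (ltW h20)); rewrite mulr_ge0 ?fejer_kernel_ge0.
- by move=> n m; congr (_ * (_ * _)); rewrite -fejer_kernelN opprB.
move=> n ns.
pose f m := (Num.floor (64 * (xi n - xi m)), Num.floor (64 * (eta n - eta m))).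
pose w (j : int * int) : R := cell_weight j.1 * cell_weight j.2.
apply: le_trans (_ : _ <= sampling_const T ^+ 2 * \sum_(m <- s) w (f m)) _.
  rewrite mulr_sumr big_seq [leRHS]big_seq; apply: ler_sum => m ms.
  rewrite -!mulrBr !expr2 mulrACA [leRHS]mulrACA.
  have hk x : 0 <= h * fejer_kernel L x.
    exact: mulr_ge0 (ltW h0) (fejer_kernel_ge0 _ _).
  by apply: ler_pM => //; apply: fejer_kernel_cell => //;
    [apply: (phase_le_pi l0 h0 lh ss t1)|apply: (phase_le_pi l0 h0 lh ss t'1)].
rewrite -[leRHS]mulrA; apply: ler_wpM2l; first exact: exprn_ge0.
apply: (@ler_sum_fibers R _ _ f w s (8 * mu * K) 36).
- by move=> j; rewrite mulr_ge0 ?cell_weight_ge0.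
- exact: mulr_ge0 (mulr_ge0 (ler0n R 8) mu0) K0.
- move=> j; rewrite -size_filter; apply: (@tube_count R lam K mu t t') => //.
  + by rewrite filter_uniq.
  + exact: on_sphere_filter.
  + move=> x y; rewrite !mem_filter => /andP[/eqP fx xs] /andP[/eqP fy ys].
    apply: (@same_floor_narrow _ _ (xi n)).
    by have [] : f x = f y by rewrite fx fy.
  + move=> x y; rewrite !mem_filter => /andP[/eqP fx xs] /andP[/eqP fy ys].
    apply: (@same_floor_narrow _ _ (eta n)).
    by have [] : f x = f y by rewrite fx fy.
- by move=> u; apply: sum_cell_weight2_le.
Qed.

End sampled_waves.

(** * Integration against Hausdorff measure *)

Section caratheodory_integral_bound.
Context {R : realType} {T : pointedType}.
Variable mu : {outer_measure set T -> \bar R}.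
Local Open Scope ereal_scope.

(** Caratheodory splitting by one [A i] at a time. It holds for an arbitrary [X], which later is a
    cell. *)
Lemma sum_outer_measureI_le (I : eqType) (A : I -> set T) (s : seq I) (X : set T) :
  (forall i, mu.-caratheodory (A i)) -> uniq s ->
  (forall i j, i != j -> A i `&` A j = set0) ->
  \sum_(i <- s) mu (X `&` A i) <= mu X.
Proof.
move=> mA + dA; elim: s X => [|i s IH] X /=.
  by move=> _; rewrite big_nil outer_measure_ge0.
move=> /andP[si us]; rewrite big_cons (mA i X) leeD2l//.
apply: le_trans (IH (X `&` ~` A i) us).
rewrite big_seq [leRHS]big_seq; apply: lee_sum => j js.
apply: le_outer_measure => x [Xx Ajx]; split => //; split => // Aix.
suff : (A i `&` A j) x by rewrite dA//; apply: contraNneq si => ->.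
by [].
Qed.

Import HBNNSimple.

(* Neither [f] nor the cells are assumed measurable: the integral is by definition a supremum
   over simple functions below [f]. *)
Lemma caratheodory_integral_le (n : nat) (Q : 'I_n -> set T) (M : 'I_n -> R)
    (f : T -> \bar R) :
  (forall x, 0 <= f x) -> (forall i, (0 <= M i)%R) ->
  (forall i x, Q i x -> f x <= (M i)%:E) ->
  (forall x, (forall i, ~ Q i x) -> f x = 0) ->
  \int[(mu : {measure set (caratheodory_type mu) -> \bar R})]_x f x
    <= \sum_(i < n) (M i)%:E * mu (Q i).
Proof.
move=> f0 M0 fM fout; rewrite ge0_integralTE//.
apply: ge_ereal_sup => _ [h /= hf <-]; rewrite sintegralE fsbig_finite//=.
set s := finmap.enum_fset _.
pose A (r : R) := h @^-1` [set r].
have mA r : mu.-caratheodory (A r) by exact: (measurable_sfunP h).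
apply: (@le_trans _ _ (\sum_(r <- s) \sum_(i < n) (M i)%:E * mu (Q i `&` A r))).
  rewrite big_seq [leRHS]big_seq; apply: lee_sum => r rs.
  have r0 : (0 <= r)%R.
    by move: rs; rewrite in_fset_set// inE => -[x _ <-].
  (* The level set of the value 0 contributes nothing and may leave the cells; those of positive
     values are covered by them. *)
  move: r0; rewrite le_eqVlt => /predU1P[<-|r0].
    by rewrite mul0e sume_ge0// => i _; rewrite mule_ge0 ?outer_measure_ge0 ?lee_fin.
  apply: (@le_trans _ _ (r%:E * \sum_(i < n) mu (Q i `&` A r))).
    apply: lee_wpmul2l; first by rewrite lee_fin ltW.
    pose F k := if insub k is Some i then Q i `&` A r else set0.
    have FE (i : 'I_n) : F i = Q i `&` A r by rewrite /F valK.
    under eq_bigr do rewrite -FE.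
    apply: le_trans (outer_measure_subadditive mu F n).
    apply: le_outer_measure => x Ax; rewrite -bigcup_mkord.
    have [[i Qi]|nQ] := pselect (exists i, Q i x).
      by exists (val i) => //=; rewrite FE; split.
    have := hf x; rewrite fout; last by move=> i Qi; apply: nQ; exists i.
    by rewrite Ax lee_fin leNgt r0.
  rewrite ge0_sume_distrr; last by move=> i _; apply: outer_measure_ge0.
  apply: lee_sum => i _.
  have [->|/set0P[x [Qx Ax]]] := eqVneq (Q i `&` A r) set0.
    by rewrite outer_measure0 !mule0.
  apply: lee_wpmul2r; first exact: outer_measure_ge0.
  by apply: le_trans (fM i x Qx); rewrite -Ax.
rewrite exchange_big /=; apply: lee_sum => i _.
rewrite -ge0_sume_distrr; last by move=> r _; apply: outer_measure_ge0.
apply: lee_wpmul2l; first by rewrite lee_fin.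
apply: sum_outer_measureI_le => //; first exact: finmap.fset_uniq.
move=> r r' rr'; apply/seteqP; split => // x [Ar Ar'].
by move: rr'; rewrite -Ar -Ar' eqxx.
Qed.

End caratheodory_integral_bound.

Section hausdorff_cells.
Context {R : realType}.
Implicit Types (p t : R * R * R).

(** A finite cover becomes a sequence by adding empty sets, to which [diam_cost] assigns 0. *)
Lemma hausdorff_le_finite (n k : nat) (A : set 'rV[R]_n) (B : R) :
  (forall delta : R, 0 < delta -> exists (m : nat) (F : nat -> set 'rV[R]_n),
    [/\ A `<=` \bigcup_(i < m) F i, forall i, (diam (F i) <= delta%:E)%E &
        (\sum_(i < m) diam_cost k (F i) <= B%:E)%E]) ->
  (hausdorff k A <= B%:E)%E.
Proof.
move=> H; apply: ge_ereal_sup => _ [delta d0 <-].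
have [m [F [AF dF cF]]] := H delta d0.
pose G i := if (i < m)%N then F i else set0.
apply: le_trans cF; apply: ereal_inf_lbound => /=.
have d0' : (diam (set0 : set 'rV[R]_n) <= delta%:E)%E.
  by apply: ge_ereal_sup => x [p [[]]].
exists G; first split.
- by move=> i; rewrite /G; case: ifP.
- by move=> x /AF[i /= im Fx]; exists i => //; rewrite /G im.
rewrite (nneseries_split _ m)//; last by move=> i _; apply: diam_cost_ge0.
rewrite add0n eseries0 ?adde0; last first.
  by move=> i mi _; rewrite /G ltnNge mi /diam_cost eqxx.
by rewrite big_mkord; apply: eq_bigr => i _; rewrite /G ltn_ord.
Qed.

Lemma diam_cost_le (n k : nat) (A : set 'rV[R]_n) (d : R) : 0 <= d ->
  (diam A <= d%:E)%E ->
  (diam_cost k A <= (unit_ball_volume R k / 2 ^+ k * d ^+ k)%:E)%E.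
Proof.
move=> d0 Ad; rewrite /diam_cost; case: ifPn => [_|/set0P[x Ax]].
  by rewrite lee_fin mulr_ge0 ?exprn_ge0// divr_ge0 ?exprn_ge0 ?unit_ball_volume_ge0.
have A0 : (0 <= diam A)%E.
  apply: le_ereal_sup_tmp; exists (enorm (x - x))%:E; first by exists (x, x).
  by rewrite lee_fin sqrtr_ge0.
rewrite [leRHS]EFinM; apply: lee_wpmul2l.
  by rewrite lee_fin divr_ge0 ?exprn_ge0 ?unit_ball_volume_ge0.
move: A0 Ad; case: (diam A) => [r| |]//; rewrite !lee_fin => r0 rd.
by rewrite -EFin_expe lee_fin lerXn2r ?nnegrE.
Qed.

Definition tr3 (x : 'rV[R]_3) : R * R * R := (x 0 0, x 0 1, x 0 2%:R).

Lemma sum_ord3 (f : 'I_3 -> R) : \sum_i f i = f 0 + f 1 + f 2%:R.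
Proof.
rewrite !big_ord_recl big_ord0 addr0 addrA.
by congr (f _ + f _ + f _); apply/val_inj.
Qed.

Lemma ord3P (i : 'I_3) : [\/ i = 0, i = 1 | i = 2%:R].
Proof.
case: i => [[|[|[|]]] // i3]; [constructor 1|constructor 2|constructor 3];
  exact/val_inj.
Qed.

Lemma vec3E (x : R * R * R) : [/\ vec3 x 0 0 = x.1.1, vec3 x 0 1 = x.1.2
  & vec3 x 0 2%:R = x.2].
Proof. by split; rewrite /vec3 mxE. Qed.

Lemma tr3K : cancel tr3 (@vec3 R).
Proof.
move=> x; apply/rowP => i; have [e1 e2 e3] := vec3E (tr3 x).
by have [->|->|->] := ord3P i.
Qed.

Lemma vec3K : cancel (@vec3 R) tr3.
Proof. by move=> [[a b] c]; rewrite /tr3 !mxE. Qed.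

Lemma vec3B (x y : R * R * R) : vec3 (x - y) = vec3 x - vec3 y.
Proof.
have [a1 a2 a3] := vec3E (x - y); have [b1 b2 b3] := vec3E x.
have [c1 c2 c3] := vec3E y; apply/rowP => i; rewrite [RHS]mxE [(- vec3 y) _ _]mxE.
by have [->|->|->] := ord3P i; rewrite ?(a1, a2, a3, b1, b2, b3, c1, c2, c3).
Qed.

Lemma enorm_vec3 (x : R * R * R) : enorm (vec3 x) = Num.sqrt (dot3 x x).
Proof.
have [a1 a2 a3] := vec3E x.
by rewrite /enorm sum_ord3 a1 a2 a3 !expr2.
Qed.

(** A closed parallelogram; neighbours share sides, which is harmless for upper bounds. A segment is
    the case t' = t, h' = 0. *)
Definition plane_cell p t t' (x y h h' : R) : set 'rV[R]_3 :=
  [set vec3 (lin3 p (x + u) t (y + u') t') | u in `[0, h] & u' in `[0, h']].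

Lemma diam_plane_cell p t t' x y h h' : 0 <= h -> 0 <= h' ->
  dot3 t t = 1 -> dot3 t' t' = 1 ->
  (diam (plane_cell p t t' x y h h') <= (h + h')%:E)%E.
Proof.
move=> h0 h0' t1 t1'; apply: ge_ereal_sup => _ [[a b] [+ +] <-] /=.
move=> [u /=]; rewrite in_itv /= => /andP[u0 uh] [u' /=].
rewrite in_itv /= => /andP[u0' uh'] <-.
move=> [v /=]; rewrite in_itv /= => /andP[v0 vh] [v' /=].
rewrite in_itv /= => /andP[v0' vh'] <-.
rewrite -vec3B enorm_vec3 lee_fin -[leRHS]ger0_norm ?addr_ge0// -sqrtr_sqr.
apply: ler_wsqrtr.
have -> : dot3 (lin3 p (x + u) t (y + u') t' - lin3 p (x + v) t (y + v') t')
   (lin3 p (x + u) t (y + u') t' - lin3 p (x + v) t (y + v') t') =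
   (u - v) ^+ 2 * dot3 t t + (u' - v') ^+ 2 * dot3 t' t' +
   2 * ((u - v) * (u' - v')) * dot3 t t'.
  by rewrite /lin3 /dot3 /=; ring.
have c1 : `|dot3 t t'| <= 1.
  by apply: norm_le_sqr => //; rewrite (le_trans (dot3_CS _ _))// t1 t1' mulr1 expr1n.
rewrite t1 t1' !mulr1.
have a1 : `|u - v| <= h by rewrite ler_norml; apply/andP; split; clear -u0 uh v0 vh; lra.
have a2 : `|u' - v'| <= h' by rewrite ler_norml; apply/andP; split; clear -u0' uh' v0' vh'; lra.
have b1 : (u - v) ^+ 2 <= h ^+ 2.
  by rewrite -(real_normK (num_real (u - v))) lerXn2r ?nnegrE.
have b2 : (u' - v') ^+ 2 <= h' ^+ 2.
  by rewrite -(real_normK (num_real (u' - v'))) lerXn2r ?nnegrE.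
have b3 : (u - v) * (u' - v') * dot3 t t' <= h * h'.
  apply: le_trans (ler_norm _) _; rewrite !normrM -[leRHS]mulr1.
  by apply: ler_pM => //; rewrite ?mulr_ge0//; apply: ler_pM.
by rewrite sqrrD; move: b1 b2 b3; rewrite -mulr_natr; clear => *; lra.
Qed.

Lemma split_interval (h u : R) (N : nat) : (0 < N)%N -> 0 < h -> 0 <= u <= h ->
  exists2 i : nat, (i < N)%N & exists2 w, 0 <= w <= h / N%:R & u = i%:R * (h / N%:R) + w.
Proof.
move=> N0 h0 /andP[u0 uh]; have N0' : 0 < N%:R :> R by rewrite ltr0n.
have d0 : 0 < h / N%:R by rewrite divr_gt0.
have [uE|un] := eqVneq u h.
  exists N.-1; first by rewrite prednK.
  exists (h / N%:R); first by rewrite lexx ltW.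
  by rewrite uE -[X in _ + X]mul1r -mulrDl natr1 prednK// mulrCA divff ?mulr1// gt_eqF.
pose i := Num.truncn (u / (h / N%:R)).
have q0 : 0 <= u / (h / N%:R) by rewrite divr_ge0// ltW.
have i1 : i%:R <= u / (h / N%:R) by rewrite truncn_le.
have i2 : u / (h / N%:R) < i.+1%:R by rewrite truncnS_gt.
rewrite ler_pdivlMr// in i1; rewrite ltr_pdivrMr// in i2.
exists i.
  rewrite -(ltr_nat R) -(ltr_pM2r d0); apply: le_lt_trans i1 _.
  by rewrite [ltRHS]mulrCA divff ?gt_eqF// mulr1 lt_neqAle un.
exists (u - i%:R * (h / N%:R)); last by rewrite addrC subrK.
by rewrite subr_ge0 i1 /=; move: i2; rewrite -natr1 mulrDl mul1r; clear => *; lra.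
Qed.

Lemma hausdorff_plane_cell1 p t x h : 0 < h -> dot3 t t = 1 ->
  (hausdorff 1 (plane_cell p t t x 0 h 0) <= h%:E)%E.
Proof.
move=> h0 t1; apply: hausdorff_le_finite => delta d0.
pose N := (Num.truncn (h / delta)).+1.
have N0 : (0 < N)%N by [].
have N0' : 0 < N%:R :> R by rewrite ltr0n.
have hN : h / N%:R <= delta.
  rewrite ler_pdivrMr// mulrC -ler_pdivrMr// ltW//; exact: truncnS_gt.
have hN0 : 0 <= h / N%:R by rewrite divr_ge0 ?ltW.
exists N, (fun i => plane_cell p t t (x + i%:R * (h / N%:R)) 0 (h / N%:R) 0).
have dF i : (diam (plane_cell p t t (x + i%:R * (h / N%:R)) 0 (h / N%:R) 0) <=
    (h / N%:R)%:E)%E.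
  by rewrite -[X in (_ <= X%:E)%E]addr0; apply: diam_plane_cell.
split.
- move=> _ [u + [u' + <-]]; rewrite /= !in_itv /= => uh u'0.
  have [i iN [w wh ->]] := split_interval N0 h0 uh.
  exists i => //=; exists w; first by rewrite /= in_itv.
  by exists u'; [rewrite /= in_itv|rewrite addrA].
- by move=> i; apply: le_trans (dF i) _; rewrite lee_fin.
apply: (@le_trans _ _ (\sum_(i < N) (h / N%:R)%:E)%E).
  apply: lee_sum => i _; apply: le_trans (diam_cost_le _ hN0 (dF i)) _.
  by rewrite lee_fin /= !expr1 divff// mul1r.
by rewrite sumEFin lee_fin sumr_const card_ord -[leLHS]mulr_natr divfK// gt_eqF.
Qed.

(** The N^2 subcells have diameter at most 2 h / N, hence cost at most pi / 4 (2 h / N)^2 each. The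
    resulting factor pi is absorbed in the final constant. *)
Lemma hausdorff_plane_cell2 p t t' x y h : 0 < h -> dot3 t t = 1 -> dot3 t' t' = 1 ->
  (hausdorff 2 (plane_cell p t t' x y h h) <= (pi * h ^+ 2)%:E)%E.
Proof.
move=> h0 t1 t1'; apply: hausdorff_le_finite => delta d0.
pose N := (Num.truncn (2 * h / delta)).+1.
have N0 : (0 < N)%N by [].
have N0' : 0 < N%:R :> R by rewrite ltr0n.
have hN : 2 * (h / N%:R) <= delta.
  rewrite mulrA ler_pdivrMr// [delta * _]mulrC -ler_pdivrMr// ltW//; exact: truncnS_gt.
have hN0 : 0 <= h / N%:R by rewrite divr_ge0 ?ltW.
pose F (i j : nat) := plane_cell p t t' (x + i%:R * (h / N%:R)) (y + j%:R * (h / N%:R))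
  (h / N%:R) (h / N%:R).
exists (N * N)%N, (fun k => F (k %/ N)%N (k %% N)%N).
have dF i j : (diam (F i j) <= (2 * (h / N%:R))%:E)%E.
  by rewrite mulr_natl mulr2n; apply: diam_plane_cell.
split.
- move=> _ [u + [u' + <-]]; rewrite /= !in_itv /= => uh uh'.
  have [i iN [w wh ->]] := split_interval N0 h0 uh.
  have [j jN [w' wh' ->]] := split_interval N0 h0 uh'.
  exists (i * N + j)%N => /=.
    by clear -iN jN; nia.
  rewrite divnMDl// divn_small// addn0 modnMDl modn_small//.
  exists w; first by rewrite /= in_itv.
  by exists w'; [rewrite /= in_itv|rewrite !addrA].
- by move=> i; apply: le_trans (dF _ _) _; rewrite lee_fin.
apply: (@le_trans _ _ (\sum_(i < N * N) (pi * (h / N%:R) ^+ 2)%:E)%E).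
  apply: lee_sum => i _; apply: le_trans (diam_cost_le _ _ (dF _ _)) _.
    by rewrite mulr_ge0.
  rewrite lee_fin /= mulr1 le_eqVlt; apply/orP; left; apply/eqP; field.
  by rewrite gt_eqF.
rewrite sumEFin lee_fin sumr_const card_ord -[leLHS]mulr_natr natrM.
by rewrite le_eqVlt; apply/orP; left; apply/eqP; field; rewrite gt_eqF.
Qed.

End hausdorff_cells.

Section coplanar_bound_eps.
Context {R : realType}.

Lemma dot3_int3 (x y : Z3) :
  dot3 (int3 x) (int3 y) = (dot3 x y)%:~R :> R.
Proof. by rewrite /dot3 /= !(intrD, intrM). Qed.

(** With N = lam^2 the count raised to the power k is at most C lam^8, and k is taken larger than 8
    / eps. *)
Lemma coplanar_bound_eps (eps : R) : 0 < eps ->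
  exists2 C : R, 0 < C & forall lam, 1 <= lam -> coplanar_bound lam (C * lam `^ eps).
Proof.
move=> e0; pose k := (Num.truncn (8 / eps)).+1.
have k0 : 0 < k%:R :> R by rewrite ltr0n.
have ke : 8 / k%:R <= eps.
  rewrite ler_pdivrMr// [eps * _]mulrC -ler_pdivrMr// ltW//; exact: truncnS_gt.
have [C C0 HC] := size_coplanar_sphere k.
have C0' : 0 < C%:R :> R by rewrite ltr0n.
exists (C%:R `^ k%:R^-1); first exact: powR_gt0.
move=> lam l1 t ut ts tc; have l0 : 0 < lam by apply: lt_le_trans l1.
case: t ut ts tc => [_ _ _|x0 t0]; first by rewrite mulr_ge0 ?powR_ge0.
set t := x0 :: t0 => ut ts tc; have x0t : x0 \in t by rewrite mem_head.
pose N : int := dot3 x0 x0.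
have NE : N%:~R = lam ^+ 2 :> R by rewrite -dot3_int3 ts.
have N0 : 0 < N by rewrite -(ltr_int R) NE exprn_gt0.
have tN : {in t, forall x : Z3, dot3 x x = N}.
  by move=> x xt; apply: (@intr_inj R); rewrite NE -dot3_int3 ts.
have := HC N t N0 ut tN tc; rewrite -(ler_nat R) natrX natrM natrX => h.
have {}h : (size t)%:R ^+ k <= C%:R * lam ^+ 8.
  apply: le_trans h _; rewrite ler_wpM2l//.
  have -> : (`|N|%N%:R = lam ^+ 2 :> R)%R.
    by rewrite -NE -[in RHS](gtz0_abs N0) -pmulrn.
  by rewrite -exprM.
have kk : (size t)%:R = ((size t)%:R ^+ k) `^ k%:R^-1 :> R.
  by rewrite -powR_mulrn// -powRrM divff ?powRr1// gt_eqF.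
have l8 : 0 <= lam ^+ 8 by rewrite exprn_ge0// ltW.
rewrite kk; apply: le_trans (_ : _ <= (C%:R * lam ^+ 8) `^ k%:R^-1) _.
  apply: ge0_ler_powR h; rewrite ?nnegrE; [|exact: exprn_ge0|exact: mulr_ge0].
  by rewrite invr_ge0.
rewrite powRM// ler_wpM2l ?powR_ge0//.
by rewrite -powR_mulrn ?(ltW l0)// -powRrM ler_powR.
Qed.

End coplanar_bound_eps.

(** * Fourier analysis on the grid *)

Section finite_fourier.
Context {R : realType} {T : finType}.
Variables (chi : T -> T -> R[i]) (N : R).
Hypothesis N0 : 0 < N.
Hypothesis chi_ortho : forall j j',
  \sum_k chi k j * conjc (chi k j') = (N * (j == j')%:R)%:C.

Definition fourier (g : T -> R[i]) k : R[i] :=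
  (N^-1)%:C * \sum_j g j * conjc (chi k j).

Lemma fourier_inversion g j : g j = \sum_k fourier g k * chi k j.
Proof.
transitivity ((N^-1)%:C * \sum_j' g j' * \sum_k chi k j * conjc (chi k j')); last first.
  rewrite /fourier; under [RHS]eq_bigr do rewrite -mulrA mulr_suml.
  rewrite -mulr_sumr exchange_big /=; congr (_ * _); apply: eq_bigr => i _.
  by rewrite mulr_sumr; apply: eq_bigr => k _; rewrite -mulrA [conjc _ * _]mulrC.
under eq_bigr do rewrite chi_ortho.
rewrite (bigD1 j)//= eqxx mulr1 big1 ?addr0; last first.
  by move=> i ij; rewrite eq_sym (negPf ij) mulr0 mulr0.
by rewrite mulrCA -rmorphM /= mulVf ?gt_eqF// rmorph1 mulr1.
Qed.

Lemma fourier_parseval g : \sum_k sqn (fourier g k) = N^-1 * \sum_j sqn (g j).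
Proof.
have sqnC (a : R) : sqn a%:C = a ^+ 2 by rewrite /sqn /= expr0n addr0.
under eq_bigr do rewrite sqnM sqnC sqn_sum.
rewrite -mulr_sumr exchange_big /=.
have -> : \sum_j \sum_k \sum_j' complex.Re (g j * conjc (chi k j) *
     conjc (g j' * conjc (chi k j'))) = \sum_j N * sqn (g j).
  apply: eq_bigr => j _; rewrite exchange_big /=.
  transitivity (\sum_(i | i == j) N * sqn (g j)); last by rewrite big_pred1_eq.
  rewrite [RHS]big_mkcond /=; apply: eq_bigr => i _; rewrite -Re_sum.
  transitivity (complex.Re (g j * conjc (g i) * \sum_k chi k i * conjc (chi k j))).
    congr complex.Re; rewrite mulr_sumr; apply: eq_bigr => k _.
    by rewrite conjcM conjcK mulrACA [chi _ _ * conjc _]mulrC.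
  rewrite chi_ortho; case: eqP => [->|_]; last by rewrite mulr0 mulr0.
  rewrite mulr1 sqnE; move: (g j * _) => [a b] /=.
  by rewrite mulr0 subr0 mulrC.
by rewrite -mulr_sumr mulrA expr2 mulfVK ?gt_eqF.
Qed.

End finite_fourier.

Section torus_grid.
Context {R : realType}.

Lemma sum_shift (J : nat) (F : R -> R[i]) : (forall x, F (x + J%:R) = F x) ->
  \sum_(j < J) F (j%:R + 1) = \sum_(j < J) F j%:R.
Proof.
case: J => [|J] FJ; first by rewrite !big_ord0.
rewrite big_ord_recr big_ord_recl /= addrC natr1 -[J.+1%:R]add0r FJ; congr (_ + _).
by apply: eq_bigr => i _; rewrite natr1.
Qed.

Lemma sum_shiftN (J : nat) (F : R -> R[i]) : (forall x, F (x + J%:R) = F x) ->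
  \sum_(j < J) F (j%:R - 1) = \sum_(j < J) F j%:R.
Proof.
move=> FJ; rewrite -(@sum_shift J (fun x => F (x - 1))).
  by apply: eq_bigr => i _; rewrite addrK.
by move=> x; rewrite addrAC FJ.
Qed.

Lemma cis_neq1 (x : R) : 0 < `|x| < 2 * pi -> cis x != 1.
Proof.
move=> /andP[x0 xpi]; apply/eqP => c1.
have P (y : R) : 0 < `|y| <= pi -> cis y != 1.
  move=> /andP[y0 ypi]; apply/eqP => c.
  have := two_sub_cos_ge ypi; rewrite -sqn_one_sub_cis c subrr /sqn /= expr0n addr0.
  by rewrite leNgt divr_gt0// -real_normK ?num_real// exprn_gt0.
have [xp|xp] := leP `|x| pi.
  by have := P x; rewrite x0 xp c1 eqxx => /(_ isT).
have [s0|s0] := leP 0 x.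
  have := P (x - 2 * pi); rewrite cisD -conj_cis cis2pi conjc1 mulr1 c1 eqxx.
  rewrite ger0_norm// in xp xpi; rewrite ltr0_norm; last by clear -xpi; lra.
  by move=> h; suff : false by []; apply: h; clear -xp xpi; apply/andP; split; lra.
have := P (x + 2 * pi); rewrite cisD cis2pi mulr1 c1 eqxx.
rewrite ltr0_norm// in xp xpi; rewrite gtr0_norm; last by clear -xpi; lra.
by move=> h; suff : false by []; apply: h; clear -xp xpi; apply/andP; split; lra.
Qed.

(** An odd number of nodes makes the frequencies symmetric, from -K to K, so that |step * n| <= pi
    for each of them and the cosine bounds apply. *)
Definition gridn (K : nat) : nat := (2 * K).+1.

Definition step (K : nat) : R := 2 * pi / (gridn K)%:R.

Variable K : nat.
Local Notation J := (gridn K).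
Local Notation h := (step K).

Lemma stepJ : J%:R * h = 2 * pi.
Proof. by rewrite /step mulrCA divff ?mulr1// pnatr_eq0. Qed.

Lemma step_gt0 : 0 < h.
Proof. by rewrite divr_gt0 ?mulr_gt0 ?pi_gt0. Qed.

Definition freq1 (k : 'I_J) : int := k%:Z - K%:Z.

(** Up to a phase this is a Dirichlet sum over a full period at h (a - b), whose geometric sum
    vanishes unless a = b. *)
Lemma ortho1 (a b : 'I_J) :
  \sum_(k < J) cis (h * ((freq1 k)%:~R * a%:R)) * cis (- (h * ((freq1 k)%:~R * b%:R)))
  = (J%:R * (a == b)%:R)%:C.
Proof.
pose d : R := a%:R - b%:R.
have -> : \sum_(k < J) cis (h * ((freq1 k)%:~R * a%:R)) *
    cis (- (h * ((freq1 k)%:~R * b%:R))) = cis (- (K%:R * (h * d))) * dirichlet J (h * d).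
  rewrite mulr_sumr; apply: eq_bigr => k _; rewrite -!cisD; congr cis.
  by rewrite /freq1 intrB -!pmulrn /d; ring.
have [ab|ab] := eqVneq a b.
  rewrite /d ab subrr !mulr0 oppr0 cis0 mul1r mulr1 /dirichlet.
  under eq_bigr do rewrite mulr0 cis0.
  by rewrite sumr_const card_ord rmorph_nat.
rewrite mulr0 rmorph0; apply/eqP; rewrite mulf_eq0; apply/orP; right.
have c1 : cis (h * d) != 1.
  have dn0 : 0 < `|d| by rewrite normr_gt0 subr_eq0 eqr_nat.
  have dJ : `|d| < J%:R.
    have := ltn_ord a; have := ltn_ord b; rewrite -!(ltr_nat R) => hb ha.
    have := ler0n R a; have := ler0n R b; rewrite ltr_norml /d; clear -ha hb => *.
    by apply/andP; split; lra.
  apply: cis_neq1; rewrite normrM (gtr0_norm step_gt0) mulr_gt0 ?step_gt0//=.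
  by rewrite -stepJ [ltRHS]mulrC ltr_pM2l// step_gt0.
have := dirichlet_geometric J (h * d); rewrite mulrA stepJ.
have -> : cis (2 * pi * d) = 1.
  rewrite /d mulrC; have := @cis2pi_int R (a%:Z - b%:Z).
  by rewrite intrB -!pmulrn.
rewrite subrr => /eqP; rewrite mulf_eq0 subr_eq0 eq_sym (negPf c1) /=.
by [].
Qed.

Definition grid : finType := ('I_J * 'I_J * 'I_J)%type.

Definition gpt (j : grid) : R * R * R := (h * j.1.1%:R, h * j.1.2%:R, h * j.2%:R).

Definition freq (k : grid) : Z3 := (freq1 k.1.1, freq1 k.1.2, freq1 k.2).

Definition character (k j : grid) : R[i] := cis (dot3 (int3 (freq k)) (gpt j)).

Lemma characterE (k j : grid) : character k j =
  cis (h * ((freq1 k.1.1)%:~R * j.1.1%:R)) * cis (h * ((freq1 k.1.2)%:~R * j.1.2%:R)) *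
  cis (h * ((freq1 k.2)%:~R * j.2%:R)).
Proof. by rewrite -!cisD /character /dot3 /=; congr cis; ring. Qed.

Lemma character_ortho (j j' : grid) :
  \sum_k character k j * conjc (character k j') = (J%:R ^+ 3 * (j == j')%:R)%:C.
Proof.
pose G (a b k : 'I_J) := cis (h * ((freq1 k)%:~R * a%:R)) *
  cis (- (h * ((freq1 k)%:~R * b%:R))).
transitivity (\sum_(k : grid) G j.1.1 j'.1.1 k.1.1 * G j.1.2 j'.1.2 k.1.2 *
    G j.2 j'.2 k.2).
  apply: eq_bigr => k _; rewrite !characterE !conjcM !conj_cis /G.
  by rewrite mulrACA; congr (_ * _); rewrite mulrACA.
rewrite (@sum_pairM _ _ _ (fun k => G j.1.1 j'.1.1 k.1 * G j.1.2 j'.1.2 k.2)).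
rewrite sum_pairM /G !ortho1 -!rmorphM /=; congr (_ %:C).
case: j => [[a b] c]; case: j' => [[a' b'] c'] /=; rewrite !xpair_eqE.
by case: eqP; case: eqP; case: eqP => _ _ _ /=; ring.
Qed.

Lemma freq_inj : injective freq.
Proof.
move=> [[a b] c] [[a' b'] c'] [] /addIr[/val_inj ->] /addIr[/val_inj ->].
by move=> /addIr[/val_inj ->].
Qed.

Lemma freq1_le (k : 'I_J) : `|(freq1 k)%:~R : R| <= K%:R.
Proof.
have := ltn_ord k; rewrite ltnS -(ler_nat R) natrM => hk.
rewrite /freq1 intrB -!pmulrn ler_norml; have := ler0n R k; clear -hk => *.
by apply/andP; split; lra.
Qed.

Lemma freq1_pi (k : 'I_J) : `|h * (freq1 k)%:~R| <= pi.
Proof.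
rewrite normrM (gtr0_norm step_gt0).
apply: le_trans (ler_wpM2l (ltW step_gt0) (freq1_le k)) _.
have := stepJ; rewrite /gridn -natr1 natrM => e; have := step_gt0.
by move: e; clear; move: (K%:R) (h) => x y e ?; lra.
Qed.

End torus_grid.

(** * The discrete Laplacian on the Fourier side *)

Section discrete_laplacian.
Context {R : realType}.

Lemma fourierD (T : finType) (chi : T -> T -> R[i]) N (f g : T -> R[i]) k :
  fourier chi N (fun j => f j + g j) k = fourier chi N f k + fourier chi N g k.
Proof.
rewrite /fourier -mulrDr -big_split /=; congr (_ * _); apply: eq_bigr => j _.
by rewrite mulrDl.
Qed.

Lemma fourierZ (T : finType) (chi : T -> T -> R[i]) N (a : R[i]) (g : T -> R[i]) k :
  fourier chi N (fun j => a * g j) k = a * fourier chi N g k.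
Proof.
rewrite /fourier mulrCA; congr (_ * _); rewrite mulr_sumr; apply: eq_bigr => j _.
by rewrite mulrA.
Qed.

Lemma sum_unit_shift (J : nat) (F : R -> R[i]) (s : R) :
  s \in [:: 0; 1; -1] -> (forall x, F (x + J%:R) = F x) ->
  \sum_(j < J) F (j%:R + s) = \sum_(j < J) F j%:R.
Proof.
rewrite !inE => /or3P[] /eqP -> FJ; last exact: sum_shiftN.
  by under eq_bigr do rewrite addr0.
exact: sum_shift.
Qed.

Variable K : nat.
Local Notation J := (gridn K).
Local Notation h := (@step R K).
Variable g : R * R * R -> R[i].
Hypothesis g1 : forall x y z, g (x + 2 * pi, y, z) = g (x, y, z).
Hypothesis g2 : forall x y z, g (x, y + 2 * pi, z) = g (x, y, z).
Hypothesis g3 : forall x y z, g (x, y, z + 2 * pi) = g (x, y, z).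

Definition shifted (a b c : R) (x : R * R * R) : R * R * R :=
  (x.1.1 + a, x.1.2 + b, x.2 + c).

Local Notation ft := (fourier (@character R K) (J%:R ^+ 3)).

Lemma fourier_shift (a b c : R) (k : grid K) :
  a \in [:: 0; 1; -1] -> b \in [:: 0; 1; -1] -> c \in [:: 0; 1; -1] ->
  ft (fun j => g (shifted (h * a) (h * b) (h * c) (gpt j))) k =
  cis (h * dot3 (int3 (freq k)) (a, b, c)) * ft (fun j => g (gpt j)) k.
Proof.
move=> a1 b1 c1; pose n : R * R * R := int3 (freq k).
pose F (x y z : R) := g (h * x, h * y, h * z) * cis (- (h * dot3 n (x, y, z))).
have cisJ (m : int) (x y z w : R) : w = h * m%:~R * J%:R -> 
    cis (- (h * dot3 n (x, y, z) + w)) = cis (- (h * dot3 n (x, y, z))).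
  move=> ->; rewrite opprD cisD -[in X in _ * X]conj_cis.
  have -> : h * m%:~R * J%:R = m%:~R * (J%:R * h) by ring.
  by rewrite stepJ cis2pi_int conjc1 mulr1.
have F1 x y z : F (x + J%:R) y z = F x y z.
  rewrite /F mulrDr [h * J%:R]mulrC stepJ g1; congr (_ * _).
  rewrite -(@cisJ (freq k).1.1 x y z _ erefl); congr cis; rewrite /dot3 /=; ring.
have F2 x y z : F x (y + J%:R) z = F x y z.
  rewrite /F mulrDr [h * J%:R]mulrC stepJ g2; congr (_ * _).
  rewrite -(@cisJ (freq k).1.2 x y z _ erefl); congr cis; rewrite /dot3 /=; ring.
have F3 x y z : F x y (z + J%:R) = F x y z.
  rewrite /F mulrDr [h * J%:R]mulrC stepJ g3; congr (_ * _).
  rewrite -(@cisJ (freq k).2 x y z _ erefl); congr cis; rewrite /dot3 /=; ring.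
rewrite /fourier mulrCA; congr (_ * _).
transitivity (cis (h * dot3 n (a, b, c)) *
  \sum_(j : grid K) F (j.1.1%:R + a) (j.1.2%:R + b) (j.2%:R + c)).
  rewrite mulr_sumr; apply: eq_bigr => j _.
  rewrite /F /character conj_cis mulrCA -cisD /shifted /gpt /= !mulrDr.
  by congr (_ * cis _); rewrite /dot3 /=; ring.
congr (_ * _).
transitivity (\sum_(j : grid K) F j.1.1%:R j.1.2%:R j.2%:R); last first.
  apply: eq_bigr => j _; rewrite /F /character conj_cis; congr (_ * cis _).
  by rewrite /dot3 /=; ring.
pose S (G : 'I_J -> 'I_J -> 'I_J -> R[i]) := \sum_(j : grid K) G j.1.1 j.1.2 j.2.
have SE G : S G = \sum_x \sum_y \sum_z G x y z by rewrite /S !pair_bigA.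
rewrite -[LHS]/(S (fun x y z => F (x%:R + a) (y%:R + b) (z%:R + c))).
rewrite -[RHS]/(S (fun x y z => F x%:R y%:R z%:R)) !SE.
rewrite (@sum_unit_shift _ (fun x => \sum_(y < J) \sum_(z < J) F x (y%:R + b) (z%:R + c)))//; last first.
  by move=> x; apply: eq_bigr => y _; apply: eq_bigr => z _; rewrite F1.
apply: eq_bigr => x _.
rewrite (@sum_unit_shift _ (fun y => \sum_(z < J) F x%:R y (z%:R + c)))//; last first.
  by move=> y; apply: eq_bigr => z _; rewrite F2.
apply: eq_bigr => y _.
by rewrite (@sum_unit_shift _ (fun z => F x%:R y%:R z)).
Qed.

(** Seven-point discretisation of Laplacian g + lam^2 g, a quantity that is 0 for an
    eigenfunction. *)
Definition discrete_residual (lam d : R) (x : R * R * R) : R[i] :=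
  ((d ^+ 2)^-1)%:C *
    ((g (shifted d 0 0 x) + g (shifted (- d) 0 0 x) - 2 * g x) +
     (g (shifted 0 d 0 x) + g (shifted 0 (- d) 0 x) - 2 * g x) +
     (g (shifted 0 0 d x) + g (shifted 0 0 (- d) x) - 2 * g x))
  + (lam ^+ 2)%:C * g x.

(** Fourier multiplier of minus the seven-point Laplacian; it tends to |n|^2 as d tends to 0. *)
Definition symbol (d : R) (n : R * R * R) : R :=
  (d ^+ 2)^-1 * ((2 - 2 * cos (d * n.1.1)) + (2 - 2 * cos (d * n.1.2)) +
    (2 - 2 * cos (d * n.2))).

Lemma cisDN (x : R) : cis x + cis (- x) = (2 * cos x)%:C.
Proof. by rewrite /cis cosN sinN /= [in RHS]mulr_natl mulr2n; congr (_ +i* _); rewrite ?subrr. Qed.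

Lemma fourier_residual (lam : R) (k : grid K) :
  ft (fun j => discrete_residual lam h (gpt j)) k =
  (lam ^+ 2 - symbol h (int3 (freq k)))%:C * ft (fun j => g (gpt j)) k.
Proof.
have m0 : (0 : R) \in [:: 0; 1; -1] by rewrite mem_head.
have m1 : (1 : R) \in [:: 0; 1; -1] by rewrite !inE eqxx orbT.
have mN : (-1 : R) \in [:: 0; 1; -1] by rewrite !inE eqxx !orbT.
have E a b c := @fourier_shift a b c k.
have e1 := E _ _ _ m1 m0 m0; have e2 := E _ _ _ mN m0 m0.
have e3 := E _ _ _ m0 m1 m0; have e4 := E _ _ _ m0 mN m0.
have e5 := E _ _ _ m0 m0 m1; have e6 := E _ _ _ m0 m0 mN.
rewrite !(mulr0, mulr1, mulrN1) in e1 e2 e3 e4 e5 e6.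
rewrite /discrete_residual !(fourierD, fourierZ).
have fN (f : grid K -> R[i]) : ft (fun j => - (2 * f j)) k = - (2 * ft f k).
  have -> : (fun j => - (2 * f j)) = (fun j => (-2) * f j).
    by apply/funext => j; rewrite mulNr.
  by rewrite fourierZ mulNr.
rewrite !fN e1 e2 e3 e4 e5 e6; set x := ft _ k.
have -> : dot3 (int3 (freq k)) (1, 0, 0) = (freq k).1.1%:~R :> R.
  by rewrite /dot3 /= mulr1 !mulr0 !addr0.
have -> : dot3 (int3 (freq k)) (-1, 0, 0) = - (freq k).1.1%:~R :> R.
  by rewrite /dot3 /= mulrN1 !mulr0 !addr0.
have -> : dot3 (int3 (freq k)) (0, 1, 0) = (freq k).1.2%:~R :> R.
  by rewrite /dot3 /= mulr1 !mulr0 addr0 add0r.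
have -> : dot3 (int3 (freq k)) (0, -1, 0) = - (freq k).1.2%:~R :> R.
  by rewrite /dot3 /= mulrN1 !mulr0 addr0 add0r.
have -> : dot3 (int3 (freq k)) (0, 0, 1) = (freq k).2%:~R :> R.
  by rewrite /dot3 /= mulr1 !mulr0 !add0r.
have -> : dot3 (int3 (freq k)) (0, 0, -1) = - (freq k).2%:~R :> R.
  by rewrite /dot3 /= mulrN1 !mulr0 !add0r.
rewrite !mulrN -!mulrDl -!mulrBl !cisDN -mulrDl -mulrDl mulrA -mulrDl; congr (_ * _).
rewrite /symbol /=; have -> : (2 : R[i]) = (2 : R)%:C by rewrite rmorph_nat.
by rewrite -!(rmorphB, rmorphD, rmorphM) /=; congr (_ %:C); ring.
Qed.

End discrete_laplacian.

(** * Gap between the symbol and the eigenvalue *)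

Section spectral_gap.
Context {R : realType}.

Lemma two_sub_cos_le (x : R) : 2 - 2 * cos x <= x ^+ 2.
Proof. by have := cos_ge_quadratic x => ?; lra. Qed.

Lemma two_sub_cos_ge_quartic (x : R) : `|x| <= pi ->
  x ^+ 2 - x ^+ 4 / 12 <= 2 - 2 * cos x.
Proof.
wlog x0 : x / 0 <= x.
  move=> H; have [/H//|/ltW x0] := leP 0 x.
  have -> : x ^+ 4 = (- x) ^+ 4 by ring.
  by rewrite -normrN -sqrrN -cosN; apply: H; rewrite oppr_ge0.
rewrite ger0_norm// => xpi; have p2 := pihalf_lt2 R.
have h2 : x / 2 <= 2 by clear -xpi p2; lra.
have -> : cos x = cos (x / 2 *+ 2) by congr cos; rewrite -mulr_natr; field.
rewrite cos_mulr2n cos2sin2.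
have h0 : 0 <= x / 2 by rewrite divr_ge0.
have := sin_ge_cubic h0.
have -> : x ^+ 2 - x ^+ 4 / 12 = 4 * ((x / 2) ^+ 2 - (x / 2) ^+ 4 / 3) by field.
move: (x / 2) (sin (x / 2)) h0 h2 => u s; clear => u0 u2 us.
have a0 : 0 <= u - u ^+ 3 / 6.
  have -> : u - u ^+ 3 / 6 = u * (1 - u ^+ 2 / 6) by ring.
  by apply: mulr_ge0 => //; nra.
have : (u - u ^+ 3 / 6) ^+ 2 <= s ^+ 2 by rewrite lerXn2r ?nnegrE// (le_trans a0).
have -> : (u - u ^+ 3 / 6) ^+ 2 = u ^+ 2 - u ^+ 4 / 3 + (u ^+ 3 / 6) ^+ 2 by field.
have := sqr_ge0 (u ^+ 3 / 6); rewrite -mulr_natr => *; lra.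
Qed.

Lemma int_gap (x : R) : exists2 gam : R, 0 < gam &
  forall m : int, m%:~R != x -> gam <= `|x - m%:~R|.
Proof.
have h1 := real_floor_le (num_real x); have h2 := real_floorD1_gt (num_real x).
set f := Num.floor x in h1 h2.
have lt_int (m : int) : (f < m)%R -> (f%:~R + 1 <= m%:~R :> R).
  by move=> fm; rewrite -[1]/(1%:~R) -intrD ler_int; move: fm; clear; lia.
rewrite intrD in h2.
have [fx|fx] := eqVneq (f%:~R) x.
  exists 1 => // m mx; have [mf|fm|mf] := ltgtP m f.
  - have : m%:~R + 1 <= f%:~R :> R.
      by rewrite -[1]/(1%:~R) -intrD ler_int; move: mf; clear; lia.
    by move=> q; apply: le_trans (ler_norm _); rewrite -fx; clear -q; lra.
  - have q := lt_int _ fm; rewrite distrC; apply: le_trans (ler_norm _).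
    by rewrite -fx; clear -q; lra.
  - by rewrite mf fx eqxx in mx.
exists (Num.min (x - f%:~R) (f%:~R + 1 - x)).
  by rewrite lt_min !subr_gt0 h2 andbT lt_neqAle fx.
move=> m mx; rewrite ge_min; have [mf|fm] := leP m f.
  apply/orP; left; apply: le_trans (ler_norm _).
  by rewrite lerD2l lerN2 ler_int.
apply/orP; right; rewrite distrC; apply: le_trans (ler_norm _).
by rewrite lerD2r lt_int.
Qed.

(** Let s = |n|^2. If s >= 18 lam^2, the symbol is at least s / 9 >= 2 lam^2, which leaves (1 + s) /
    36. Otherwise s, an integer other than lam^2, is at distance at least [gam] from it. The symbol
    differs from s by at most d^2 s^2 / 12 <= 27 d lam^4, which is at most gam / 2 by the choice of
    [d0]. *)
Lemma symbol_gap (lam : R) : 1 <= lam -> exists2 c0 : R, 0 < c0 &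
  exists2 d0 : R, 0 < d0 & forall (d : R) (n : Z3), 0 < d <= d0 ->
    [/\ `|d * n.1.1%:~R| <= pi, `|d * n.1.2%:~R| <= pi & `|d * n.2%:~R| <= pi] ->
    dot3 (int3 n) (int3 n) != lam ^+ 2 ->
    c0 * (1 + dot3 (int3 n) (int3 n)) <= `|lam ^+ 2 - symbol d (int3 n)|.
Proof.
move=> l1; set Lam := lam ^+ 2; have L1 : 1 <= Lam by rewrite exprn_ege1.
have [gam g0 gP] := int_gap Lam.
have cc0 : 0 < Num.min (36^-1) (gam / 2 / (1 + 18 * Lam)).
  by rewrite lt_min invr_gt0 ltr0n /= !divr_gt0//; clear -L1; lra.
exists (Num.min (36^-1) (gam / 2 / (1 + 18 * Lam))) => //.
exists (Num.min 1 (gam / (54 * Lam ^+ 2))).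
  by rewrite lt_min ltr01 /= divr_gt0// mulr_gt0// exprn_gt0//; clear -L1; lra.
move=> d n /andP[dpos]; rewrite le_min => /andP[d1 dg] [p1 p2 p3] nl.
have d2 : 0 < d ^+ 2 by rewrite exprn_gt0.
set s := dot3 _ _ in nl *; set q := symbol _ _.
have s0 : 0 <= s by apply: dot3_ge0.
have sE : s = n.1.1%:~R ^+ 2 + n.1.2%:~R ^+ 2 + n.2%:~R ^+ 2.
  by rewrite /s /dot3 /= !expr2.
have q9 : s / 9 <= q.
  rewrite /q /symbol /= [leRHS]mulrC ler_pdivlMr//.
  apply: le_trans (lerD (lerD (two_sub_cos_ge p1) (two_sub_cos_ge p2)) (two_sub_cos_ge p3)).
  by rewrite sE !exprMn le_eqVlt; apply/orP; left; apply/eqP; field.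
have qs : q <= s.
  rewrite /q /symbol /= [leLHS]mulrC ler_pdivrMr//.
  apply: le_trans (lerD (lerD (two_sub_cos_le _) (two_sub_cos_le _)) (two_sub_cos_le _)) _.
  by rewrite sE !exprMn le_eqVlt; apply/orP; left; apply/eqP; ring.
have sq : s - d ^+ 2 * s ^+ 2 / 12 <= q.
  rewrite /q /symbol /= [leRHS]mulrC ler_pdivlMr//.
  apply: le_trans (lerD (lerD (two_sub_cos_ge_quartic p1) (two_sub_cos_ge_quartic p2))
     (two_sub_cos_ge_quartic p3)).
  rewrite sE !exprMn; move: (n.1.1%:~R : R) (n.1.2%:~R : R) (n.2%:~R : R) => x y z.
  rewrite -subr_ge0 [X in 0 <= X](_ : _ = (d ^+ 2) ^+ 2 / 6 *
    (x ^+ 2 * y ^+ 2 + x ^+ 2 * z ^+ 2 + y ^+ 2 * z ^+ 2)); last by field.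
  by rewrite mulr_ge0 ?divr_ge0 ?sqr_ge0// !addr_ge0// mulr_ge0// sqr_ge0.
have [s18|s18] := leP (18 * Lam) s.
  apply: le_trans (_ : _ <= 36^-1 * (1 + s)) _.
    by apply: ler_wpM2r; [exact: addr_ge0|rewrite ge_min lexx].
  rewrite distrC; apply: le_trans (ler_norm _); move: q9 s18 L1; clear => *; lra.
have gs : gam <= `|Lam - s|.
  by have := gP (dot3 n n); rewrite -dot3_int3; apply.
apply: le_trans (_ : _ <= gam / 2) _.
  apply: le_trans (_ : _ <= gam / 2 / (1 + 18 * Lam) * (1 + s)) _.
    by apply: ler_wpM2r; [exact: addr_ge0|rewrite ge_min lexx orbT].
  rewrite mulrAC ler_pdivrMr; last by clear -L1; lra.
  by apply: ler_wpM2l; [rewrite divr_ge0// ltW|rewrite lerD2l ltW].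
have dist : s - q <= gam / 2.
  apply: le_trans (_ : _ <= d ^+ 2 * s ^+ 2 / 12) _; first by clear -sq; lra.
  have h1 : s ^+ 2 <= (18 * Lam) ^+ 2 by rewrite lerXn2r ?nnegrE ?(ltW s18)//; clear -L1; lra.
  have h2 : d ^+ 2 <= d by rewrite expr2 ler_piMl// ltW.
  have h3 : d * (54 * Lam ^+ 2) <= gam.
    by rewrite -ler_pdivlMr// mulr_gt0// exprn_gt0//; clear -L1; lra.
  have h4 : d ^+ 2 * s ^+ 2 <= d * (18 * Lam) ^+ 2.
    by apply: ler_pM; rewrite ?sqr_ge0.
  have e1 : d * (18 * Lam) ^+ 2 = 6 * (d * (54 * Lam ^+ 2)) by ring.
  by rewrite e1 in h4; clear -h3 h4; lra.
have sq' : `|s - q| <= gam / 2 by rewrite ger0_norm// subr_ge0.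
have := ler_normD (Lam - q) (q - s); rewrite addrA subrK [`|q - s|]distrC.
by move: gs sq'; clear => *; lra.
Qed.

(** Telescoping: 1 / y^2 <= 2 / y - 2 / (y + 1) for y >= 1. *)
Lemma sum_inv_shift_le (x : R) (N : nat) : 1 <= x ->
  \sum_(c < N) ((x + c%:R) ^+ 2)^-1 <= 2 / x.
Proof.
move=> x1; suff : \sum_(c < N) ((x + c%:R) ^+ 2)^-1 <= 2 / x - 2 / (x + N%:R).
  move/le_trans; apply; rewrite gerBl divr_ge0// addr_ge0//; clear -x1; lra.
elim: N => [|N IH]; first by rewrite big_ord0 addr0 subrr.
rewrite big_ord_recr /=; apply: le_trans (lerD IH (lexx _)) _.
rewrite -[N.+1%:R]natr1 addrA; have : 1 <= x + N%:R by rewrite ler_wpDr.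
move: (x + N%:R) => y; clear => y1.
have : (y ^+ 2)^-1 <= 2 / y - 2 / (y + 1).
  have -> : 2 / y - 2 / (y + 1) = 2 / (y * (y + 1)) by field; lra.
  rewrite -[leLHS]mul1r ler_pdivrMr ?exprn_gt0//; last by lra.
  by rewrite mulrAC ler_pdivlMr; nra.
by move=> *; lra.
Qed.

Lemma sum_freq1_le (K : nat) (F : R -> R) : (forall x, 0 <= F x) ->
  \sum_(k < gridn K) F `|(freq1 k)%:~R| <= 2 * \sum_(c < K.+1) F c%:R.
Proof.
move=> F0; have -> : 2 = 1 + 1 :> R by [].
rewrite mulrDl mul1r.
rewrite -(big_mkord xpredT (fun k => F `|(k%:Z - K%:Z)%:~R|)).
rewrite (@big_cat_nat _ _ _ K)//=; last by rewrite /gridn mul2n -addnn ltnW// ltnS leq_addr.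
apply: lerD.
  rewrite big_nat_rev /= add0n big_mkord big_ord_recl /=.
  apply: le_trans (_ : _ <= \sum_(i < K) F (lift ord0 i)%:R) _; last by rewrite ler_wpDl.
  apply: ler_sum => i _; rewrite intrB -!pmulrn.
  rewrite natrB//; have -> : K%:R - i.+1%:R - K%:R = - i.+1%:R :> R by ring.
  by rewrite normrN ger0_norm.
rewrite -{1}[K]add0n big_addn /gridn mul2n -addnn -addSn addnK big_mkord.
by apply: ler_sum => i _; rewrite PoszD addrK -pmulrn ger0_norm.
Qed.

(** What matters is uniformity in [K]. The summand is at most 16 (1 + |a| + |b| + |c|)^-4, and each
    summation over one coordinate lowers the exponent by one and costs a factor 4. *)
Lemma sum_freq_le (K : nat) :
  \sum_(k : grid K) ((1 + dot3 (int3 (freq k)) (int3 (freq k))) ^+ 2)^-1 <= 1024 :> R.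
Proof.
pose G (a b c : R) := 16 * ((1 + `|a| + `|b| + `|c|) ^+ 4)^-1.
apply: le_trans (_ : _ <= \sum_(k : grid K) G (freq1 k.1.1)%:~R (freq1 k.1.2)%:~R
    (freq1 k.2)%:~R) _.
  apply: ler_sum => k _; rewrite /G /dot3 /= -!expr2.
  move: (_%:~R : R) (_%:~R : R) (_%:~R : R) => c b a.
  rewrite -[a ^+ 2]real_normK ?num_real// -[b ^+ 2]real_normK ?num_real//.
  rewrite -[c ^+ 2]real_normK ?num_real//.
  move: `|a| `|b| `|c| (normr_ge0 a) (normr_ge0 b) (normr_ge0 c); clear => x y z x0 y0 z0.
  have p : 0 < 1 + x + y + z by lra.
  rewrite -[leLHS]mul1r ler_pdivrMr ?exprn_gt0//; last by nra.
  rewrite mulrAC ler_pdivlMr ?exprn_gt0// mul1r.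
  have -> : (1 + x + y + z) ^+ 4 = ((1 + x + y + z) ^+ 2) ^+ 2 by ring.
  have -> : 16 * (1 + (x ^+ 2 + y ^+ 2 + z ^+ 2)) ^+ 2 =
     (4 * (1 + (x ^+ 2 + y ^+ 2 + z ^+ 2))) ^+ 2 by ring.
  rewrite lerXn2r ?nnegrE ?sqr_ge0//; first by nra.
  have h1 := sqr_ge0 (1 - x); have h2 := sqr_ge0 (1 - y); have h3 := sqr_ge0 (1 - z).
  have h4 := sqr_ge0 (x - y); have h5 := sqr_ge0 (x - z); have h6 := sqr_ge0 (y - z).
  by nra.
have -> : \sum_(k : grid K) G (freq1 k.1.1)%:~R (freq1 k.1.2)%:~R (freq1 k.2)%:~R =
  \sum_(a < gridn K) \sum_(b < gridn K) \sum_(c < gridn K)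
    G (freq1 a)%:~R (freq1 b)%:~R (freq1 c)%:~R by rewrite !pair_bigA.
have S4 (x : R) : 1 <= x ->
    \sum_(c < gridn K) 16 * ((x + `|(freq1 c)%:~R|) ^+ 4)^-1 <= 64 * (x ^+ 3)^-1.
  move=> x1; have x0 : 0 < x by lra.
  apply: le_trans (@sum_freq1_le K (fun z => 16 * ((x + z) ^+ 4)^-1) _) _.
    by move=> z; rewrite mulr_ge0// invr_ge0 (exprn_even_ge0 (n := 4)).
  apply: le_trans (_ : _ <= 2 * \sum_(c < K.+1) 16 * (x ^+ 2)^-1 * ((x + c%:R) ^+ 2)^-1) _.
    rewrite ler_wpM2l//; apply: ler_sum => c _; rewrite -mulrA ler_wpM2l// -invfM.
    have xc : x <= x + c%:R by rewrite lerDl.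
    rewrite lef_pV2 ?posrE ?mulr_gt0 ?exprn_gt0 ?(lt_le_trans x0)//.
    have -> : (x + c%:R) ^+ 4 = (x + c%:R) ^+ 2 * (x + c%:R) ^+ 2 by ring.
    apply: ler_wpM2r; first exact: sqr_ge0.
    by rewrite lerXn2r ?nnegrE ?(ltW x0) ?(le_trans (ltW x0)).
  rewrite -mulr_sumr.
  have -> : 64 * (x ^+ 3)^-1 = 2 * (16 * (x ^+ 2)^-1 * (2 / x)) by field; lra.
  by rewrite ler_wpM2l// ler_wpM2l ?sum_inv_shift_le// mulr_ge0// invr_ge0 sqr_ge0.
have S3 (x : R) : 1 <= x ->
    \sum_(c < gridn K) 64 * ((x + `|(freq1 c)%:~R|) ^+ 3)^-1 <= 256 * (x ^+ 2)^-1.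
  move=> x1; have x0 : 0 < x by lra.
  apply: le_trans (_ : _ <= \sum_(c < gridn K) 64 * x^-1 *
      ((x + `|(freq1 c)%:~R|) ^+ 2)^-1) _.
    apply: ler_sum => c _; have n0 := normr_ge0 ((freq1 c)%:~R : R).
    rewrite -mulrA ler_wpM2l// -invfM.
    have xc : x <= x + `|(freq1 c)%:~R| by rewrite lerDl.
    rewrite lef_pV2 ?posrE ?mulr_gt0 ?exprn_gt0 ?(lt_le_trans x0)//.
    by rewrite [leRHS]exprS ler_wpM2r// sqr_ge0.
  rewrite -mulr_sumr.
  have -> : 256 * (x ^+ 2)^-1 = 64 * x^-1 * (2 * (2 / x)) by field; lra.
  rewrite ler_wpM2l ?mulr_ge0 ?invr_ge0 ?(ltW x0)//.
  apply: le_trans (@sum_freq1_le K (fun z => ((x + z) ^+ 2)^-1) _) _.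
    by move=> z; rewrite invr_ge0 sqr_ge0.
  by rewrite ler_wpM2l// sum_inv_shift_le.
apply: le_trans (_ : _ <= \sum_(a < gridn K) 256 * ((1 + `|(freq1 a)%:~R|) ^+ 2)^-1) _.
  apply: ler_sum => a _.
  apply: le_trans (_ : _ <= \sum_(b < gridn K) 64 * ((1 + `|(freq1 a)%:~R| +
    `|(freq1 b)%:~R|) ^+ 3)^-1) _; last by apply: S3; rewrite ler_wpDr.
  by apply: ler_sum => b _; apply: S4; rewrite -addrA ler_wpDr// addr_ge0.
rewrite -mulr_sumr.
have -> : 1024 = 256 * (2 * (2 / 1)) :> R by rewrite divr1; ring.
rewrite ler_wpM2l//.
apply: le_trans (@sum_freq1_le K (fun z => ((1 + z) ^+ 2)^-1) _) _.
  by move=> z; rewrite invr_ge0 sqr_ge0.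
by rewrite ler_wpM2l// sum_inv_shift_le.
Qed.

End spectral_gap.

(** * Uniform approximation by waves *)

Section wave_approximation.
Context {R : realType}.

Definition near3 (d : R) (x y : R * R * R) : Prop :=
  [/\ `|x.1.1 - y.1.1| <= d, `|x.1.2 - y.1.2| <= d & `|x.2 - y.2| <= d].

Lemma sqn_cis_sub (x y : R) : sqn (cis x - cis y) <= (x - y) ^+ 2.
Proof.
have -> : cis x - cis y = cis y * - (1 - cis (x - y)).
  by rewrite opprB mulrBr mulr1 -cisD [y + _]addrC subrK.
have -> : sqn (cis y * - (1 - cis (x - y))) = sqn (1 - cis (x - y)).
  rewrite sqnM -normc_sqr normc_cis expr1n mul1r.
  by move: (1 - _) => [a b]; rewrite /sqn /= !sqrrN.
by rewrite sqn_one_sub_cis two_sub_cos_le.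
Qed.

Lemma normc_cis_sub (x y : R) : normc (cis x - cis y) <= `|x - y|.
Proof.
rewrite -ler_sqr ?nnegrE ?normc_ge0// normc_sqr real_normK ?num_real//.
exact: sqn_cis_sub.
Qed.

Lemma dot3_near (v x y : R * R * R) (lam d : R) : 0 <= lam ->
  dot3 v v = lam ^+ 2 -> near3 d x y -> `|dot3 v x - dot3 v y| <= 3 * lam * d.
Proof.
move=> l0 vl [h1 h2 h3].
have vE : v.1.1 ^+ 2 + v.1.2 ^+ 2 + v.2 ^+ 2 = lam ^+ 2.
  by rewrite -vl /dot3 !expr2.
have b1 : `|v.1.1| <= lam.
  by apply: norm_le_sqr => //; rewrite -vE -addrA lerDl addr_ge0 ?sqr_ge0.
have b2 : `|v.1.2| <= lam.
  by apply: norm_le_sqr => //; rewrite -vE addrAC lerDr addr_ge0 ?sqr_ge0.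
have b3 : `|v.2| <= lam.
  by apply: norm_le_sqr => //; rewrite -vE lerDr addr_ge0 ?sqr_ge0.
have -> : dot3 v x - dot3 v y = v.1.1 * (x.1.1 - y.1.1) + v.1.2 * (x.1.2 - y.1.2) +
    v.2 * (x.2 - y.2) by rewrite /dot3; ring.
have -> : 3 * lam * d = lam * d + lam * d + lam * d by ring.
apply: le_trans (ler_normD _ _) _; rewrite lerD//; last by rewrite normrM ler_pM.
by apply: le_trans (ler_normD _ _) _; rewrite lerD// normrM ler_pM.
Qed.

Lemma wave_near (c : Z3 -> R[i]) s (lam B d : R) (x y : R * R * R) :
  0 <= lam -> on_sphere lam s -> (forall n, normc (c n) <= B) ->
  near3 d x y -> normc (wave c s x - wave c s y) <= (size s)%:R * (B * (3 * lam * d)).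
Proof.
move=> l0 ss cB xy; rewrite /wave -sumrB; apply: le_trans (normc_sum _ _ _) _.
apply: le_trans (_ : _ <= \sum_(n <- s) B * (3 * lam * d)) _; last first.
  by rewrite big_const_seq count_predT iter_addr addr0 -[leLHS]mulr_natl.
rewrite big_seq [leRHS]big_seq; apply: ler_sum => n ns.
rewrite -mulrBr Normc.normcM; apply: ler_pM; rewrite ?normc_ge0//.
by apply: le_trans (normc_cis_sub _ _) _; apply: dot3_near (ss _ ns) xy.
Qed.

(** A crude count in a cube. It makes the Lipschitz constant of the approximating waves independent
    of the grid. *)
Lemma size_sphere_le (lam : R) : exists m : nat, forall s, uniq s -> on_sphere lam s ->
  (size s <= m)%N.
Proof.
pose M := (Num.truncn `|lam|).+1.
have MP : `|lam| < M%:R by apply: truncnS_gt.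
pose I : seq int := [seq (i%:Z - M%:Z)%R | i <- iota 0 (2 * M)].
pose I3 := allpairs (fun (p : int * int) (z : int) => (p, z))
  (allpairs (fun x y : int => (x, y)) I I) I.
exists (size I3).
move=> s us ss; apply: uniq_leq_size => // -[[a b] c] /ss; rewrite /dot3 /= -!expr2 => e.
have mI (x : int) : (x%:~R : R) ^+ 2 <= lam ^+ 2 -> x \in I.
  move=> xl; have : `|x%:~R| < M%:R :> R.
    apply: le_lt_trans MP; apply: norm_le_sqr => //.
    by rewrite real_normK ?num_real.
  rewrite -intr_norm pmulrn ltr_int => xM.
  apply/mapP; exists (absz (x + M%:Z)%R); first by rewrite mem_iota /=; move: xM; clear; lia.
  by move: xM; clear; lia.
have h1 := sqr_ge0 (a%:~R : R); have h2 := sqr_ge0 (b%:~R : R).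
have h3 := sqr_ge0 (c%:~R : R).
have aI : a \in I by apply: mI; clear -e h1 h2 h3; lra.
have bI : b \in I by apply: mI; clear -e h1 h2 h3; lra.
have cI : c \in I by apply: mI; clear -e h1 h2 h3; lra.
by rewrite /I3; apply: allpairs_f => //; apply: allpairs_f.
Qed.

Lemma periodic_reduce (T : Type) (F : R -> T) (u : R) : (forall x, F (x + 2 * pi) = F x) ->
  exists2 v, 0 <= v < 2 * pi & F u = F v.
Proof.
move=> FP; have p0 : 0 < 2 * pi :> R by rewrite mulr_gt0// pi_gt0.
have FN (n : nat) x : F (x + n%:R * (2 * pi)) = F x.
  elim: n x => [|n IH] x; first by rewrite mul0r addr0.
  by rewrite -natr1 mulrDl mul1r addrA FP IH.
have FZ (m : int) x : F (x + m%:~R * (2 * pi)) = F x.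
  case: m => n; first by rewrite -pmulrn FN.
  by rewrite NegzE intrN mulNr -pmulrn -[in RHS](subrK (n.+1%:R * (2 * pi)) x) FN.
have h1 := real_floor_le (num_real (u / (2 * pi))).
have h2 := real_floorD1_gt (num_real (u / (2 * pi))).
set m := Num.floor _ in h1 h2.
rewrite ler_pdivlMr// in h1; rewrite ltr_pdivrMr// intrD mulrDl mul1r in h2.
exists (u - m%:~R * (2 * pi)); last by rewrite -[in LHS](subrK (m%:~R * (2 * pi)) u) FZ.
by apply/andP; split; [rewrite subr_ge0|rewrite ltrBlDl].
Qed.

Lemma mesh_index (L : nat) (h a : R) : 0 < h -> 0 <= a < L%:R * h ->
  exists i : 'I_L, exists2 u, 0 <= u <= h & a = i%:R * h + u.
Proof.
move=> h0 /andP[a0 aL].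
have q0 : 0 <= a / h by rewrite divr_ge0// ltW.
have i1 : (Num.truncn (a / h))%:R <= a / h by rewrite truncn_le.
have i2 := truncnS_gt (a / h); set i := Num.truncn _ in i1 i2.
rewrite ler_pdivlMr// in i1; rewrite ltr_pdivrMr// -natr1 mulrDl mul1r in i2.
have iL : (i < L)%N by rewrite -(ltr_nat R) -(ltr_pM2r h0) (le_lt_trans i1).
exists (Ordinal iL), (a - i%:R * h); last by rewrite /= addrC subrK.
by rewrite subr_ge0 i1 lerBlDl ltW.
Qed.

Lemma grid_round (K : nat) (v : R) : 0 <= v < 2 * pi ->
  exists j : 'I_(gridn K), `|v - step K * j%:R| <= step K.
Proof.
rewrite -(stepJ K) => /(mesh_index (step_gt0 K))[j [u /andP[u0 uh] ->]].
by exists j; rewrite mulrC addrC addKr ger0_norm.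
Qed.

Lemma step_small (d : R) : 0 < d -> exists K0 : nat, forall K, (K0 <= K)%N -> step K <= d.
Proof.
move=> d0; exists (Num.truncn (2 * pi / d)).+1 => K KK.
rewrite /step ler_pdivrMr ?ltr0n// [d * _]mulrC -ler_pdivrMr//.
apply: le_trans (ltW (truncnS_gt _)) _; rewrite ler_nat.
by apply: leq_trans KK _; rewrite /gridn; clear; lia.
Qed.

Variables (g : R * R * R -> R[i]) (lam B : R).
Hypothesis l1 : 1 <= lam.
Hypothesis g1 : forall x y z, g (x + 2 * pi, y, z) = g (x, y, z).
Hypothesis g2 : forall x y z, g (x, y + 2 * pi, z) = g (x, y, z).
Hypothesis g3 : forall x y z, g (x, y, z + 2 * pi) = g (x, y, z).
Hypothesis gB : forall x, normc (g x) <= B.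
Hypothesis guc : forall eta : R, 0 < eta -> exists2 d : R, 0 < d &
  forall x y, near3 d x y -> normc (g x - g y) <= eta.
Hypothesis glap : forall eta : R, 0 < eta -> exists2 d0 : R, 0 < d0 &
  forall (d : R) x, 0 < d <= d0 -> normc (discrete_residual g lam d x) <= eta.

(** The grid Fourier coefficient, extended to all lattice points so that it can serve as the
    coefficients of a [wave]. *)
Definition coef (K : nat) (n : Z3) : R[i] :=
  (((gridn K)%:R ^+ 3)^-1)%:C *
    \sum_(j : grid K) g (gpt j) * conjc (cis (dot3 (int3 n) (gpt j))).

Definition spectrum (K : nat) : seq Z3 :=
  [seq freq k | k <- enum (grid K) & dot3 (int3 (freq k)) (int3 (freq k)) == lam ^+ 2].

Lemma gridn3_gt0 K : 0 < (gridn K)%:R ^+ 3 :> R.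
Proof. by rewrite exprn_gt0// ltr0n. Qed.

Lemma sum_grid_const K (a : R) : \sum_(j : grid K) a = (gridn K)%:R ^+ 3 * a.
Proof.
rewrite sumr_const -[LHS]mulr_natl -natrX; congr (_%:R * _).
by rewrite !card_prod !card_ord !expnS expn0 muln1 mulnA.
Qed.

Lemma normc_coef_le K n : normc (coef K n) <= B.
Proof.
rewrite /coef Normc.normcM.
have -> : normc (((gridn K)%:R ^+ 3)^-1)%:C = ((gridn K)%:R ^+ 3)^-1 :> R.
  by rewrite /= expr0n addr0 sqrtr_sqr ger0_norm// invr_ge0 ltW// gridn3_gt0.
rewrite mulrC ler_pdivrMr ?gridn3_gt0// mulrC -sum_grid_const.
apply: le_trans (normc_sum _ _ _) _; apply: ler_sum => j _.
by rewrite Normc.normcM normc_conj normc_cis mulr1.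
Qed.

Lemma uniq_spectrum K : uniq (spectrum K).
Proof. by rewrite (map_inj_uniq (@freq_inj K)); apply: filter_uniq; apply: enum_uniq. Qed.

Lemma spectrum_on_sphere K : on_sphere lam (spectrum K).
Proof. by move=> n /mapP[k + ->]; rewrite mem_filter => /andP[/eqP]. Qed.

Lemma sum_spectrum K (V : nmodType) (F : Z3 -> V) :
  \sum_(n <- spectrum K) F n =
  \sum_(k : grid K | dot3 (int3 (freq k)) (int3 (freq k)) == lam ^+ 2 :> R) F (freq k).
Proof. by rewrite /spectrum big_map big_filter big_enum_cond. Qed.

Lemma sum_sqn_coef_le K :
  (gridn K)%:R ^+ 3 * \sum_(n <- spectrum K) sqn (coef K n) <=
  \sum_(j : grid K) sqn (g (gpt j)).
Proof.
rewrite mulrC -ler_pdivlMr ?gridn3_gt0// mulrC.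
rewrite -(@fourier_parseval R (grid K) (@character R K) _ (gridn3_gt0 K) (@character_ortho R K)).
rewrite sum_spectrum [leRHS](bigID (fun k => dot3 (int3 (freq k)) (int3 (freq k)) == lam ^+ 2)) /=.
rewrite -[leLHS]addr0; apply: lerD => //.
by apply: sumr_ge0 => k _; apply: sqn_ge0.
Qed.

(** The error is the part of the Fourier expansion off the sphere. There the coefficient is at most
    |r k| / (c0 D k), with r the transform of the residual. The square sum of r is small by
    Parseval, and that of 1 / D is bounded uniformly in [K]. *)
Lemma wave_approx_grid (eta : R) : 0 < eta -> exists K0 : nat, forall K, (K0 <= K)%N ->
  forall j : grid K,
    normc (g (gpt j) - wave (coef K) (spectrum K) (gpt j)) <= eta.
Proof.
move=> eta0; have [c0 c00 [d0 d00 gap]] := symbol_gap l1.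
have [S S0 SP] : exists2 S : R, 0 < S & forall K,
    \sum_(k : grid K) ((1 + dot3 (int3 (freq k)) (int3 (freq k))) ^+ 2)^-1 <= S.
  by exists 1024; [rewrite ltr0n|exact: sum_freq_le].
pose A := 1 + S / c0 ^+ 2.
have A0 : 0 < A by rewrite addr_gt0// divr_gt0// exprn_gt0.
pose om := eta / A; have om0 : 0 < om by rewrite divr_gt0.
have [d1 d10 lap] := glap om0.
have dd : 0 < Num.min d0 d1 by rewrite lt_min d00.
have [K0 KP] := step_small dd; exists K0 => K KK j.
have h0 := @step_gt0 R K.
have := KP K KK; rewrite le_min => /andP[hd0 hd1].
set ft := fourier (@character R K) ((gridn K)%:R ^+ 3).
pose bad (k : grid K) := dot3 (int3 (freq k)) (int3 (freq k)) != lam ^+ 2.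
have -> : g (gpt j) - wave (coef K) (spectrum K) (gpt j) =
    \sum_(k : grid K | bad k) ft (fun j => g (gpt j)) k * character k j.
  rewrite {1}(@fourier_inversion R (grid K) (@character R K) _ (gridn3_gt0 K)
    (@character_ortho R K) (fun j => g (gpt j)) j).
  rewrite (bigID (fun k => dot3 (int3 (freq k)) (int3 (freq k)) == lam ^+ 2)) /=.
  by rewrite /wave sum_spectrum addrC addrK.
apply: le_trans (normc_sum _ _ _) _.
pose r k := ft (fun j => discrete_residual g lam (step K) (gpt j)) k.
pose D (k : grid K) : R := 1 + dot3 (int3 (freq k)) (int3 (freq k)).
apply: le_trans (_ : _ <= \sum_(k : grid K) (sqn (r k) / om + om / c0 ^+ 2 *
   (D k ^+ 2)^-1) / 2) _.
  rewrite [leRHS](bigID bad) /= -[leLHS]addr0; apply: lerD; last first.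
    apply: sumr_ge0 => k _; apply: divr_ge0 => //; apply: addr_ge0.
      exact: divr_ge0 (sqn_ge0 _) (ltW om0).
    apply: mulr_ge0; first exact: divr_ge0 (ltW om0) (sqr_ge0 _).
    by rewrite invr_ge0 sqr_ge0.
  apply: ler_sum => k kbad; rewrite Normc.normcM normc_cis mulr1.
  have D1 : 0 < D k by rewrite ltr_wpDr ?dot3_ge0.
  have rE : normc (r k) = `|lam ^+ 2 - symbol (step K) (int3 (freq k))| *
      normc (ft (fun j => g (gpt j)) k).
    rewrite /r /ft fourier_residual// Normc.normcM; congr (_ * _).
    by rewrite /= expr0n addr0 sqrtr_sqr.
  have := gap (step K) (freq k); rewrite h0 hd0 => /(_ isT _ kbad) q.
  have {}q : c0 * D k <= `|lam ^+ 2 - symbol (step K) (int3 (freq k))|.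
    by apply: q; split; apply: freq1_pi.
  set a := normc (ft _ _) in rE *; have a0 : 0 <= a by apply: normc_ge0.
  have cD : 0 < c0 * D k by rewrite mulr_gt0.
  have ab : c0 * D k * a <= normc (r k) by rewrite rE ler_wpM2r.
  rewrite -normc_sqr; set b := normc (r k) in ab *.
  have -> : om / c0 ^+ 2 * (D k ^+ 2)^-1 = om / (c0 * D k) ^+ 2.
    by field; rewrite !gt_eqF.
  have ab' : a <= b / (c0 * D k) by rewrite ler_pdivlMr// mulrC.
  (* Arithmetic-geometric mean inequality with weight [om], in place of Cauchy-Schwarz. *)
  apply: le_trans ab' _; rewrite -subr_ge0.
  have -> : (b ^+ 2 / om + om / (c0 * D k) ^+ 2) / 2 - b / (c0 * D k) =
     (b - om / (c0 * D k)) ^+ 2 / om / 2 by field; rewrite !gt_eqF.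
  by rewrite divr_ge0// divr_ge0 ?sqr_ge0// ltW.
rewrite -mulr_suml big_split /= -mulr_suml -mulr_sumr.
have S1 : \sum_(k : grid K) sqn (r k) <= om ^+ 2.
  rewrite (@fourier_parseval R (grid K) (@character R K) _ (gridn3_gt0 K) (@character_ortho R K)).
  rewrite mulrC ler_pdivrMr ?gridn3_gt0// mulrC -sum_grid_const; apply: ler_sum => i _.
  by rewrite -normc_sqr lerXn2r ?nnegrE ?normc_ge0 ?(ltW om0)// lap// h0.
have S2 : \sum_(k : grid K) (D k ^+ 2)^-1 <= S by apply: SP.
have e1 : (\sum_(k : grid K) sqn (r k)) / om <= om.
  by rewrite ler_pdivrMr// -expr2.
have e2 : om / c0 ^+ 2 * \sum_(k : grid K) (D k ^+ 2)^-1 <= om / c0 ^+ 2 * S.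
  by rewrite ler_wpM2l// divr_ge0 ?sqr_ge0// ltW.
have e3 : om + om / c0 ^+ 2 * S = eta.
  have -> : om + om / c0 ^+ 2 * S = om * A by rewrite /A; ring.
  by rewrite /om divfK// gt_eqF.
have : (\sum_(k : grid K) sqn (r k)) / om +
  om / c0 ^+ 2 * \sum_(k : grid K) (D k ^+ 2)^-1 <= eta.
  by rewrite -e3; apply: lerD.
by move: eta0; clear => p q; lra.
Qed.

(** By periodicity x is brought within one step of a grid point, and each of three errors is at most
    eta / 3: the oscillation of g, the error at the grid point, and the oscillation of the wave,
    whose coefficients and number of terms are bounded independently of [K]. *)
Lemma wave_approx (eta : R) : 0 < eta -> exists K0 : nat, forall K, (K0 <= K)%N ->
  forall x, normc (g x - wave (coef K) (spectrum K) x) <= eta.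
Proof.
move=> eta0; have e3 : 0 < eta / 3 by rewrite divr_gt0.
have [K1 H1] := wave_approx_grid e3.
have [d1 d10 uc] := guc e3.
have [m mP] := size_sphere_le lam.
have B0 : 0 <= B by apply: le_trans (gB (0, 0, 0)); apply: normc_ge0.
have l0 : 0 <= lam by apply: le_trans l1.
pose d2 := eta / 3 / (m%:R * (B * (3 * lam)) + 1).
have den0 : 0 < m%:R * (B * (3 * lam)) + 1 by rewrite ltr_wpDl// !mulr_ge0.
have d20 : 0 < d2 by rewrite divr_gt0.
have dd : 0 < Num.min d1 d2 by rewrite lt_min d10.
have [K2 H2] := step_small dd.
exists (maxn K1 K2) => K; rewrite geq_max => /andP[K1K K2K] x.
have := H2 K K2K; rewrite le_min => /andP[hd1 hd2].
pose F (x : R * R * R) := g x - wave (coef K) (spectrum K) x.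
have wper (y z : R * R * R) : (forall n, exists m : int,
    dot3 (int3 n) y = dot3 (int3 n) z + m%:~R * (2 * pi)) ->
    wave (coef K) (spectrum K) y = wave (coef K) (spectrum K) z.
  move=> xy; apply: eq_bigr => n _; have [k ->] := xy n.
  by rewrite cisD cis2pi_int mulr1.
have F1 a b c : F (a + 2 * pi, b, c) = F (a, b, c).
  rewrite /F g1; congr (_ - _); apply: wper => n; exists n.1.1.
  by rewrite /dot3 /=; ring.
have F2 a b c : F (a, b + 2 * pi, c) = F (a, b, c).
  rewrite /F g2; congr (_ - _); apply: wper => n; exists n.1.2.
  by rewrite /dot3 /=; ring.
have F3 a b c : F (a, b, c + 2 * pi) = F (a, b, c).
  rewrite /F g3; congr (_ - _); apply: wper => n; exists n.2.
  by rewrite /dot3 /=; ring.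
case: x => [[a b] c]; rewrite -/(F (a, b, c)).
have [a' a'p ->] := @periodic_reduce _ (fun a => F (a, b, c)) a (fun a => F1 a b c).
have [b' b'p ->] := @periodic_reduce _ (fun b => F (a', b, c)) b (fun b => F2 a' b c).
have [c' c'p ->] := @periodic_reduce _ (fun c => F (a', b', c)) c (F3 a' b').
have [i1 h1] := grid_round K a'p; have [i2 h2] := grid_round K b'p.
have [i3 h3] := grid_round K c'p.
pose j : grid K := (i1, i2, i3).
have nj d : step K <= d -> near3 d (a', b', c') (gpt j).
  by move=> hd; split; apply: le_trans hd.
have -> : F (a', b', c') = (g (a', b', c') - g (gpt j)) +
   (g (gpt j) - wave (coef K) (spectrum K) (gpt j)) +
   - (wave (coef K) (spectrum K) (a', b', c') - wave (coef K) (spectrum K) (gpt j)).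
  by rewrite /F; ring.
have -> : eta = eta / 3 + eta / 3 + eta / 3 by field.
apply: le_trans (le_normcD _ _) _; apply: lerD.
  apply: le_trans (le_normcD _ _) _; apply: lerD; last exact: H1.
  exact/uc/nj.
rewrite normcN.
apply: le_trans (wave_near l0 (@spectrum_on_sphere K) (normc_coef_le K) (nj _ hd2)) _.
apply: le_trans (_ : _ <= m%:R * (B * (3 * lam * d2))) _.
  apply: ler_wpM2r; first by apply: mulr_ge0 => //; apply: mulr_ge0 (ltW d20); apply: mulr_ge0.
  rewrite ler_nat; apply: mP; first exact: uniq_spectrum.
  exact: spectrum_on_sphere.
have -> : m%:R * (B * (3 * lam * d2)) = m%:R * (B * (3 * lam)) * d2 by ring.
rewrite /d2 mulrCA ler_piMr ?(ltW e3)// ler_pdivrMr// mul1r lerDl//.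
Qed.

End wave_approximation.

(** * Eigenfunctions *)

Section periodic_functions.
Context {R : realType}.
Implicit Types (f : 'rV[R]_3 -> R).

Definition periodic3 (T : Type) (f : 'rV[R]_3 -> T) : Prop :=
  forall (x : 'rV[R]_3) (m : 'rV[int]_3), f (x + (2 * pi) *: map_mx intr m) = f x.

Definition cube : set 'rV[R]_3 := [set v | forall i, `[0, 2 * pi]%classic (v ord0 i)].

Lemma compact_cube : compact cube.
Proof.
by apply: (@rV_compact R 3 (fun=> `[0, 2 * pi]%classic)) => _; exact: segment_compact.
Qed.

Lemma reduce_to_cube (x : 'rV[R]_3) :
  exists m : 'rV[int]_3, cube (x + (2 * pi) *: map_mx intr m).
Proof.
have p0 : 0 < 2 * pi :> R by rewrite mulr_gt0// pi_gt0.
exists (\row_i - Num.floor (x ord0 i / (2 * pi))) => i /=.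
rewrite !mxE in_itv /= intrN mulrN subr_ge0.
have h1 := real_floor_le (num_real (x ord0 i / (2 * pi))).
have h2 := real_floorD1_gt (num_real (x ord0 i / (2 * pi))).
rewrite ler_pdivlMr// in h1; rewrite ltr_pdivrMr// intrD mulrDl mul1r in h2.
by rewrite mulrC h1 /= lerBlDl ltW.
Qed.

(** Compactness of the cube gives a radius valid at every x in it, with y free to leave the cube. A
    general pair is then moved by one common period. *)
Lemma periodic_unif_continuous f : continuous f -> periodic3 f ->
  forall eta : R, 0 < eta -> exists2 d : R, 0 < d &
    forall x y, ball x d y -> `|f x - f y| <= eta.
Proof.
move=> cf pf eta eta0.
pose P (d : R) (x : 'rV[R]_3) := forall y, ball x d y -> `|f x - f y| <= eta.
have : \forall d \near 0^'+, cube `<=` P d.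
  apply: (proj1 (compact_near_coveringP cube) compact_cube R (0^'+) P) => x _.
  have e2 : 0 < eta / 2 by rewrite divr_gt0.
  have := cf x; move=> /cvgrPdist_lt /(_ _ e2) /nbhs_ballP[r /= r0 H].
  have r2 : 0 < r / 2 by rewrite divr_gt0.
  exists (ball x (r / 2), [set d | d < r / 2]).
    split; first exact: nbhsx_ballx.
    exact: nbhs_right_lt.
  move=> [x' d] [/= xx' dr] y x'y.
  have xr : `|f x - f x'| < eta / 2 by apply: H; apply: le_ball xx'; lra.
  have yr : `|f x - f y| < eta / 2.
    apply: H; have := ball_triangle xx' (le_ball (ltW dr) x'y).
    by rewrite -splitr.
  have -> : f x' - f y = (f x - f y) - (f x - f x') by ring.
  by apply: le_trans (ler_normB _ _) _; clear -xr yr; lra.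
move=> H; near (0 : R)^'+ => d.
have dP : cube `<=` P d by near: d.
have d0 : 0 < d by near: d; exact: nbhs_right_gt.
exists d => // x y xy; have [m cm] := reduce_to_cube x.
rewrite -(pf x m) -(pf y m); apply: dP => //; case: xy => _ xy; split => // i j.
have := xy i j; rewrite /ball /= !mxE.
by have -> : forall a b c : R, a + c - (b + c) = a - b by move=> *; ring.
Unshelve. all: by end_near. Qed.

Lemma periodic_bounded f : continuous f -> periodic3 f ->
  exists B : R, forall x, `|f x| <= B.
Proof.
move=> cf pf.
have : compact (f @` cube).
  by apply: continuous_compact compact_cube; apply: continuous_subspaceT.
move=> /compact_bounded[M [_ HM]]; exists (M + 1) => x.
have [m cm] := reduce_to_cube x; rewrite -(pf x m).
by apply: (HM (M + 1)); [rewrite ltrDl|exists (x + 2 * pi *: map_mx intr m)].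
Qed.

Lemma derive_periodic f (v : 'rV[R]_3) : periodic3 f -> periodic3 ('D_v f).
Proof.
move=> pf x m; set T := (2 * pi) *: _.
have E : (fun h => h^-1 *: ((f \o shift (x + T)) (h *: v) - f (x + T))) =
         (fun h => h^-1 *: ((f \o shift x) (h *: v) - f x)).
  by apply/funext => h /=; rewrite addrA !pf.
by rewrite /derive E.
Qed.

Lemma is_derive_line f (x v : 'rV[R]_3) (s : R) : (forall y, derivable f y v) ->
  is_derive s 1 (fun s : R => f (x + s *: v)) ('D_v f (x + s *: v)).
Proof.
move=> df.
have E : (fun h : R => h^-1 *: (((fun s : R => f (x + s *: v)) \o shift s) (h *: 1) -
     f (x + s *: v))) =
   (fun h : R => h^-1 *: ((f \o shift (x + s *: v)) (h *: v) - f (x + s *: v))).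
  apply/funext => h /=; congr (_ *: (f _ - _)).
  by rewrite scalerDl [h%:A]mulr1 addrCA addrC.
by split; [rewrite /derivable E; exact: df|rewrite /derive E].
Qed.

(** Only two derivatives are available, so the mean value theorem is used twice on symmetric
    differences: for [g1] between -s and s, then for [phi] between 0 and d. *)
Lemma second_difference f (v : 'rV[R]_3) (x : 'rV[R]_3) (d om : R) :
  (forall y, derivable f y v) -> (forall y, derivable ('D_v f) y v) -> 0 < d ->
  (forall s : R, `|s| <= d -> `|'D_v ('D_v f) (x + s *: v) - 'D_v ('D_v f) x| <= om) ->
  `|f (x + d *: v) + f (x + (- d) *: v) - 2 * f x - d ^+ 2 * 'D_v ('D_v f) x|
    <= 2 * d ^+ 2 * om.
Proof.
move=> df ddf d0 H; set A : R := 'D_v ('D_v f) x in H *.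
have om0 : 0 <= om.
  by apply: le_trans (H 0 _) => //; rewrite normr0 ltW.
pose g (s : R) : R := f (x + s *: v); pose g1 (s : R) : R := 'D_v f (x + s *: v).
pose g2 (s : R) : R := 'D_v ('D_v f) (x + s *: v).
have Dg (s : R) : is_derive s 1 g (g1 s) by apply: is_derive_line.
have Dg1 (s : R) : is_derive s 1 g1 (g2 s) by apply: is_derive_line.
have Dgc (h h1 : R -> R) (a b : R) : (forall s : R, is_derive s 1 h (h1 s)) ->
    {within `[a, b], continuous h}.
  move=> Dh; apply: continuous_subspaceT => y; apply: differentiable_continuous.
  by apply/derivable1_diffP; have [] := Dh y.
have G1 s : 0 < s -> s <= d -> `|g1 s - g1 (- s) - 2 * s * A| <= 2 * s * om.
  move=> s0 sd; have ss : - s < s by lra.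
  have [c + ->] := MVT ss (fun y _ => Dg1 y) (Dgc _ _ _ _ Dg1).
  rewrite in_itv /= => /andP[c1 c2].
  have -> : g2 c * (s - - s) - 2 * s * A = (g2 c - A) * (2 * s) by ring.
  rewrite normrM mulrC [`|2 * s|]ger0_norm ?mulr_ge0 ?(ltW s0)// ler_wpM2l//.
    by rewrite mulr_ge0// ltW.
  by apply: H; rewrite ler_norml; apply/andP; split; lra.
(* The quadratic term is subtracted beforehand, so that the derivative of [phi] is exactly the
   quantity bounded in [G1]. *)
pose phi (s : R) := g s + g (- s) - s ^+ 2 * A.
pose phi1 (s : R) := g1 s - g1 (- s) - 2 * s * A.
have Dphi (s : R) : is_derive s 1 phi (phi1 s).
  have D1 : is_derive s 1 (g \o -%R) (g1 (- s) * - 1).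
    by apply: is_derive1_comp; exact: is_deriveNid.
  have D2 : is_derive s 1 (A \*: (@id R ^+ 2)) (A *: ((2%:R * s ^+ 1) *: 1)).
    exact: is_deriveZ (is_deriveX 2 (is_derive_id s (1 : R))).
  have D3 := is_deriveB (is_deriveD (Dg s) D1) D2.
  have -> : phi = g + (g \o -%R) - A \*: (@id R ^+ 2).
    by apply/funext => y; rewrite /phi [y ^+ 2 * A]mulrC.
  apply: (is_derive_eq D3); rewrite /phi1 /GRing.scale /=; ring.
have [c + e] := MVT d0 (fun y _ => Dphi y) (Dgc _ _ _ _ Dphi).
rewrite in_itv /= => /andP[c0 cd].
have -> : f (x + d *: v) + f (x + (- d) *: v) - 2 * f x - d ^+ 2 * A = phi d - phi 0.
  by rewrite /phi /g oppr0 scale0r addr0; ring.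
rewrite e subr0 normrM (gtr0_norm d0).
have := G1 c c0 (ltW cd); rewrite -/(phi1 c) => h.
apply: le_trans (ler_wpM2r (ltW d0) h) _.
have -> : 2 * d ^+ 2 * om = 2 * d * om * d by ring.
apply: ler_wpM2r; first exact: ltW.
by apply: ler_wpM2r => //; rewrite ler_pM2l// ltW.
Qed.

End periodic_functions.

Section eigenfunctions.
Context {R : realType}.

Lemma vec3_add (a b c u : R) :
  ((vec3 (a + u, b, c) = vec3 (a, b, c) + u *: delta_mx 0 0)%R *
   (vec3 (a, b + u, c) = vec3 (a, b, c) + u *: delta_mx 0 1)%R *
   (vec3 (a, b, c + u) = vec3 (a, b, c) + u *: delta_mx 0 2%:R)%R)%type.
Proof.
have [k1 k2 k3] := vec3E (a, b, c).
have [l1 l2 l3] := vec3E (a + u, b, c); have [m1 m2 m3] := vec3E (a, b + u, c).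
have [n1 n2 n3] := vec3E (a, b, c + u); do !split; apply/rowP => i.
all: rewrite [RHS]mxE [X in _ = _ + X]mxE [X in _ = _ + _ * X]mxE.
all: by have [->|->|->] := ord3P i; rewrite ?(k1, k2, k3, l1, l2, l3, m1, m2, m3, n1, n2, n3) /=
  ?mulr1 ?mulr0 ?addr0.
Qed.

Lemma near3_ball (d d' : R) (x y : R * R * R) : d < d' -> near3 d x y ->
  ball (vec3 x) d' (vec3 y).
Proof.
move=> dd [h1 h2 h3]; have d0 : 0 <= d by apply: le_trans h1.
split; first exact: le_lt_trans dd.
move=> i j; rewrite /ball /= (ord1 i).
have [a1 a2 a3] := vec3E x; have [b1 b2 b3] := vec3E y.
by have [->|->|->] := ord3P j; rewrite ?(a1, a2, a3, b1, b2, b3);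
  apply: le_lt_trans dd.
Qed.

Lemma normc_le_ReIm (z : R[i]) : normc z <= `|complex.Re z| + `|complex.Im z|.
Proof.
rewrite -ler_sqr ?nnegrE ?normc_ge0 ?addr_ge0// normc_sqr sqrrD !real_normK ?num_real//.
by rewrite /sqn -addrA lerD2l lerDr mulrn_wge0// mulr_ge0.
Qed.

Section one_eigenfunction.
Variables (lam : R) (e : 'rV[R]_3 -> R[i]).
Hypothesis eig : eigenfunction lam e.

Let g x := e (@vec3 R x).
Let f1 := @complex.Re R \o e.
Let f2 := @complex.Im R \o e.

Lemma eig_periodic3 : periodic3 e.
Proof. by have [] := eig. Qed.

Lemma lift_periodic1 x y z : g (x + 2 * pi, y, z) = g (x, y, z).
Proof.
have := eig_periodic3 (vec3 (x, y, z)) (delta_mx 0 0).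
by rewrite map_delta_mx -(vec3_add _ _ _ _).1.1.
Qed.

Lemma lift_periodic2 x y z : g (x, y + 2 * pi, z) = g (x, y, z).
Proof.
have := eig_periodic3 (vec3 (x, y, z)) (delta_mx 0 1).
by rewrite map_delta_mx -(vec3_add _ _ _ _).1.2.
Qed.

Lemma lift_periodic3 x y z : g (x, y, z + 2 * pi) = g (x, y, z).
Proof.
have := eig_periodic3 (vec3 (x, y, z)) (delta_mx 0 2%:R).
by rewrite map_delta_mx -(vec3_add _ _ _ _).2.
Qed.

Let p1 : periodic3 f1.
Proof. by move=> x m; rewrite /f1 /= eig_periodic3. Qed.

Let p2 : periodic3 f2.
Proof. by move=> x m; rewrite /f2 /= eig_periodic3. Qed.

Lemma lift_bounded : exists B : R, forall x, normc (g x) <= B.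
Proof.
have [_ [c1 _] [c2 _] _] := eig.
have [B1 H1] := periodic_bounded c1 p1; have [B2 H2] := periodic_bounded c2 p2.
exists (B1 + B2) => x; apply: le_trans (normc_le_ReIm _) _.
by apply: lerD; [exact: H1|exact: H2].
Qed.

Lemma lift_unif_continuous (eta : R) : 0 < eta -> exists2 d : R, 0 < d &
  forall x y, near3 d x y -> normc (g x - g y) <= eta.
Proof.
move=> eta0; have [_ [c1 _] [c2 _] _] := eig.
have e2 : 0 < eta / 2 by rewrite divr_gt0.
have [d1 d10 H1] := periodic_unif_continuous c1 p1 e2.
have [d2 d20 H2] := periodic_unif_continuous c2 p2 e2.
exists (Num.min d1 d2 / 2); first by rewrite divr_gt0// lt_min d10.
move=> x y xy; apply: le_trans (normc_le_ReIm _) _.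
have dd : Num.min d1 d2 / 2 < Num.min d1 d2.
  by rewrite ltr_pdivrMr// mulr_natr mulr2n ltrDl lt_min d10.
have b := near3_ball dd xy.
rewrite [leRHS]splitr; apply: lerD.
  have := H1 _ _ (le_ball _ b); rewrite ge_min lexx => /(_ isT).
  by rewrite /f1 /= /g; case: (e _) => a1 a2; case: (e _).
have := H2 _ _ (le_ball _ b); rewrite ge_min lexx orbT => /(_ isT).
by rewrite /f2 /= /g; case: (e _) => a1 a2; case: (e _).
Qed.

Lemma Ck2_second_difference (f : 'rV[R]_3 -> R) (om : R) : Ck 2 f -> periodic3 f ->
  0 < om -> exists2 d0 : R, 0 < d0 & forall (d : R) (x : 'rV[R]_3) (i : 'I_3), 0 < d <= d0 ->
    `|(d ^+ 2)^-1 * (f (x + d *: delta_mx 0 i) + f (x + (- d) *: delta_mx 0 i) - 2 * f x)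
      - 'D_(delta_mx 0 i) ('D_(delta_mx 0 i) f) x| <= om.
Proof.
move=> [cf Hf] pf om0; have om2 : 0 < om / 2 by rewrite divr_gt0.
have U i : exists2 d0 : R, 0 < d0 & forall x y, ball x d0 y ->
   `|'D_(delta_mx 0 i) ('D_(delta_mx 0 i) f) x
     - 'D_(delta_mx 0 i) ('D_(delta_mx 0 i) f) y| <= om / 2.
  have [df [_ /(_ i)[ddf [cdd _]]]] := Hf i.
  exact: periodic_unif_continuous cdd (derive_periodic _ (derive_periodic _ pf)) _ om2.
have [a a0 Ha] := U 0; have [b b0 Hb] := U 1; have [c c0 Hc] := U 2%:R.
pose d0 := Num.min a (Num.min b c).
have d00 : 0 < d0 by rewrite !lt_min a0 b0.
exists (d0 / 2); first by rewrite divr_gt0.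
move=> d x i /andP[dpos dd].
have H y z : ball y d0 z -> `|'D_(delta_mx 0 i) ('D_(delta_mx 0 i) f) y
     - 'D_(delta_mx 0 i) ('D_(delta_mx 0 i) f) z| <= om / 2.
  move=> yz; have [->|->|->] := ord3P i.
  - by apply: Ha; apply: le_ball yz; rewrite ge_min lexx.
  - by apply: Hb; apply: le_ball yz; rewrite !ge_min lexx orbT.
  - by apply: Hc; apply: le_ball yz; rewrite !ge_min lexx !orbT.
have [df [_ /(_ i)[ddf _]]] := Hf i.
have S := @second_difference R f (delta_mx 0 i) x d (om / 2) df ddf dpos.
have {}S := S _; rewrite -subr_ge0.
have d2 : 0 < d ^+ 2 by rewrite exprn_gt0.
rewrite subr_ge0 -(ler_pM2l d2) -[X in X * _](gtr0_norm d2) -normrM.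
rewrite mulrBr mulrA mulfV ?gt_eqF// mul1r.
have -> : d ^+ 2 * om = 2 * d ^+ 2 * (om / 2) by field.
apply: S => s sd; rewrite distrC; apply: H.
split => // k j; rewrite /ball /= !mxE opprD addrA subrr add0r normrN normrM.
apply: le_lt_trans (_ : d < d0); last by clear -dd dpos d00; lra.
apply: le_trans sd; rewrite ler_piMr//.
by case: (_ && _); rewrite ?normr1 ?normr0.
Qed.

Lemma lift_residual (eta : R) : 0 < eta -> exists2 d0 : R, 0 < d0 &
  forall (d : R) x, 0 < d <= d0 -> normc (discrete_residual g lam d x) <= eta.
Proof.
move=> eta0; have e6 : 0 < eta / 6 by rewrite divr_gt0.
have [_ C1 C2 E] := eig.
have [a a0 Ha] := Ck2_second_difference C1 p1 e6.
have [b b0 Hb] := Ck2_second_difference C2 p2 e6.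
exists (Num.min a b); first by rewrite lt_min a0.
move=> d x /andP[d0]; rewrite le_min => /andP[da db].
have := Ha d (vec3 x) _; rewrite d0 da => {}Ha.
have := Hb d (vec3 x) _; rewrite d0 db => {}Hb.
have Ex := E (vec3 x).
have L1 : - laplacian f1 (vec3 x) = lam ^+ 2 * f1 (vec3 x).
  have := congr1 (@complex.Re R) Ex; rewrite /claplacian /= -/f1.
  by rewrite /f1 /=; case: (e _) => u v /=; rewrite mul0r subr0.
have L2 : - laplacian f2 (vec3 x) = lam ^+ 2 * f2 (vec3 x).
  have := congr1 (@complex.Im R) Ex; rewrite /claplacian /= -/f2.
  by rewrite /f2 /=; case: (e _) => u v /=; rewrite mul0r addr0.
rewrite /laplacian sum_ord3 in L1; rewrite /laplacian sum_ord3 in L2.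
case: x Ha Hb L1 L2 {Ex} => [[x y] z] Ha Hb L1 L2.
apply: le_trans (normc_le_ReIm _) _.
have gE p : g p = f1 (vec3 p) +i* f2 (vec3 p) by rewrite /g /f1 /f2 /=; case: (e _).
rewrite /discrete_residual /shifted /= !addr0 !gE !vec3_add.
have -> : (2 : R[i]) = (2 : R)%:C by rewrite rmorph_nat.
move: (Ha 0 isT) (Ha 1 isT) (Ha 2%:R isT) (Hb 0 isT) (Hb 1 isT) (Hb 2%:R isT).
have three (D a1 a2 a3 l1 l2 l3 L f : R) : `|D * a1 - l1| <= eta / 6 ->
    `|D * a2 - l2| <= eta / 6 -> `|D * a3 - l3| <= eta / 6 ->
    - (l1 + l2 + l3) = L * f -> `|D * (a1 + a2 + a3) + L * f| <= eta / 2.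
  move=> h1 h2 h3 <-; have -> : D * (a1 + a2 + a3) - (l1 + l2 + l3) =
    (D * a1 - l1) + (D * a2 - l2) + (D * a3 - l3) by ring.
  have -> : eta / 2 = eta / 6 + eta / 6 + eta / 6 by field.
  by rewrite (le_trans (ler_normD _ _))// lerD// (le_trans (ler_normD _ _))// lerD.
move=> A1 A2 A3 B1 B2 B3.
have R1 := three _ _ _ _ _ _ _ _ _ A1 A2 A3 L1.
have R2 := three _ _ _ _ _ _ _ _ _ B1 B2 B3 L2.
rewrite [leRHS]splitr; apply: lerD.
  rewrite (_ : complex.Re _ = (d ^+ 2)^-1 * (f1 (vec3 (x, y, z) + d *: delta_mx 0 0)
    + f1 (vec3 (x, y, z) + - d *: delta_mx 0 0) - 2 * f1 (vec3 (x, y, z))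
    + (f1 (vec3 (x, y, z) + d *: delta_mx 0 1)
    + f1 (vec3 (x, y, z) + - d *: delta_mx 0 1) - 2 * f1 (vec3 (x, y, z)))
    + (f1 (vec3 (x, y, z) + d *: delta_mx 0 2%:R)
    + f1 (vec3 (x, y, z) + - d *: delta_mx 0 2%:R) - 2 * f1 (vec3 (x, y, z))))
    + lam ^+ 2 * f1 (vec3 (x, y, z)))//.
  by rewrite [LHS]/=; ring.
rewrite (_ : complex.Im _ = (d ^+ 2)^-1 * (f2 (vec3 (x, y, z) + d *: delta_mx 0 0)
  + f2 (vec3 (x, y, z) + - d *: delta_mx 0 0) - 2 * f2 (vec3 (x, y, z))
  + (f2 (vec3 (x, y, z) + d *: delta_mx 0 1)
  + f2 (vec3 (x, y, z) + - d *: delta_mx 0 1) - 2 * f2 (vec3 (x, y, z)))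
  + (f2 (vec3 (x, y, z) + d *: delta_mx 0 2%:R)
  + f2 (vec3 (x, y, z) + - d *: delta_mx 0 2%:R) - 2 * f2 (vec3 (x, y, z))))
  + lam ^+ 2 * f2 (vec3 (x, y, z)))//.
by rewrite [LHS]/=; ring.
Qed.

End one_eigenfunction.
End eigenfunctions.

(** * Restriction estimates *)

Section lower_sums.
Context {d : measure_display} {T : measurableType d} {R : realType}.
Variable mu : {measure set T -> \bar R}.
Local Open Scope ereal_scope.

(** The integral is a supremum over simple functions below the integrand, and this supremum is
    monotone in any nonnegative integrand. *)
Lemma le_integral_nonmeasurable (g f : T -> \bar R) : (forall x, 0 <= g x) ->
  (forall x, g x <= f x) -> \int[mu]_x g x <= \int[mu]_x f x.
Proof.
move=> g0 gf; rewrite !ge0_integralTE//; last by move=> x; apply: le_trans (gf x).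
apply: ge_ereal_sup => _ [h /= hg <-]; apply: ereal_sup_ubound; exists h => //= x.
exact: le_trans (hg x) (gf x).
Qed.

Lemma lower_sum_le_integral (I : finType) (Q : I -> set T) (m : I -> R) (f : T -> \bar R) :
  (forall i, measurable (Q i)) -> (forall i j x, Q i x -> Q j x -> i = j) ->
  (forall i, (0 <= m i)%R) -> (forall x, 0 <= f x) ->
  (forall i x, Q i x -> (m i)%:E <= f x) ->
  \sum_i (m i)%:E * mu (Q i) <= \int[mu]_x f x.
Proof.
move=> mQ dQ m0 f0 mf.
pose g x := \sum_(i <- index_enum I) (m i)%:E * (\1_(Q i) x)%:E.
have g0 i x : 0 <= (m i)%:E * (\1_(Q i) x)%:E by rewrite mule_ge0 ?lee_fin.
have mi i : measurable_fun setT (fun x => (\1_(Q i) x)%:E).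
  by apply/measurable_EFinP; exact: measurable_indic.
have -> : \sum_i (m i)%:E * mu (Q i) = \int[mu]_x g x.
  rewrite ge0_integral_sum//; last by move=> i; apply: measurable_funeM.
  by apply: eq_bigr => i _; rewrite ge0_integralZl_EFin// integral_indic// setIT.
apply: le_integral_nonmeasurable => x; first by apply: sume_ge0 => i _.
have [[i Qi]|nQ] := pselect (exists i, Q i x).
  rewrite /g (bigD1 i)//= indicE mem_set// mule1 big1 ?adde0 ?mf// => j ji.
  rewrite indicE memNset ?mule0// => Qj; move: ji; rewrite (dQ _ _ _ Qi Qj).
  by rewrite eqxx.
rewrite /g big1 ?f0// => i _; rewrite indicE memNset ?mule0// => Qi.
by apply: nQ; exists i.
Qed.

End lower_sums.

Section norms.
Context {d : measure_display} {T : measurableType d} {R : realType}.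
Variable mu : {measure set T -> \bar R}.

Lemma L2normE (D : set T) (g : T -> R[i]) :
  L2norm mu D g = ((\int[mu]_x (((fun x => sqn (g x)) \_ D) x)%:E) `^ 2^-1)%E.
Proof.
rewrite /L2norm unlock; congr (_ `^ _)%E.
apply: eq_integral => x _ /=; rewrite patchE [in RHS]patchE.
case: ifP => _; rewrite /= ?poweR_EFin; last by rewrite normr0 powR0 ?pnatr_eq0.
by rewrite ger0_norm ?normc_ge0// -normc_sqr powR_mulrn// normc_ge0.
Qed.

End norms.

(** * Lower Riemann sums on the torus *)

Section torus_lower_sum.
Context {R : realType}.

(** Half-open, because lower sums require disjoint cells. *)
Definition cell1 (K j : nat) : set R := `[step K * j%:R, step K * (j%:R + 1)[%classic.

Lemma cell1_inj K i j (x : R) : cell1 K i x -> cell1 K j x -> i = j.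
Proof.
rewrite /cell1 /= !in_itv /= => /andP[i1 i2] /andP[j1 j2].
have h := @step_gt0 R K.
have := le_lt_trans i1 j2; have := le_lt_trans j1 i2; rewrite !ltr_pM2l// !natr1 !ltr_nat.
by clear; lia.
Qed.

Lemma lebesgue_cell1 K j : lebesgue_measure (cell1 K j) = (step K : R)%:E.
Proof.
have h := @step_gt0 R K.
rewrite lebesgue_measure_itv /= lte_fin ltr_pM2l// ltrDl ltr01.
by rewrite -EFinB mulrDr mulr1 addrC addKr.
Qed.

Lemma cell1_sub K (j : 'I_(gridn K)) (x : R) : cell1 K j x ->
  `[0, 2 * pi[%classic x /\ `|step K * j%:R - x| <= step K.
Proof.
have h := @step_gt0 R K.
rewrite /cell1 /= !in_itv /= => /andP[j1 j2]; split; last first.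
  by rewrite distrC ger0_norm ?subr_ge0// lerBlDl; apply: ltW; rewrite -{2}[step K]mulr1 -mulrDr.
apply/andP; split; first by apply: le_trans j1; rewrite mulr_ge0// ltW.
apply: lt_le_trans j2 _; rewrite -(stepJ K) [leRHS]mulrC ler_pM2l// natr1 ler_nat.
exact: ltn_ord.
Qed.

Definition torus_square_integral (g : R * R * R -> R[i]) : \bar R :=
  (\int[(lebesgue_measure \x lebesgue_measure) \x lebesgue_measure]_x
    (((fun x => sqn (g x)) \_ ((`[0%R, (2 * pi)%R[ `*` `[0%R, (2 * pi)%R[) `*` `[0%R, (2 * pi)%R[)) x)%:E)%E.

Lemma torus_square_integral_ge0 g : (0 <= torus_square_integral g)%E.
Proof.
apply: integral_ge0 => x _; rewrite lee_fin patchE; case: ifP => // _.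
exact: sqn_ge0.
Qed.

Variables (g : R * R * R -> R[i]) (B : R).
Hypothesis gB : forall x, normc (g x) <= B.
Hypothesis guc : forall eta : R, 0 < eta -> exists2 d : R, 0 < d &
  forall x y, near3 d x y -> normc (g x - g y) <= eta.

Lemma sqn_sub_le (x y : R * R * R) (eta : R) : normc (g x - g y) <= eta ->
  sqn (g x) - 2 * B * eta <= sqn (g y).
Proof.
move=> xy; have a := gB x; have b := gB y; rewrite -!normc_sqr.
have a0 := normc_ge0 (g x); have b0 := normc_ge0 (g y).
have t : normc (g x) <= normc (g y) + eta.
  have -> : g x = g y + (g x - g y) by rewrite addrC subrK.
  by apply: le_trans (le_normcD _ _) _; rewrite lerD2l.
have e0 : 0 <= eta by apply: le_trans xy; apply: normc_ge0.
move: a b a0 b0 t e0; clear; move: (normc (g x)) (normc (g y)) => u v *.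
have [uv|uv] := leP u v.
  by apply: le_trans (_ : u ^+ 2 <= _); [rewrite gerBl !mulr_ge0//; lra|rewrite lerXn2r ?nnegrE].
have : (u - v) * (u + v) <= eta * (2 * B) by apply: ler_pM; lra.
by rewrite -subr_sqr; lra.
Qed.

Lemma torus_lower_sum (eta : R) : 0 < eta -> exists K0 : nat, forall K, (K0 <= K)%N ->
  ((step K ^+ 3 * \sum_(j : grid K) sqn (g (gpt j)))%:E
   <= torus_square_integral g + eta%:E)%E.
Proof.
move=> eta0.
have B0 : 0 <= B by apply: le_trans (gB (0, 0, 0)); apply: normc_ge0.
have p0 : 0 < (2 * pi : R) ^+ 3 by rewrite exprn_gt0// mulr_gt0// pi_gt0.
pose om := eta / (2 * pi) ^+ 3; have om0 : 0 < om by rewrite divr_gt0.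
pose e1 := om / (2 * B + 1).
have B1 : 0 < 2 * B + 1 by rewrite ltr_wpDl// mulr_ge0.
have e10 : 0 < e1 by rewrite divr_gt0.
have Be : 2 * B * e1 <= om.
  by rewrite /e1 mulrCA ler_piMr ?(ltW om0)// ler_pdivrMr// mul1r lerDl.
have [d d0 uc] := guc e10; have [K0 KP] := step_small d0.
exists K0 => K KK.
have h0 := @step_gt0 R K.
(* A lower bound for |g|^2 on the cell, truncated at 0 since lower sums need nonnegative values. The
   loss [om] per cell adds up to [eta] over the volume (2 pi)^3. *)
pose m (j : grid K) := Num.max 0 (sqn (g (gpt j)) - om).
pose Q (j : grid K) : set (R * R * R) :=
  (cell1 K j.1.1 `*` cell1 K j.1.2) `*` cell1 K j.2.
have mC k : @measurable _ (measurableTypeR R) (cell1 K k) by exact: measurable_itv.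
have mQ j := measurableX (measurableX (mC j.1.1) (mC j.1.2)) (mC j.2).
have QE j : ((lebesgue_measure \x lebesgue_measure) \x lebesgue_measure)%E (Q j) =
    (step K ^+ 3)%:E.
  rewrite (product_measure1E _ _ (measurableX (mC j.1.1) (mC j.1.2)) (mC j.2)).
  rewrite [X in (X * _)%E](product_measure1E _ _ (mC _) (mC _)).
  transitivity ((step K : R)%:E * (step K)%:E * (step K)%:E)%E.
    by congr (_ * _ * _)%E; exact: lebesgue_cell1.
  by rewrite -!EFinM exprSr expr2.
apply: (@le_trans _ _ (\sum_j (m j)%:E *
    ((lebesgue_measure \x lebesgue_measure) \x lebesgue_measure)%E (Q j) + eta%:E)%E).
  under [in leRHS]eq_bigr do rewrite QE -EFinM.
  rewrite sumEFin -EFinD lee_fin -mulr_suml mulrC -lerBlDr.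
  have -> : eta = (\sum_(j : grid K) om) * step K ^+ 3.
    by rewrite sum_grid_const mulrAC -exprMn stepJ mulrC divfK ?gt_eqF.
  rewrite -mulrBl -sumrB; apply: ler_wpM2r; first by rewrite exprn_ge0// ltW.
  by apply: ler_sum => j _; rewrite le_max lexx orbT.
rewrite leeD2r//; apply: lower_sum_le_integral => //; first by move=> j; apply: measurableX (measurableX _ _) _; exact: mC.
- move=> [[a b] c] [[a' b'] c'] [[x y] z] [[/= a1 b1] c1] [[/= a2 b2] c2].
  by congr (_, _, _); apply/val_inj; [exact: cell1_inj a1 a2|exact: cell1_inj b1 b2|
    exact: cell1_inj c1 c2].
- by move=> j; rewrite le_max lexx.
- by move=> x; rewrite lee_fin patchE; case: ifP => // _; apply: sqn_ge0.
move=> j x [[/= /cell1_sub[x1 n1] /cell1_sub[x2 n2]] /cell1_sub[x3 n3]].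
rewrite patchE mem_set//= lee_fin ge_max sqn_ge0 /=.
apply: le_trans (sqn_sub_le (uc (gpt j) x _)).
  by rewrite lerD2l lerN2.
have hd := KP K KK.
by split; apply: le_trans hd.
Qed.

End torus_lower_sum.

Section geodesics.
Context {R : realType}.
Implicit Types (t v w : R * R * R) (p c x : 'rV[R]_3).

Lemma triple_eq v w : v.1.1 = w.1.1 -> v.1.2 = w.1.2 -> v.2 = w.2 -> v = w.
Proof. by case: v w => [[? ?] ?] [[? ?] ?] /= -> -> ->. Qed.

Lemma eigenfunction_wave (lam : R) (e : 'rV[R]_3 -> R[i]) (eta : R) :
  1 <= lam -> eigenfunction lam e -> 0 < eta ->
  exists (s : seq Z3) (c : Z3 -> R[i]) (B : R),
  [/\ uniq s, on_sphere lam s, forall n, normc (c n) <= B,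
      forall x : R * R * R, normc (e (vec3 x) - wave c s x) <= eta &
      ((\sum_(n <- s) sqn (c n))%:E <= torus_square_integral (e \o @vec3 R) + eta%:E)%E].
Proof.
move=> l1 eig eta0; pose g (y : R * R * R) := e (vec3 y).
have [B gB] := lift_bounded eig.
have [K1 H1] := wave_approx l1 (lift_periodic1 eig) (lift_periodic2 eig)
  (lift_periodic3 eig) gB (lift_unif_continuous eig) (lift_residual eig) eta0.
have [K2 H2] := torus_lower_sum gB (lift_unif_continuous eig) eta0.
pose K := maxn K1 K2.
exists (spectrum lam K), (coef g K), B; split.
- exact: uniq_spectrum.
- exact: spectrum_on_sphere.
- exact: normc_coef_le.
- exact: H1 (leq_maxl _ _).
apply: le_trans (H2 K (leq_maxr _ _)); rewrite lee_fin.
have S0 : 0 <= \sum_(n <- spectrum lam K) sqn (coef g K n).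
  by apply: sumr_ge0 => n _; apply: sqn_ge0.
(* Bessel's inequality on the grid comes with the factor (step * gridn)^3 = (2 pi)^3, which is at
   least 1 and is given away. *)
apply: le_trans (_ : _ <= (2 * pi) ^+ 3 * \sum_(n <- spectrum lam K) sqn (coef g K n)) _.
  rewrite ler_peMl// exprn_ege1//; have := pi_ge2 R; clear; lra.
rewrite -(stepJ K) exprMn [_%:R ^+ 3 * _]mulrC -mulrA; apply: ler_wpM2l.
  by rewrite exprn_ge0// ltW// step_gt0.
exact: sum_sqn_coef_le.
Qed.

Lemma unit_orthogonal v : dot3 v v = 1 -> exists2 b, dot3 b b = 1 & dot3 v b = 0.
Proof.
move=> v1; have [z|nz] := eqVneq (v.1.1 ^+ 2 + v.1.2 ^+ 2) 0.
  exists (1, 0, 0); rewrite /dot3 /= ?mulr0 ?mulr1 ?addr0//.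
  by move/eqP: z; rewrite paddr_eq0 ?sqr_ge0// sqrf_eq0 => /andP[/eqP].
pose n := Num.sqrt (v.1.1 ^+ 2 + v.1.2 ^+ 2).
have n2 : n ^+ 2 = v.1.1 ^+ 2 + v.1.2 ^+ 2 by rewrite sqr_sqrtr// addr_ge0 ?sqr_ge0.
have n0 : n != 0 by rewrite -sqrf_eq0 n2.
exists (- v.1.2 / n, v.1.1 / n, 0); rewrite /dot3 /=; last by field.
have -> : - v.1.2 / n * (- v.1.2 / n) + v.1.1 / n * (v.1.1 / n) + 0 * 0 =
  (v.1.1 ^+ 2 + v.1.2 ^+ 2) / n ^+ 2 by field.
by rewrite n2 divff.
Qed.

Definition scale3 (a : R) v : R * R * R := (a * v.1.1, a * v.1.2, a * v.2).

Lemma normalize3 v : v != 0 -> exists2 t, dot3 t t = 1 & exists2 a, a != 0 & v = scale3 a t.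
Proof.
move=> v0; pose n := Num.sqrt (dot3 v v).
have n2 : n ^+ 2 = dot3 v v by rewrite sqr_sqrtr// dot3_ge0.
have n0 : n != 0 by rewrite -sqrf_eq0 n2; apply: contraNneq v0 => /dot3_eq0 ->.
exists (scale3 n^-1 v).
  have -> : dot3 (scale3 n^-1 v) (scale3 n^-1 v) = dot3 v v / n ^+ 2.
    by rewrite /dot3 /scale3 /=; field.
  by rewrite -n2 divff// sqrf_eq0.
exists n => //; case: v {v0 n2} @n n0 => [[a b] c] n n0; rewrite /scale3 /=.
by congr (_, _, _); field.
Qed.

Lemma line_direction (V : 'M[R]_(1, 3)) : row_free V -> exists2 t, dot3 t t = 1 &
  forall u, exists a, forall p, p + u *m V = vec3 (lin3 (tr3 p) a t 0 t).
Proof.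
move=> fV; pose v : R * R * R := tr3 (row 0 V).
have [|t t1 [a a0 va]] := @normalize3 v.
  apply/eqP => v0; have : row 0 V = 0.
    rewrite -[row 0 V]tr3K -/v v0; apply/rowP => i.
    have [h1 h2 h3] := @vec3E R 0; rewrite [RHS]mxE.
    by have [->|->|->] := ord3P i; rewrite ?(h1, h2, h3).
  move=> r0; have := mulmx_free_eq0 (1%:M : 'M[R]_1) fV; rewrite mul1mx => /esym.
  suff -> : V = 0 by rewrite eqxx oner_eq0.
  by apply/row_matrixP => i; rewrite (ord1 i) r0 row0.
exists t => // u; exists (u 0 0 * a) => p.
rewrite -[LHS]tr3K; congr vec3; move: va; rewrite /v /tr3 /scale3 /lin3 /= => -[].
rewrite !mxE !big_ord_recl !big_ord0 !addr0 => -> -> ->.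
by rewrite !mulrA !mul0r !addr0.
Qed.

(** Gram-Schmidt on the two rows of V. *)
Lemma plane_directions (V : 'M[R]_(2, 3)) : row_free V -> exists t t',
  [/\ dot3 t t = 1, dot3 t' t' = 1, dot3 t t' = 0 &
  forall u, exists a b, forall p, p + u *m V = vec3 (lin3 (tr3 p) a t b t')].
Proof.
move=> fV.
pose v : R * R * R := tr3 (row 0 V); pose w : R * R * R := tr3 (row 1 V).
have comb a b : scale3 a v + scale3 b w = 0 -> a = 0 /\ b = 0.
  move=> ab; pose u : 'rV[R]_2 := \row_i (if i == 0 then a else b).
  have : u *m V == 0.
    apply/eqP; rewrite -[LHS]tr3K; rewrite -[RHS]tr3K; congr vec3.
    rewrite /tr3 !mxE !big_ord_recl !big_ord0 !mxE /= !addr0.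
    move: ab; rewrite /v /w /tr3 /scale3 /= !mxE => -[].
    have -> : lift ord0 ord0 = 1 :> 'I_2 by apply/val_inj.
    by move=> -> -> ->.
  rewrite mulmx_free_eq0// => /eqP u0; split.
    by have /rowP/(_ 0) := u0; rewrite !mxE.
  by have /rowP/(_ 1) := u0; rewrite !mxE.
have [|t t1 [al al0 va]] := @normalize3 v.
  apply/eqP => v0; have [|/eqP + _] := comb 1 0; last by rewrite oner_eq0.
  by rewrite v0 /scale3 /= !mulr0 !mul0r; congr (_, _, _); rewrite addr0.
pose w' := w - scale3 (dot3 t w) t.
have [|t' t'1 [be be0 w'b]] := @normalize3 w'.
  apply/eqP => w0; have [|_ /eqP] := comb (- (dot3 t w / al)) 1; last by rewrite oner_eq0.
  rewrite -[RHS]w0 /w' va; move: (w) (dot3 t w) => [[w1 w2] w3] d; rewrite /scale3 /=.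
  by apply: triple_eq => /=; field.
have tw : dot3 t w' = 0.
  rewrite /w'; have -> : dot3 t (w - scale3 (dot3 t w) t) = dot3 t w - dot3 t w * dot3 t t.
    by rewrite /dot3 /scale3 /=; ring.
  by rewrite t1 mulr1 subrr.
have tt' : dot3 t t' = 0.
  move: tw; rewrite w'b; have -> : dot3 t (scale3 be t') = be * dot3 t t'.
    by rewrite /dot3 /scale3 /=; ring.
  by move/eqP; rewrite mulf_eq0 (negPf be0) => /eqP.
exists t, t'; split => // u; exists (u 0 0 * al + u 0 1 * dot3 t w), (u 0 1 * be) => p.
have wE : w = scale3 (dot3 t w) t + scale3 be t' by rewrite -w'b addrC subrK.
rewrite -[LHS]tr3K; congr vec3; rewrite /tr3 !mxE !big_ord_recl !big_ord0 !addr0.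
have -> : lift ord0 ord0 = 1 :> 'I_2 by apply/val_inj.
move: va wE; rewrite {1}/v {1}/w /tr3 /scale3 /= !mxE => -[-> -> ->] [-> -> ->].
by rewrite /lin3 /=; congr (_, _, _); ring.
Qed.

Lemma dot3_ball t c x (C0 : R) : dot3 t t = 1 -> enorm (x - c) <= C0 ->
  `|dot3 (tr3 x - tr3 c) t| <= C0.
Proof.
move=> t1 xc; have C00 : 0 <= C0 by apply: le_trans xc; apply: sqrtr_ge0.
apply: norm_le_sqr => //; apply: le_trans (dot3_CS _ _) _; rewrite t1 mulr1.
rewrite -[x - c]tr3K in xc; rewrite enorm_vec3 in xc.
have -> : tr3 x - tr3 c = tr3 (x - c) by rewrite /tr3 !mxE.
have -> : dot3 (tr3 (x - c)) (tr3 (x - c)) = Num.sqrt (dot3 (tr3 (x - c)) (tr3 (x - c))) ^+ 2.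
  by rewrite sqr_sqrtr// dot3_ge0.
by rewrite lerXn2r ?nnegrE ?sqrtr_ge0.
Qed.

(** The ball containing S projects on the direction t to an interval of length 2 C0; the base point
    is moved to its lower end so that coordinates start at 0. *)
Lemma geodesic_segment (C0 : R) (S : set 'rV[R]_3) : geodesic_submanifold C0 1 S ->
  exists q t, dot3 t t = 1 /\
    forall x, S x -> exists2 a, 0 <= a <= 2 * C0 & x = vec3 (lin3 q a t 0 t).
Proof.
move=> [[p [V [U [fV _ SE]]]] _ [c Sc]]; have [t t1 H] := line_direction fV.
pose a0 := dot3 (tr3 c - tr3 p) t - C0.
exists (lin3 (tr3 p) a0 t 0 t), t; split => // x Sx.
have := Sc _ Sx; have := Sx; rewrite {1}SE => -[[u _ <-] _].
have [a -> /(dot3_ball t1)] := H u; rewrite vec3K => xc.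
exists (a - a0); last first.
  by congr vec3; rewrite /lin3 /=; congr (_, _, _); ring.
have E : dot3 (lin3 (tr3 p) a t 0 t - tr3 c) t = a * dot3 t t - dot3 (tr3 c - tr3 p) t.
  by rewrite /dot3 /lin3 /=; ring.
rewrite E t1 mulr1 ler_norml in xc; rewrite /a0; move: xc; clear => /andP[? ?].
by apply/andP; split; lra.
Qed.

Lemma geodesic_square (C0 : R) (S : set 'rV[R]_3) : geodesic_submanifold C0 2 S ->
  exists q t t', [/\ dot3 t t = 1, dot3 t' t' = 1, dot3 t t' = 0 &
    forall x, S x -> exists a b, [/\ 0 <= a <= 2 * C0, 0 <= b <= 2 * C0 &
      x = vec3 (lin3 q a t b t')]].
Proof.
move=> [[p [V [U [fV _ SE]]]] _ [c Sc]].
have [t [t' [t1 t'1 tt' H]]] := plane_directions fV.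
pose a0 := dot3 (tr3 c - tr3 p) t - C0; pose b0 := dot3 (tr3 c - tr3 p) t' - C0.
exists (lin3 (tr3 p) a0 t b0 t'), t, t'; split => // x Sx.
have := Sc _ Sx; have := Sx; rewrite {1}SE => -[[u _ <-] _].
have [a [b ->]] := H u => xc.
have := dot3_ball t1 xc; have := dot3_ball t'1 xc; rewrite vec3K => {xc}.
have -> : dot3 (lin3 (tr3 p) a t b t' - tr3 c) t' =
    a * dot3 t t' + b * dot3 t' t' - dot3 (tr3 c - tr3 p) t'.
  by rewrite /dot3 /lin3 /=; ring.
have -> : dot3 (lin3 (tr3 p) a t b t' - tr3 c) t =
    a * dot3 t t + b * dot3 t t' - dot3 (tr3 c - tr3 p) t.
  by rewrite /dot3 /lin3 /=; ring.
rewrite t1 t'1 tt' mulr1 !mulr0 add0r addr0 !mulr1 !ler_norml => /andP[h1 h2] /andP[h3 h4].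
exists (a - a0), (b - b0); split; last first.
- by congr vec3; rewrite /lin3 /=; congr (_, _, _); ring.
- by rewrite /b0; move: h1 h2; clear => ? ?; apply/andP; split; lra.
- by rewrite /a0; move: h3 h4; clear => ? ?; apply/andP; split; lra.
Qed.

End geodesics.

(** * From sampled waves to integrals over geodesics *)

Section geodesic_estimates.
Context {R : realType}.
Implicit Types (S : set 'rV[R]_3) (e : 'rV[R]_3 -> R[i]).

Definition geodesic_square_integral (k : nat) S e : \bar R :=
  let H := hausdorff_measure R 3 k in
  (\int[(H : {measure set (caratheodory_type H) -> \bar R})]_x
    (((fun x => sqn (e x)) \_ S) x)%:E)%E.

Lemma geodesic_square_integral_ge0 k S e : (0 <= geodesic_square_integral k S e)%E.
Proof.
apply: integral_ge0 => x _; rewrite lee_fin patchE; case: ifP => // _.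
exact: sqn_ge0.
Qed.

Lemma geodesic_square_integral_le (k : nat) S e (I : finType) (Q : I -> set 'rV[R]_3)
    (M : I -> R) (a : R) :
  0 <= a -> (forall i, 0 <= M i) -> (forall x, S x -> exists i, Q i x) ->
  (forall i, (hausdorff k (Q i) <= a%:E)%E) -> (forall i x, Q i x -> sqn (e x) <= M i) ->
  (geodesic_square_integral k S e <= (a * \sum_i M i)%:E)%E.
Proof.
move=> a0 M0 SQ Qa eM.
apply: (@le_trans _ _ (\sum_(i < #|I|) (M (enum_val i))%:E *
    hausdorff_measure R 3 k (Q (enum_val i)))%E).
  apply: caratheodory_integral_le => //.
  - by move=> x; rewrite lee_fin patchE; case: ifP => // _; apply: sqn_ge0.
  - move=> i x Qx; rewrite patchE lee_fin; case: ifP => // _; exact: eM.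
  move=> x nQ; rewrite patchE memNset// => /SQ[i Qi].
  by apply: (nQ (enum_rank i)); rewrite enum_rankK.
apply: (@le_trans _ _ (\sum_(i < #|I|) (M (enum_val i) * a)%:E)%E).
  by apply: lee_sum => i _; rewrite EFinM; apply: lee_wpmul2l; [rewrite lee_fin|exact: Qa].
rewrite sumEFin lee_fin -mulr_suml mulrC ler_wpM2l//.
by rewrite -(big_enum_val (fun i => M i)).
Qed.

Lemma mesh_exists (T h0 : R) : 0 < T -> 0 < h0 -> exists (L : nat) (h : R),
  [/\ (0 < L)%N, 0 < h, T = L%:R * h & h <= h0].
Proof.
move=> T0 h00; pose L := (Num.truncn (T / h0)).+1.
exists L, (T / L%:R); split => //; first by rewrite divr_gt0.
  by rewrite mulrC divfK// pnatr_eq0.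
rewrite ler_pdivrMr ?ltr0n// mulrC -ler_pdivrMr//.
exact: ltW (truncnS_gt _).
Qed.

Lemma unit_coord_le (t : R * R * R) : dot3 t t = 1 ->
  [/\ `|t.1.1| <= 1, `|t.1.2| <= 1 & `|t.2| <= 1].
Proof.
move=> t1; have E : t.1.1 ^+ 2 + t.1.2 ^+ 2 + t.2 ^+ 2 = 1 by rewrite -t1 /dot3 !expr2.
have := sqr_ge0 t.1.1; have := sqr_ge0 t.1.2; have := sqr_ge0 t.2.
by split; apply: norm_le_sqr => //; rewrite expr1n; lra.
Qed.

Lemma near3_lin3 (q t t' : R * R * R) (a b u u' h : R) : dot3 t t = 1 -> dot3 t' t' = 1 ->
  0 <= u <= h -> 0 <= u' <= h ->
  near3 (2 * h) (lin3 q (a + u) t (b + u') t') (lin3 q a t b t').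
Proof.
move=> /unit_coord_le[t1 t2 t3] /unit_coord_le[s1 s2 s3] /andP[u0 uh] /andP[v0 vh].
have main (x y z : R) : `|x| <= 1 -> `|y| <= 1 ->
    `|z + (a + u) * x + (b + u') * y - (z + a * x + b * y)| <= 2 * h.
  move=> x1 y1; have -> : z + (a + u) * x + (b + u') * y - (z + a * x + b * y) =
    u * x + u' * y by ring.
  apply: le_trans (ler_normD _ _) _; rewrite !normrM (ger0_norm u0) (ger0_norm v0).
  have -> : 2 * h = h * 1 + h * 1 by ring.
  by rewrite lerD// ler_pM.
by split; apply: main.
Qed.

Lemma plane_cell_near (q t t' : R * R * R) (a b h h' : R) (x : 'rV[R]_3) : h' <= h ->
  dot3 t t = 1 -> dot3 t' t' = 1 -> plane_cell q t t' a b h h' x ->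
  exists2 y, near3 (2 * h) y (lin3 q a t b t') & x = vec3 y.
Proof.
move=> hh t1 t'1 [u uI [u' u'I <-]]; exists (lin3 q (a + u) t (b + u') t') => //.
move: uI u'I; rewrite /= !in_itv /= => uh /andP[u'0 u'h].
by apply: near3_lin3 => //; rewrite u'0 (le_trans u'h).
Qed.

(** The passage to the limit d -> 0. [A] is the square sum of the coefficients of a wave that itself
    depends on d. *)
Lemma le_limit_bound (X I : \bar R) (D E : R) : 0 <= D -> 0 <= E -> (0 <= I)%E ->
  (forall d, 0 < d <= 1 -> exists2 A : R, (A%:E <= I + d%:E)%E &
     (X <= (D * A + E * d)%:E)%E) ->
  (X <= D%:E * I)%E.
Proof.
move=> D0 E0 I0 H; apply/lee_addgt0Pr => om om0.
have DE : 0 < D + E + 1 by rewrite ltr_wpDl// addr_ge0.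
pose d := Num.min 1 (om / (D + E + 1)).
have d0 : 0 < d <= 1 by rewrite lt_min ltr01 divr_gt0//= ge_min lexx.
have [A AI XA] := H d d0; apply: le_trans XA _.
have : (D%:E * A%:E <= D%:E * (I + d%:E))%E by apply: lee_wpmul2l; rewrite ?lee_fin.
rewrite ge0_muleDr ?lee_fin ?(ltW (andP d0).1)// -!EFinM EFinD => h.
apply: le_trans (leeD h (lexx _)) _; rewrite -addeA leeD2l// -EFinD lee_fin.
rewrite -mulrDl; apply: le_trans (_ : (D + E + 1) * d <= _).
  by apply: ler_wpM2r; [case/andP: d0 => /ltW|rewrite lerDl].
by rewrite mulrC -ler_pdivlMr// ge_min lexx orbT.
Qed.

Lemma mesh_condition (lam B d : R) (m : nat) : 1 <= lam -> 0 <= B -> 0 < d ->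
  exists2 h0 : R, 0 < h0 & forall h, 0 < h <= h0 ->
    lam * h <= 1 /\ m%:R * (B * (3 * lam * (2 * h))) <= d.
Proof.
move=> l1 B0 d0; have l0 : 0 < lam by apply: lt_le_trans l1.
pose N := m%:R * (B * (3 * lam * 2)) + 1.
have N0 : 0 < N by rewrite ltr_wpDl// !mulr_ge0// ltW.
exists (Num.min lam^-1 (d / N)); first by rewrite lt_min invr_gt0 l0 divr_gt0.
move=> h /andP[h0]; rewrite le_min => /andP[h1 h2]; split.
  by rewrite mulrC -ler_pdivlMr// mul1r.
rewrite ler_pdivlMr// in h2; apply: le_trans h2; rewrite /N mulrDr mulr1.
have -> : m%:R * (B * (3 * lam * (2 * h))) = h * (m%:R * (B * (3 * lam * 2))) by ring.
by rewrite lerDl ltW.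
Qed.

Lemma sampling_const_ge0 (T : R) : 0 <= T -> 0 <= sampling_const T.
Proof.
move=> T0; exact: (addr_ge0 (mulr_ge0 (ler0n R 6) T0) (mulr_ge0 (ler0n R 72) (ler0n R 4096))).
Qed.

(* The bound for sampled waves passes to the eigenfunction as the mesh [h] tends to 0; the total
   mass [a * #|I|] of the cells only multiplies an error term, so [V] does not enter. *)
Lemma restriction_of_sampling (k : nat) (lam T A V : R) S e : 1 <= lam -> 1 <= T -> 0 <= A ->
  0 <= V -> eigenfunction lam e ->
  (forall (L : nat) (h : R), (0 < L)%N -> 0 < h -> T = L%:R * h -> lam * h <= 1 ->
    exists (I : finType) (Q : I -> set 'rV[R]_3) (z : I -> R * R * R) (a : R),
    [/\ 0 <= a /\ a * #|I|%:R <= V, forall x, S x -> exists i, Q i x,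
      forall i, (hausdorff k (Q i) <= a%:E)%E,
      forall i x, Q i x -> exists2 y, near3 (2 * h) y (z i) & x = vec3 y &
      forall c s, uniq s -> on_sphere lam s ->
        a * \sum_i sqn (wave c s (z i)) <= A * \sum_(n <- s) sqn (c n)]) ->
  (geodesic_square_integral k S e <= (2 * A)%:E * torus_square_integral (e \o @vec3 R))%E.
Proof.
move=> l1 T1 A0 V0 eig H; have l0 : 0 <= lam by apply: le_trans l1.
apply: (@le_limit_bound _ _ _ (8 * V)).
- exact: mulr_ge0.
- exact: mulr_ge0.
- exact: torus_square_integral_ge0.
move=> d /andP[d0 d1].
have [s [c [B [us ss cB ew cI]]]] := eigenfunction_wave l1 eig d0.
exists (\sum_(n <- s) sqn (c n)) => //.
have B0 : 0 <= B by apply: le_trans (cB (0, 0, 0)); apply: normc_ge0.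
have [h0 h00 hP] := mesh_condition (size s) l1 B0 d0.
have [L [h [L0 h_gt0 TL hh0]]] := mesh_exists (lt_le_trans ltr01 T1) h00.
have [lh sd] : lam * h <= 1 /\ (size s)%:R * (B * (3 * lam * (2 * h))) <= d.
  by apply: hP; rewrite h_gt0.
have [I [Q [z [a [[a0 aV] SQ Qa Qz zs]]]]] := H L h L0 h_gt0 TL lh.
have := @geodesic_square_integral_le k S e I Q
  (* On a cell the eigenfunction differs from the sampled value by at most 2 d: d from the
     approximation and d from the variation of the wave. *)
  (fun i => 2 * sqn (wave c s (z i)) + 8 * d ^+ 2) a a0.
move=> /(_ _ SQ Qa _)/le_trans; apply.
- by move=> i; apply: addr_ge0; apply: mulr_ge0; rewrite ?sqn_ge0 ?sqr_ge0.
- move=> i x /Qz[y yz ->].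
  have d2 := le_trans (wave_near l0 ss cB yz) sd.
  have -> : e (vec3 y) = wave c s (z i) +
      ((e (vec3 y) - wave c s y) + (wave c s y - wave c s (z i))) by ring.
  apply: le_trans (sqnD_le _ _) _; rewrite lerD2l.
  have -> : 8 * d ^+ 2 = 2 * (d + d) ^+ 2 by ring.
  rewrite ler_pM2l// -normc_sqr lerXn2r ?nnegrE ?normc_ge0 ?(addr_ge0 (ltW d0) (ltW d0))//.
  by apply: le_trans (le_normcD _ _) _; apply: lerD.
rewrite lee_fin big_split /= mulrDr -mulr_sumr mulrCA.
have -> : \sum_(i : I) 8 * d ^+ 2 = #|I|%:R * (8 * d ^+ 2).
  by rewrite sumr_const -[LHS]mulr_natl.
apply: lerD.
  by rewrite -mulrA ler_pM2l//; apply: zs.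
have -> : a * (#|I|%:R * (8 * d ^+ 2)) = a * #|I|%:R * 8 * d ^+ 2 by ring.
rewrite [8 * V]mulrC; apply: ler_pM; rewrite ?sqr_ge0 ?mulr_ge0//.
  by rewrite ler_pM2r.
by rewrite expr2 ler_piMl// ltW.
Qed.

Lemma geodesic1_square_integral_le (lam mu K C0 : R) S e : 1 <= mu -> mu ^+ 6 = lam ->
  coplanar_bound lam K -> 3 <= C0 -> eigenfunction lam e -> geodesic_submanifold C0 1 S ->
  (geodesic_square_integral 1 S e <=
   (2 * (2 * sampling_const (3 * C0) * (17161 * mu ^+ 4 * K) * 6))%:E *
     torus_square_integral (e \o @vec3 R))%E.
Proof.
move=> mu1 muE KP C03 eig gS.
(* The sampled length is 3 C0 because coordinates reach 2 C0 and [mesh_index] requires them to be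
   strictly below the end of the mesh. *)
have T1 : 1 <= 3 * C0 by move: C03; clear; lra.
have T0 := le_trans ler01 T1.
have [q [t [t1 St]]] := geodesic_segment gS.
have [b b1 tb] := unit_orthogonal t1.
have l1 : 1 <= lam by rewrite -muE exprn_ege1.
apply: (restriction_of_sampling l1 T1 _ T0 eig).
  exact: (mulr_ge0 (mulr_ge0 (mulr_ge0 (ler0n R 2) (sampling_const_ge0 T0)) (mulr_ge0 (mulr_ge0
    (ler0n R 17161) (exprn_ge0 4 (le_trans ler01 mu1))) (coplanar_bound_ge0 KP))) (ler0n R 6)).
move=> L h L0 h0 TL lh.
exists 'I_L, (fun i : 'I_L => plane_cell q t t (i%:R * h) 0 h 0),
  (fun i : 'I_L => lin3 q (i%:R * h) t 0 t), h.
split.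
- by rewrite card_ord mulrC -TL ltW.
- move=> x /St[a /andP[a0 aC] ->].
  have [|i [u uh ->]] := @mesh_index R L h a h0.
    by rewrite a0 -TL; move: aC C03; clear; lra.
  exists i; exists u; first by rewrite /= in_itv.
  by exists 0; rewrite /= ?in_itv /= ?lexx// addr0.
- by move=> i; apply: hausdorff_plane_cell1.
- by move=> i x; apply: plane_cell_near => //; apply: ltW.
by move=> c s us ss; apply: sampled_wave1 muE KP t1 b1 tb us ss h0 lh L0 T1 TL.
Qed.

Lemma geodesic2_square_integral_le (lam mu K C0 : R) S e : 1 <= mu -> mu ^+ 6 = lam ->
  coplanar_bound lam K -> 3 <= C0 -> eigenfunction lam e -> geodesic_submanifold C0 2 S ->
  (geodesic_square_integral 2 S e <=
   (2 * (pi * (sampling_const (3 * C0) ^+ 2 * (8 * mu * K) * 36)))%:E *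
     torus_square_integral (e \o @vec3 R))%E.
Proof.
move=> mu1 muE KP C03 eig gS.
have T1 : 1 <= 3 * C0 by move: C03; clear; lra.
have p0 : 0 <= pi :> R by apply: pi_ge0.
have [q [t [t' [t1 t'1 tt' St]]]] := geodesic_square gS.
have l1 : 1 <= lam by rewrite -muE exprn_ege1.
apply: (restriction_of_sampling l1 T1 _ (mulr_ge0 p0 (sqr_ge0 (3 * C0))) eig).
  exact: (mulr_ge0 p0 (mulr_ge0 (mulr_ge0 (sqr_ge0 _) (mulr_ge0 (mulr_ge0 (ler0n R 8)
    (le_trans ler01 mu1)) (coplanar_bound_ge0 KP))) (ler0n R 36))).
move=> L h L0 h0 TL lh.
exists ('I_L * 'I_L)%type,
  (fun i : 'I_L * 'I_L => plane_cell q t t' (i.1%:R * h) (i.2%:R * h) h h),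
  (fun i : 'I_L * 'I_L => lin3 q (i.1%:R * h) t (i.2%:R * h) t'), (pi * h ^+ 2); split.
- split; first exact: mulr_ge0 p0 (sqr_ge0 _).
  by rewrite card_prod card_ord natrM TL exprMn expr2 le_eqVlt; apply/orP; left; apply/eqP; ring.
- move=> x /St[a [b [/andP[a0 aC] /andP[b0 bC] ->]]].
  have [|i [u uh ->]] := @mesh_index R L h a h0.
    by rewrite a0 -TL; move: aC C03; clear; lra.
  have [|j [v vh ->]] := @mesh_index R L h b h0.
    by rewrite b0 -TL; move: bC C03; clear; lra.
  exists (i, j); exists u; first by rewrite /= in_itv.
  by exists v; rewrite /= ?in_itv.
- by move=> i; apply: hausdorff_plane_cell2.
- by move=> i x; apply: plane_cell_near.
move=> c s us ss.
have := sampled_wave2 c q mu1 muE KP t1 t'1 tt' us ss h0 lh L0 T1 TL.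
rewrite pair_bigA /= => H.
by rewrite -[leLHS]mulrA -[leRHS]mulrA; apply: (ler_wpM2l p0).
Qed.

End geodesic_estimates.

Lemma sqrt_bound (R : realType) (X I : \bar R) (E lam x : R) : 0 <= E -> 0 <= lam ->
  (0 <= X)%E -> (0 <= I)%E -> (X <= (E * lam `^ (2 * x))%:E * I)%E ->
  (X `^ 2^-1 <= (E `^ 2^-1 * lam `^ x)%:E * I `^ 2^-1)%E.
Proof.
move=> E0 l0 X0 I0 XI.
have EP : 0 <= E * lam `^ (2 * x) by rewrite mulr_ge0// powR_ge0.
apply: le_trans (_ : (((E * lam `^ (2 * x))%:E * I) `^ 2^-1 <= _)%E).
  by apply: gt0_ler_poweR => //; rewrite in_itv /= leey ?X0// mule_ge0.
rewrite poweRM// poweR_EFin powRM ?powR_ge0// -powRrM mulrAC divff ?pnatr_eq0//.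
by rewrite mul1r.
Qed.

Lemma powR_sixth (R : realType) (lam : R) (n : nat) : 0 <= lam ->
  (lam `^ 6^-1) ^+ n = lam `^ (n%:R / 6).
Proof. by move=> l0; rewrite -powR_mulrn ?powR_ge0// -powRrM mulrC. Qed.

Unset Implicit Arguments.

Theorem theorem4 (R : realType) (C0 : R) (hC0 : 3 <= C0)
    (eps : R) (heps : 0 < eps) :
  exists C : R, 0 < C /\
    forall (lambda : R) (e : 'rV[R]_3 -> R[i]),
      1 < lambda -> eigenfunction lambda e ->
      (forall S : set 'rV[R]_3, geodesic_submanifold C0 1 S ->
        (L2norm_geodesic 1 S e <=
           (C * lambda `^ (3^-1 + eps))%:E * L2norm_torus e)%E) /\
      (forall S : set 'rV[R]_3, geodesic_submanifold C0 2 S ->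
        (L2norm_geodesic 2 S e <=
           (C * lambda `^ (12^-1 + eps))%:E * L2norm_torus e)%E).
Proof.
(* The estimates concern squared norms, so the coplanar count may lose lam^(2 eps). *)
have e2 : 0 < 2 * eps by rewrite mulr_gt0.
have [A A0 AP] := coplanar_bound_eps e2.
pose sc := sampling_const (3 * C0).
have sc0 : 0 <= sc.
  by apply: sampling_const_ge0; apply: mulr_ge0 => //; apply: le_trans hC0.
pose E1 := 2 * (2 * sc * (17161 * A) * 6); pose E2 := 2 * (pi * (sc ^+ 2 * (8 * A) * 36)).
have E10 : 0 <= E1.
  exact: (mulr_ge0 (ler0n R 2) (mulr_ge0 (mulr_ge0 (mulr_ge0 (ler0n R 2) sc0)
    (mulr_ge0 (ler0n R 17161) (ltW A0))) (ler0n R 6))).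
have E20 : 0 <= E2.
  exact: (mulr_ge0 (ler0n R 2) (mulr_ge0 (pi_ge0 R) (mulr_ge0 (mulr_ge0 (sqr_ge0 sc)
    (mulr_ge0 (ler0n R 8) (ltW A0))) (ler0n R 36)))).
pose E := E1 + E2 + 1.
have E0 : 0 < E by rewrite ltr_wpDl// addr_ge0.
exists (E `^ 2^-1); split; first exact: powR_gt0.
move=> lam e l1 eig; have l0 : 0 <= lam by apply: ltW; apply: lt_trans l1.
pose mu := lam `^ 6^-1.
have mu1 : 1 <= mu by rewrite -(powRr0 lam); apply: ler_powR; [exact: ltW|rewrite invr_ge0].
have mu6 : mu ^+ 6 = lam by rewrite powR_sixth// divff ?pnatr_eq0// powRr1.
have ln0 : lam != 0 by rewrite gt_eqF// (lt_trans _ l1).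
have KP := AP lam (ltW l1).
have TE : L2norm_torus e = (torus_square_integral (e \o @vec3 R) `^ 2^-1)%E.
  exact: L2normE.
have GE k S : L2norm_geodesic k S e = (geodesic_square_integral k S e `^ 2^-1)%E.
  exact: L2normE.
have mono (D x : R) : 0 <= D -> D <= E -> 
    ((D * lam `^ (2 * x))%:E * torus_square_integral (e \o @vec3 R) <=
     (E * lam `^ (2 * x))%:E * torus_square_integral (e \o @vec3 R))%E.
  move=> D0 DE; apply: lee_wpmul2r; first exact: torus_square_integral_ge0.
  by rewrite lee_fin; apply: ler_wpM2r => //; apply: powR_ge0.
split=> S gS; rewrite GE TE; apply: (sqrt_bound (ltW E0) l0).
- exact: geodesic_square_integral_ge0.
- exact: torus_square_integral_ge0.
- apply: le_trans (mono E1 _ E10 _); last by rewrite /E -addrA lerDl addr_ge0.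
  apply: le_trans (geodesic1_square_integral_le mu1 mu6 KP hC0 eig gS) _.
  rewrite le_eqVlt; apply/orP; left; apply/eqP; congr (_%:E * _)%E.
  (* Twice 1/3 is 4/6, the exponent of the slab count. *)
  have -> : lam `^ (2 * (3^-1 + eps)) = mu ^+ 4 * lam `^ (2 * eps).
    by rewrite (powR_sixth 4 l0) -powRD ?(implybT, ln0)//; congr (_ `^ _); field.
  by rewrite /E1 /sc; ring.
- exact: geodesic_square_integral_ge0.
- exact: torus_square_integral_ge0.
apply: le_trans (mono E2 _ E20 _); last by rewrite /E addrAC lerDr addr_ge0.
apply: le_trans (geodesic2_square_integral_le mu1 mu6 KP hC0 eig gS) _.
rewrite le_eqVlt; apply/orP; left; apply/eqP; congr (_%:E * _)%E.
(* Twice 1/12 is 1/6, the exponent of the tube count. *)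
have -> : lam `^ (2 * (12^-1 + eps)) = mu * lam `^ (2 * eps).
  by rewrite /mu -powRD ?(implybT, ln0)//; congr (_ `^ _); field.
by rewrite /E2 /sc; ring.
Qed.
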